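(* Let $J\in(L^2(\mathbb R^3))^3$ have compact support and be divergence free, i.e. $\operatorname{div}J=0$. Let $E_\infty(\hat x,k)$, $\hat x\in\mathbb S^2$, $k>0$, be the electric far field pattern of $J$, and define $$\mathcal I_E(z):=\frac{-i\sqrt{\varepsilon}}{2\pi^2}\int_{\mathbb S^2}\int_0^{+\infty}E_{\infty}(\hat x,k)\,e^{ik\hat x\cdot z}\,k\,dk\,ds_{\hat x},\quad z\in\mathbb R^3.$$ Then $\mathcal I_E=J$.
   Context: $\varepsilon>0$ (electric permittivity) is a constant. $\mathbb S^2$ is the unit sphere in $\mathbb R^3$ and $ds_{\hat x}$ its surface measure. The electric far field pattern of $J$ at wave number $k>0$ is $$E_{\infty}(\hat x,k)=\frac{ik}{4\pi\sqrt{\varepsilon}}\,\hat x\times\left(\int_{\mathbb R^3}e^{-ik\hat x\cdot y}J(y)\,dy\times\hat x\right),\quad \hat x\in\mathbb S^2.$$ $\operatorname{div}J=0$ is understood in the sense of distributions on $\mathbb R^3$. The integral defining $\mathcal I_E$ is understood in the inverse Fourier–Plancherel sense: it is the limit in $(L^2(\mathbb R^3))^3$ as $R\to+\infty$ of the integrals with $\int_0^{+\infty}dk$ replaced by $\int_0^{R}dk$; equality is in $(L^2(\mathbb R^3))^3$. *)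

(* Defs.v *)
From mathcomp Require Import all_boot all_order all_algebra.
From mathcomp Require Import all_classical all_reals all_analysis.
From mathcomp Require Import complex.

Set Implicit Arguments.
Unset Strict Implicit.
Unset Printing Implicit Defensive.

Import Order.TTheory GRing.Theory Num.Theory.
Import numFieldNormedType.Exports.

Local Open Scope classical_set_scope.
Local Open Scope ring_scope.
Local Open Scope complex_scope.

(* Points of R^3 are triples, which carry the product topology, the product
   Borel sigma-algebra and the product Lebesgue measure of the library.
   Vectors of C^3 are row vectors over R[i]. *)
Definition R3 (R : realType) : Type :=
  (measurableTypeR R * measurableTypeR R * measurableTypeR R)%type.

Definition leb2 (R : realType) :
    {measure set (measurableTypeR R * measurableTypeR R)%type -> \bar R} :=
  (@lebesgue_measure R \x @lebesgue_measure R)%E.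

Definition leb3 (R : realType) : {measure set (R3 R) -> \bar R} :=
  (@lebesgue_measure R \x @lebesgue_measure R \x @lebesgue_measure R)%E.

Definition vec (R : realType) (x : R3 R) : 'rV[R]_3 :=
  \row_(j < 3) [:: x.1.1; x.1.2; x.2]`_j.

Definition std_basis (R : realType) (j : 'I_3) : R3 R :=
  ((j == 0)%:R, (j == 1)%:R, (j == 2)%:R).

Definition dot (F : pzRingType) (u v : 'rV[F]_3) : F :=
  \sum_(j < 3) u 0 j * v 0 j.

(* The indices j + 1 and j + 2 are computed in 'I_3, that is, modulo 3. *)
Definition cross (F : pzRingType) (u v : 'rV[F]_3) : 'rV[F]_3 :=
  \row_(j < 3) (u 0 (j + 1) * v 0 (j + 2) - u 0 (j + 2) * v 0 (j + 1)).

Definition expi (R : realType) (t : R) : R[i] := cos t +i* sin t.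

Definition cnorm (R : realType) (v : 'rV[R[i]]_3) : R :=
  Num.sqrt (\sum_(j < 3) (complex.Re (v 0 j) ^+ 2 + complex.Im (v 0 j) ^+ 2)).

Definition cintegral d (T : measurableType d) (R : realType)
    (mu : {measure set T -> \bar R}) (D : set T) (f : T -> R[i]) : R[i] :=
  (\int[mu]_(x in D) complex.Re (f x)) +i* (\int[mu]_(x in D) complex.Im (f x)).

Definition vintegral d (T : measurableType d) (R : realType)
    (mu : {measure set T -> \bar R}) (D : set T) (f : T -> 'rV[R[i]]_3) :
    'rV[R[i]]_3 :=
  \row_(j < 3) cintegral mu D (fun x => f x 0 j).

(* Surface integral over the unit sphere in spherical coordinates: the area
   element of this parametrization is |d_theta x \times d_phi x| = sin theta. *)
Definition sphere_point (R : realType) (theta phi : R) : R3 R :=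
  (sin theta * cos phi, sin theta * sin phi, cos theta).

Definition sphere_integral (R : realType) (f : R3 R -> 'rV[R[i]]_3) :
    'rV[R[i]]_3 :=
  vintegral (leb2 R) (`[0, pi] `*` `[0, 2 * pi])
    (fun a => (sin a.1)%:C *: f (sphere_point a.1 a.2)).

(* (L^2(R^3))^3 at the level of representatives, measurable componentwise. *)
Definition L2norm (R : realType) (f : R3 R -> 'rV[R[i]]_3) : \bar R :=
  ('N[leb3 R]_2%:E[(fun x => (cnorm (f x))%:E)])%E.

Definition in_L2 (R : realType) (f : R3 R -> 'rV[R[i]]_3) : Prop :=
  (forall j : 'I_3,
    measurable_fun [set: R3 R] (fun x => complex.Re (f x 0 j)) /\
    measurable_fun [set: R3 R] (fun x => complex.Im (f x 0 j))) /\
  (L2norm f < +oo)%E.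

Definition L2_cvg_pinfty (R : realType) (F : R -> R3 R -> 'rV[R[i]]_3)
    (f : R3 R -> 'rV[R[i]]_3) : Prop :=
  (forall r, 0 < r -> in_L2 (F r)) /\
  L2norm (fun x => F r x - f x) @[r --> +oo] --> 0%E.

(* The support of the class of f modulo equality almost everywhere. *)
Definition ess_support (R : realType) (f : R3 R -> 'rV[R[i]]_3) : set (R3 R) :=
  ~` \bigcup_(U in [set U : set (R3 R) |
                open U /\ {ae leb3 R, forall x, U x -> f x = 0}]) U.

Definition partial (R : realType) (s : seq 'I_3) (phi : R3 R -> R) :
    R3 R -> R :=
  foldr (fun (j : 'I_3) (g : R3 R -> R) (x : R3 R) => 'D_(std_basis R j) g x)
    phi s.

Definition smooth (R : realType) (phi : R3 R -> R) : Prop :=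
  forall s : seq 'I_3, continuous (partial s phi) /\
    forall (j : 'I_3) (x : R3 R), derivable (partial s phi) x (std_basis R j).

(* Real-valued test functions; the complex-valued ones are their complex linear
   combinations. *)
Definition test_function (R : realType) (phi : R3 R -> R) : Prop :=
  smooth phi /\ compact (closure [set x | phi x != 0]).

Definition distr_div (R : realType) (J : R3 R -> 'rV[R[i]]_3) (phi : R3 R -> R)
    : R[i] :=
  - cintegral (leb3 R) [set: R3 R]
      (fun y => \sum_(j < 3) J y 0 j * ('D_(std_basis R j) phi y)%:C).

Definition divergence_free (R : realType) (J : R3 R -> 'rV[R[i]]_3) : Prop :=
  forall phi : R3 R -> R, test_function phi -> distr_div J phi = 0.

Definition cvec (R : realType) (x : R3 R) : 'rV[R[i]]_3 :=
  \row_(j < 3) (vec x 0 j)%:C.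

Definition E_far (R : realType) (eps : R) (J : R3 R -> 'rV[R[i]]_3)
    (x : R3 R) (k : R) : 'rV[R[i]]_3 :=
  ('i * k%:C / (4 * pi * Num.sqrt eps)%:C) *:
    cross (cvec x)
      (cross (vintegral (leb3 R) [set: R3 R]
                (fun y => expi (- (k * dot (vec x) (vec y))) *: J y))
             (cvec x)).

(* The integral defining I_E, with the wave numbers truncated at K. *)
Definition I_E (R : realType) (eps : R) (J : R3 R -> 'rV[R[i]]_3) (K : R)
    (z : R3 R) : 'rV[R[i]]_3 :=
  (- 'i * (Num.sqrt eps)%:C / (2 * pi ^+ 2)%:C) *:
    sphere_integral (fun x =>
      vintegral (@lebesgue_measure R) `]0, K]
        (fun k => (expi (k * dot (vec x) (vec z)) * k%:C) *: E_far eps J x k)).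

(* Main.v *)
From HB Require Import structures.
Require Import Defs.
From mathcomp Require Import all_boot all_order all_algebra.
From mathcomp Require Import all_classical all_reals all_analysis.
From mathcomp Require Import measurable_realfun.
From mathcomp Require Import complex ring lra.

Set Implicit Arguments.
Unset Strict Implicit.
Unset Printing Implicit Defensive.

Import Order.TTheory GRing.Theory Num.Theory.
Import numFieldNormedType.Exports.

Local Open Scope classical_set_scope.
Local Open Scope ring_scope.
Local Open Scope complex_scope.

(** Write F J (xi) for the integral of e^{-i xi.y} J(y) dy. The far field in direction x at wave
    number k involves only A = F J (k x): it is a constant times k times x cross (A cross x) = |x|^2
    A - (x.A) x. Since div J = 0, xi . F J (xi) = 0 ([divergence_free_transform]), and since |x| = 1
    the far field is i k / (4 pi sqrt eps) times F J (k x) ([E_far_sphere]). Together with the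
    factor k in [I_E] this gives k^2 dk ds, the volume element in spherical coordinates
    ([ge0_integral_spherical]), and the constants multiply to (2 pi)^{-3} ([far_field_constant]).
    Hence [I_E] truncated at K is the inverse Fourier integral of F J over the ball of radius K
    ([I_E_partial_inverse]), and what remains is Fourier inversion in L^2.

    Inversion is derived from Plancherel's identity alone. If a kernel and its adjoint both satisfy
    it with constant c, expanding a square shows that the inverse integral over a set B misses f by
    exactly |f|^2 - c^{-1} (energy of the transform on B), in squared L^2 norms
    ([partial_inverse_error]). This tends to 0 when B exhausts the frequency space
    ([partial_inverse_cvg]).

    Plancherel's identity on the line starts from a real u in L^1 and L^2. Damping its energy on s >
    0 by e^{-ts} turns it into a double integral of u(x) u(y) against the Poisson kernel, of mass pi
    ([decay_pwE]); thus the energy is at most pi |u|^2. The deficit [defect] is a nonnegative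
    quadratic form, so its zeros form a vector space closed in L^2. An arctangent computation puts
    indicators of intervals in it ([tight_itv]), hence all functions ([tight_L12]). Parity gives the
    complex case ([plancherel_fourier]) and Fubini the product case ([plancherel_prod]).

    The orthogonality xi . F J (xi) = 0 amounts to using plane waves as test functions. This is
    allowed after a smooth cutoff, because a square integrable field of compact support is
    integrable ([in_L2_cintegrable], [divergence_free_against]). *)

Definition pushforward_measure d1 d2 (T1 : measurableType d1)
    (T2 : measurableType d2) (R : realType) (f : T1 -> T2)
    (mf : measurable_fun setT f) (m : {measure set T1 -> \bar R}) :
    {measure set T2 -> \bar R} :=
  measure_function_pushforward__canonical__measure_function_Measure m mf.
Arguments pushforward_measure {d1 d2 T1 T2 R f}.

(** * Affine substitution on the line, parametric integrals, products of sigma-finite measures *)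

Section affine.
Context {R : realType}.
Local Notation leb := (@lebesgue_measure R).

(** By uniqueness of Lebesgue measure: the rescaled push-forward gives each half-open interval its
    length. For negative [a] the preimage is half-open on the opposite side, which does not affect
    its length. *)
Lemma lebesgue_measure_affine (a b : R) (A : set R) : a != 0 -> measurable A ->
  (`|a|%:E * leb ((fun x => a * x + b)%R @^-1` A) = leb A)%E.
Proof.
move=> a0 mA.
pose phi : measurableTypeR R -> measurableTypeR R := fun x => a * x + b.
have mphi : measurable_fun setT phi.
  by apply: measurable_funD => //; apply: measurable_funM.
have na0 : 0 <= `|a| by [].
pose m : {measure set (measurableTypeR R) -> \bar R} :=
  mscale (NngNum na0) (pushforward_measure mphi leb).
transitivity (m A); first by [].
apply/esym; apply: lebesgue_measure_unique mA => _ [[x y] _ <-] /=.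
rewrite /m /mscale /= /pushforward.
have [a_gt0|a_lt0|/eqP] := ltgtP 0 a; last by rewrite eq_sym (negbTE a0).
- rewrite (_ : _ @^-1` _ = `](x - b) / a, (y - b) / a]%classic); last first.
    apply/seteqP; split=> z /=; rewrite !in_itv/= /phi => /andP[h1 h2];
      apply/andP; split; move: h1 h2;
      rewrite ?ltr_pdivrMr// ?ler_pdivlMr// ?(mulrC _ a); lra.
  rewrite !lebesgue_measure_itv/= !lte_fin ltr_pM2r ?invr_gt0// ltrD2r.
  case: ifPn => // xy; last by rewrite mule0.
  by rewrite -EFinB -EFinM gtr0_norm//; congr EFin; field.
- rewrite (_ : _ @^-1` _ = `[(y - b) / a, (x - b) / a[%classic); last first.
    apply/seteqP; split=> z /=; rewrite !in_itv/= /phi => /andP[h1 h2];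
      apply/andP; split; move: h1 h2;
      rewrite ?ltr_ndivlMr// ?ler_ndivrMr// ?(mulrC _ a); lra.
  rewrite !lebesgue_measure_itv/= !lte_fin ltr_nM2r ?invr_lt0// ltrD2r.
  case: ifPn => // xy; last by rewrite mule0.
  by rewrite -EFinB -EFinM ltr0_norm//; congr EFin; field.
Qed.

Lemma ge0_integral_affine (a b : R) (f : R -> \bar R) : a != 0 ->
  measurable_fun setT f -> (forall x, 0 <= f x)%E ->
  (\int[leb]_x f x = `|a|%:E * \int[leb]_x f (a * x + b)%R)%E.
Proof.
move=> a0 mf f0.
pose phi : measurableTypeR R -> measurableTypeR R := fun x => a * x + b.
have mphi : measurable_fun setT phi.
  by apply: measurable_funD => //; apply: measurable_funM.
have na0 : 0 <= `|a| by [].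
pose m : {measure set (measurableTypeR R) -> \bar R} :=
  mscale (NngNum na0) (pushforward_measure mphi leb).
rewrite (eq_measure_integral m); last first.
  by move=> A mA _; exact/esym/lebesgue_measure_affine.
rewrite ge0_integral_mscale//= ge0_integral_pushforward//.
Qed.

End affine.

Section param.
Context {d1 d2} {T1 : measurableType d1} {T2 : measurableType d2} {R : realType}.
Variable m2 : {sigma_finite_measure set T2 -> \bar R}.

(** No integrability is assumed: Tonelli makes the integrals of the positive and negative parts
    measurable, and [fine] of their difference is a total measurable function, infinite values being
    sent to 0. *)
Lemma measurable_Rintegral_param (f : T1 * T2 -> R) :
  measurable_fun setT f -> measurable_fun setT (fun x => \int[m2]_y f (x, y)).
Proof.
move=> mf; apply: (@measurableT_comp _ _ _ _ _ _ (@fine R)) => //.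
have mEf : measurable_fun setT (EFin \o f) by exact/measurable_EFinP.
have -> : (fun x => \int[m2]_y (f (x, y))%:E)%E =
    (fun x => \int[m2]_y (EFin \o f)^\+ (x, y) -
              \int[m2]_y (EFin \o f)^\- (x, y))%E.
  apply/funext => x; rewrite integralE; congr (_ - _)%E.
    by apply: eq_integral => y _; rewrite !funeposE.
  by apply: eq_integral => y _; rewrite !funenegE.
apply: emeasurable_funB.
  apply: (measurable_fun_fubini_tonelli_F (EFin \o f)^\+%E).
  - exact: measurable_funepos.
  - by [].
apply: (measurable_fun_fubini_tonelli_F (EFin \o f)^\-%E).
- exact: measurable_funeneg.
- by [].
Qed.

End param.
Section sigma_finite_product.
Context {d1 d2} {T1 : measurableType d1} {T2 : measurableType d2} {R : realType}.
Variable m1 : {sigma_finite_measure set T1 -> \bar R}.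
Variable m2 : {sigma_finite_measure set T2 -> \bar R}.

Lemma product_measure_sigma_finite : sigma_finite setT (m1 \x m2)%E.
Proof.
have /sigma_finiteP[F [TF ndF Foo]] := sigma_finiteT m1.
have /sigma_finiteP[G [TG ndG Goo]] := sigma_finiteT m2.
exists (fun n => F n `*` G n).
  rewrite -setXTT TF TG predeqE => -[x y]; split.
    move=> [/= [n _ Fnx] [k _ Gky]]; exists (maxn n k) => //; split.
    - by move: x Fnx; exact/subsetPset/ndF/leq_maxl.
    - by move: y Gky; exact/subsetPset/ndG/leq_maxr.
  by move=> [n _ []/= ? ?]; split; exists n.
move=> k; have [? ?] := Foo k; have [? ?] := Goo k.
split; first exact: measurableX.
by rewrite product_measure1E// lte_mul_pinfty// ge0_fin_numE.
Qed.

(** Carries the sigma-finite structure, so that Fubini applies to nested products such as [leb3]. *)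
Definition sprod : {sigma_finite_measure set (T1 * T2)%type -> \bar R} :=
  HB.pack (m1 \x m2)%E
   (Measure_isSigmaFinite.Build _ _ _ (m1 \x m2)%E product_measure_sigma_finite).

End sigma_finite_product.

(** * Complex-valued functions: sizes, measurability, integration, Fubini *)

Section complex_basics.
Context {R : realType}.
Implicit Types a b : R[i].

(** [sqn] is the squared modulus, used for energies. [l1n] is a norm equivalent to the modulus and
    free of square roots, subadditive and submultiplicative; integrability and domination are
    expressed with it. *)
Definition sqn a : R := complex.Re a ^+ 2 + complex.Im a ^+ 2.
Definition l1n a : R := `|complex.Re a| + `|complex.Im a|.

Lemma cReM a b : complex.Re (a * b) =
  complex.Re a * complex.Re b - complex.Im a * complex.Im b.
Proof. by case: a b => [? ?] [? ?]. Qed.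

Lemma cImM a b : complex.Im (a * b) =
  complex.Re a * complex.Im b + complex.Im a * complex.Re b.
Proof. by case: a b => [? ?] [? ?]. Qed.

Lemma cReD a b : complex.Re (a + b) = complex.Re a + complex.Re b.
Proof. by case: a b => [? ?] [? ?]. Qed.

Lemma cImD a b : complex.Im (a + b) = complex.Im a + complex.Im b.
Proof. by case: a b => [? ?] [? ?]. Qed.

Lemma cReN a : complex.Re (- a) = - complex.Re a.
Proof. by case: a => [? ?]. Qed.

Lemma cImN a : complex.Im (- a) = - complex.Im a.
Proof. by case: a => [? ?]. Qed.

Lemma cReconj a : complex.Re (conjc a) = complex.Re a.
Proof. by case: a. Qed.

Lemma cImconj a : complex.Im (conjc a) = - complex.Im a.
Proof. by case: a. Qed.

Definition cReImE := (cReM, cImM, cReD, cImD, cReN, cImN, cReconj, cImconj).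

Lemma complex_eq a b : complex.Re a = complex.Re b ->
  complex.Im a = complex.Im b -> a = b.
Proof. by case: a b => [? ?] [? ?] /= -> ->. Qed.

Lemma sqn_ge0 a : 0 <= sqn a. Proof. by rewrite addr_ge0// sqr_ge0. Qed.

Lemma sqnM a b : sqn (a * b) = sqn a * sqn b.
Proof. by rewrite /sqn !cReImE; ring. Qed.

Lemma sqnN a : sqn (- a) = sqn a.
Proof. by rewrite /sqn !cReImE !sqrrN. Qed.

Lemma sqn_conj a : sqn (conjc a) = sqn a.
Proof. by rewrite /sqn !cReImE sqrrN. Qed.

Lemma sqnB a b : sqn (a - b) =
  sqn a + sqn b - 2 * complex.Re (a * conjc b).
Proof. by rewrite /sqn !cReImE; ring. Qed.

Lemma mul_conjc_sqn a : a * conjc a = (sqn a)%:C.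
Proof. by apply: complex_eq; rewrite !cReImE /sqn /=; ring. Qed.

Lemma sqn_le_l1n a : sqn a <= l1n a ^+ 2.
Proof.
by rewrite sqrrD !real_normK ?num_real// addrAC lerDl mulrn_wge0.
Qed.

Lemma l1n_ge0 a : 0 <= l1n a. Proof. by rewrite addr_ge0. Qed.

(** Completing a square for each part gives t <= 1/2 + t^2. This is what turns square integrability
    into integrability on a set of finite measure. *)
Lemma l1n_le_sqn a : l1n a <= 1 + sqn a.
Proof.
have h (x : R) : `|x| <= 2^-1 + x ^+ 2.
  rewrite -(@real_normK _ x) ?num_real//.
  have := sqr_ge0 (`|x| - 2^-1); rewrite sqrrB; lra.
by have := h (complex.Re a); have := h (complex.Im a); rewrite /l1n /sqn; lra.
Qed.

Lemma l1nM a b : l1n (a * b) <= l1n a * l1n b.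
Proof.
rewrite /l1n !cReImE.
have h1 := ler_normB (complex.Re a * complex.Re b) (complex.Im a * complex.Im b).
have h2 := ler_normD (complex.Re a * complex.Im b) (complex.Im a * complex.Re b).
move: h1 h2; rewrite !normrM; lra.
Qed.

Lemma l1nD a b : l1n (a + b) <= l1n a + l1n b.
Proof.
rewrite /l1n !cReImE.
have := ler_normD (complex.Re a) (complex.Re b).
have := ler_normD (complex.Im a) (complex.Im b); lra.
Qed.

Lemma l1n_conj a : l1n (conjc a) = l1n a.
Proof. by rewrite /l1n !cReImE normrN. Qed.

Lemma l1nN a : l1n (- a) = l1n a.
Proof. by rewrite /l1n !cReImE !normrN. Qed.

End complex_basics.

Section complex_measurable.
Context {d} {T : measurableType d} {R : realType}.
Implicit Types f g : T -> R[i].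

Definition cmeas f := measurable_fun [set: T] (fun x => complex.Re (f x)) /\
  measurable_fun [set: T] (fun x => complex.Im (f x)).

Lemma cmeasM f g : cmeas f -> cmeas g -> cmeas (fun x => f x * g x).
Proof.
move=> [fr fi] [gr gi]; split.
  under eq_fun do rewrite cReM; apply: measurable_funB; exact: measurable_funM.
under eq_fun do rewrite cImM; apply: measurable_funD; exact: measurable_funM.
Qed.

Lemma cmeasD f g : cmeas f -> cmeas g -> cmeas (fun x => f x + g x).
Proof.
move=> [fr fi] [gr gi]; split.
  by under eq_fun do rewrite cReD; apply: measurable_funD.
by under eq_fun do rewrite cImD; apply: measurable_funD.
Qed.

Lemma cmeasN f : cmeas f -> cmeas (fun x => - f x).
Proof.
move=> [fr fi]; split.
  by under eq_fun do rewrite cReN; apply: measurableT_comp.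
by under eq_fun do rewrite cImN; apply: measurableT_comp.
Qed.

Lemma cmeas_conj f : cmeas f -> cmeas (fun x => conjc (f x)).
Proof.
move=> [fr fi]; split; first by under eq_fun do rewrite cReconj.
by under eq_fun do rewrite cImconj; apply: measurableT_comp.
Qed.

Lemma cmeas_cst (c : R[i]) : cmeas (fun=> c).
Proof. by split; exact: measurable_cst. Qed.

Lemma cmeas_real (f : T -> R) : measurable_fun setT f ->
  cmeas (fun x => (f x)%:C).
Proof. by move=> mf; split => //=; exact: measurable_cst. Qed.

Lemma measurable_sqn f : cmeas f -> measurable_fun setT (fun x => sqn (f x)).
Proof.
by move=> [fr fi]; apply: measurable_funD; exact: measurable_funX.
Qed.

Lemma measurable_l1n f : cmeas f -> measurable_fun setT (fun x => l1n (f x)).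
Proof.
by move=> [fr fi]; apply: measurable_funD; exact: measurableT_comp.
Qed.

End complex_measurable.

Lemma cmeas_comp {d1 d2} {T1 : measurableType d1} {T2 : measurableType d2}
    {R : realType} (f : T2 -> R[i]) (g : T1 -> T2) :
  cmeas f -> measurable_fun setT g -> cmeas (f \o g).
Proof.
move=> [fr fi] mg; split.
  exact: (measurableT_comp fr mg).
exact: (measurableT_comp fi mg).
Qed.

Section complex_integral.
Context {d} {T : measurableType d} {R : realType}.
Variable mu : {measure set T -> \bar R}.
Implicit Types f g : T -> R[i].

Definition cintegrable f := cmeas f /\
  mu.-integrable setT (fun x => (l1n (f x))%:E).

Lemma cintegrable_le f (g : T -> R) : cmeas f ->
  mu.-integrable setT (fun x => (g x)%:E) -> (forall x, l1n (f x) <= g x) ->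
  cintegrable f.
Proof.
move=> mf ig fg; split => //; apply: le_integrable ig => //.
  by apply/measurable_EFinP; exact: measurable_l1n.
by move=> x _ /=; rewrite lee_fin ger0_norm ?l1n_ge0// ler_normr fg.
Qed.

Lemma cintegrable_Re f : cintegrable f ->
  mu.-integrable setT (fun x => (complex.Re (f x))%:E).
Proof.
move=> [[fr fi] if1]; apply: le_integrable if1 => //.
  exact/measurable_EFinP.
by move=> x _ /=; rewrite lee_fin [leRHS]ger0_norm ?l1n_ge0// lerDl.
Qed.

Lemma cintegrable_Im f : cintegrable f ->
  mu.-integrable setT (fun x => (complex.Im (f x))%:E).
Proof.
move=> [[fr fi] if1]; apply: le_integrable if1 => //.
  exact/measurable_EFinP.
by move=> x _ /=; rewrite lee_fin [leRHS]ger0_norm ?l1n_ge0// lerDr.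
Qed.

Lemma cintegrable_ReIm f :
  mu.-integrable setT (fun x => (complex.Re (f x))%:E) ->
  mu.-integrable setT (fun x => (complex.Im (f x))%:E) -> cintegrable f.
Proof.
move=> ir ii; split.
  split; apply/measurable_EFinP; first exact: (measurable_int mu ir).
  exact: (measurable_int mu ii).
rewrite (_ : (fun x => _) =
    (fun x => `|(complex.Re (f x))%:E| + `|(complex.Im (f x))%:E|)%E) //.
by apply: integrableD => //; exact: integrable_abse.
Qed.

Lemma cintegrableM_bounded (M : R) f g : cmeas g ->
  (forall x, l1n (g x) <= M) -> cintegrable f -> cintegrable (fun x => g x * f x).
Proof.
move=> mg gM [mf if1].
apply: (@cintegrable_le _ (fun x => M * l1n (f x))).
- exact: cmeasM.
- by under eq_fun do rewrite EFinM; apply: integrableZl.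
- move=> x; apply: (le_trans (l1nM _ _)).
  by rewrite ler_wpM2r// l1n_ge0.
Qed.

Lemma cintegrableD f g : cintegrable f -> cintegrable g ->
  cintegrable (fun x => f x + g x).
Proof.
move=> [mf if1] [mg ig1].
apply: (@cintegrable_le _ (fun x => l1n (f x) + l1n (g x))).
- exact: cmeasD.
- by under eq_fun do rewrite EFinD; apply: integrableD.
- by move=> x; exact: l1nD.
Qed.

Lemma cintegrableN f : cintegrable f -> cintegrable (fun x => - f x).
Proof.
move=> [mf if1]; apply: (@cintegrable_le _ (fun x => l1n (f x))) => //.
  exact: cmeasN.
by move=> x; rewrite l1nN.
Qed.

Lemma cintegrableZ (c : R[i]) f : cintegrable f -> cintegrable (fun x => c * f x).
Proof.
by apply: (@cintegrableM_bounded (l1n c)) => //; exact: cmeas_cst.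
Qed.

Local Notation cint := (cintegral mu setT).

Lemma cintegralD f g : cintegrable f -> cintegrable g ->
  cint (fun x => f x + g x) = cint f + cint g.
Proof.
move=> cf cg; rewrite /cintegral; apply: complex_eq; rewrite ?cReImE /=.
  under eq_Rintegral do rewrite cReD.
  by rewrite RintegralD//; exact: cintegrable_Re.
under eq_Rintegral do rewrite cImD.
by rewrite RintegralD//; exact: cintegrable_Im.
Qed.

Lemma cintegralZ (c : R[i]) f : cintegrable f ->
  cint (fun x => c * f x) = c * cint f.
Proof.
move=> cf; have fr := cintegrable_Re cf; have fi := cintegrable_Im cf.
rewrite /cintegral; apply: complex_eq; rewrite ?cReImE /=.
  under eq_Rintegral do rewrite cReM.
  rewrite RintegralB//; last 2 first.
  - by under [X in integrable _ _ X]eq_fun do rewrite /= EFinM; exact: integrableZl.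
  - by under [X in integrable _ _ X]eq_fun do rewrite /= EFinM; exact: integrableZl.
  by rewrite !RintegralZl.
under eq_Rintegral do rewrite cImM.
rewrite RintegralD//; last 2 first.
- by under [X in integrable _ _ X]eq_fun do rewrite /= EFinM; exact: integrableZl.
- by under [X in integrable _ _ X]eq_fun do rewrite /= EFinM; exact: integrableZl.
by rewrite !RintegralZl.
Qed.

Lemma cintegral_conj f : cintegrable f ->
  cint (fun x => conjc (f x)) = conjc (cint f).
Proof.
move=> cf; rewrite /cintegral; apply: complex_eq; rewrite ?cReImE /=.
  by under eq_Rintegral do rewrite cReconj.
under eq_Rintegral do rewrite cImconj -mulN1r.
rewrite RintegralZl ?mulN1r//; exact: cintegrable_Im.
Qed.

Lemma cintegral0 : cint (fun=> 0) = 0.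
Proof.
by apply: complex_eq; rewrite /= /Rintegral integral0.
Qed.

Lemma eq_cintegral D f g : {in D, f =1 g} ->
  cintegral mu D f = cintegral mu D g.
Proof.
move=> fg; rewrite /cintegral.
by congr (_ +i* _); apply: eq_Rintegral => x xD; rewrite fg.
Qed.

Lemma l1n_cintegral_le f : cintegrable f ->
  l1n (cint f) <= fine (\int[mu]_x (l1n (f x))%:E).
Proof.
move=> cf; have fr := cintegrable_Re cf; have fi := cintegrable_Im cf.
rewrite -/(Rintegral mu setT (fun x => l1n (f x))) RintegralD//; last 2 first.
- exact: (integrable_norm fr).
- exact: (integrable_norm fi).
rewrite /l1n /=; apply: lerD; exact: le_normr_Rintegral.
Qed.

End complex_integral.

Section complex_fubini.
Context {d1 d2} {T1 : measurableType d1} {T2 : measurableType d2} {R : realType}.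
Variable m1 : {sigma_finite_measure set T1 -> \bar R}.
Variable m2 : {sigma_finite_measure set T2 -> \bar R}.
Implicit Type f : T1 * T2 -> R[i].

Lemma cmeas_cintegral_param f : cmeas f ->
  cmeas (fun x => cintegral m2 setT (fun y => f (x, y))).
Proof.
move=> [fr fi]; split => /=.
  exact: (measurable_Rintegral_param m2 fr).
exact: (measurable_Rintegral_param m2 fi).
Qed.

Lemma EFin_Rintegral d (T : measurableType d) (mu : {measure set T -> \bar R})
    (f : T -> R) : mu.-integrable setT (EFin \o f) ->
  (\int[mu]_x f x)%:E = (\int[mu]_x (f x)%:E)%E.
Proof. by move=> i_f; rewrite fineK//; exact: integrable_fin_num. Qed.

(** A section of an integrable function is integrable at almost every point only. Elsewhere [fine]
    may turn an infinite inner integral into 0, so the real and extended inner integrals are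
    compared almost everywhere, which suffices for Fubini. *)
Lemma ae_EFin_Rintegral1 (f : T1 * T2 -> R) :
  (m1 \x m2)%E.-integrable setT (EFin \o f) ->
  ae_eq m1 setT (fun x => (\int[m2]_y f (x, y))%:E)
    (fun x => \int[m2]_y (f (x, y))%:E)%E.
Proof.
move=> i_f; have := ae_integrable1 i_f.
by apply: filterS => x /= ix _; rewrite EFin_Rintegral.
Qed.

Lemma ae_EFin_Rintegral2 (f : T1 * T2 -> R) :
  (m1 \x m2)%E.-integrable setT (EFin \o f) ->
  ae_eq m2 setT (fun y => (\int[m1]_x f (x, y))%:E)
    (fun y => \int[m1]_x (f (x, y))%:E)%E.
Proof.
move=> i_f; have := ae_integrable2 i_f.
by apply: filterS => x /= ix _; rewrite EFin_Rintegral.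
Qed.

Lemma measurable_Rintegral_param2 (f : T1 * T2 -> R) :
  measurable_fun setT f -> measurable_fun setT (fun y => \int[m1]_x f (x, y)).
Proof.
move=> mf; apply: (measurable_Rintegral_param m1 (f := fun z => f (z.2, z.1))).
apply: (measurableT_comp mf); exact: measurable_fun_pair.
Qed.

Let abse_fine_le (x : \bar R) : (`|(fine x)%:E| <= `|x|)%E.
Proof. by case: x => [r||] //=; rewrite normr0 leey. Qed.

Lemma integrable_Rintegral1 (f : T1 * T2 -> R) :
  (m1 \x m2)%E.-integrable setT (EFin \o f) ->
  m1.-integrable setT (fun x => (\int[m2]_y f (x, y))%:E).
Proof.
move=> i_f; apply: le_integrable (integrable_fubini_F i_f) => //.
  apply/measurable_EFinP/measurable_Rintegral_param.
  by apply/measurable_EFinP; exact: (measurable_int _ i_f).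
by move=> x _; exact: abse_fine_le.
Qed.

Lemma RintegralFubini (f : T1 * T2 -> R) :
  (m1 \x m2)%E.-integrable setT (EFin \o f) ->
  \int[m1]_x \int[m2]_y f (x, y) = \int[(m1 \x m2)%E]_z f z.
Proof.
move=> i_f; rewrite /Rintegral -(integral12_prod_meas1 i_f).
congr fine; apply: ae_eq_integral => //.
- apply/measurable_EFinP/measurable_Rintegral_param.
  by apply/measurable_EFinP; exact: (measurable_int _ i_f).
- exact: (measurable_fubini_F i_f).
- exact: ae_EFin_Rintegral1.
Qed.

Lemma integrable_Rintegral2 (f : T1 * T2 -> R) :
  (m1 \x m2)%E.-integrable setT (EFin \o f) ->
  m2.-integrable setT (fun y => (\int[m1]_x f (x, y))%:E).
Proof.
move=> i_f; have mEf := measurable_int _ i_f.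
have mf : measurable_fun setT f by exact/measurable_EFinP.
have mF : measurable_fun setT (fun y => (\int[m1]_x f (x, y))%:E).
  exact/measurable_EFinP/measurable_Rintegral_param2.
apply/integrableP; split => //.
have hlt : (\int[m2]_y \int[m1]_x `|(f (x, y))%:E| < +oo)%E.
  by move: i_f => /integrable21ltyP; apply.
apply: le_lt_trans hlt.
apply: ge0_le_integral => //.
- exact: measurableT_comp.
- apply: (measurable_fun_fubini_tonelli_G (abse \o (EFin \o f))).
    exact: measurableT_comp.
  by move=> z; exact: abse_ge0.
- move=> y _; apply: le_trans (abse_fine_le _) _.
  apply: le_abse_integral => //.
  exact: (measurableT_comp mEf (pair2_measurable y)).
Qed.

Lemma RintegralFubini2 (f : T1 * T2 -> R) :
  (m1 \x m2)%E.-integrable setT (EFin \o f) ->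
  \int[m2]_y \int[m1]_x f (x, y) = \int[(m1 \x m2)%E]_z f z.
Proof.
move=> i_f; rewrite /Rintegral -(integral21_prod_meas1 i_f).
congr fine; apply: ae_eq_integral => //.
- apply/measurable_EFinP/measurable_Rintegral_param2.
  by apply/measurable_EFinP; exact: (measurable_int _ i_f).
- exact: (measurable_fubini_G i_f).
- exact: ae_EFin_Rintegral2.
Qed.

Lemma cintegral_fubini1 f : cintegrable (m1 \x m2)%E f ->
  cintegral m1 setT (fun x => cintegral m2 setT (fun y => f (x, y))) =
  cintegral (m1 \x m2)%E setT f.
Proof.
move=> cf; apply: complex_eq => /=.
  by rewrite (RintegralFubini (cintegrable_Re cf)).
by rewrite (RintegralFubini (cintegrable_Im cf)).
Qed.

Lemma cintegral_fubini2 f : cintegrable (m1 \x m2)%E f ->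
  cintegral m2 setT (fun y => cintegral m1 setT (fun x => f (x, y))) =
  cintegral (m1 \x m2)%E setT f.
Proof.
move=> cf; apply: complex_eq => /=.
  by rewrite (RintegralFubini2 (cintegrable_Re cf)).
by rewrite (RintegralFubini2 (cintegrable_Im cf)).
Qed.

Lemma cintegrable_param2 f : cintegrable (m1 \x m2)%E f ->
  cintegrable m2 (fun y => cintegral m1 setT (fun x => f (x, y))).
Proof.
move=> cf; apply: cintegrable_ReIm => /=.
  exact: (integrable_Rintegral2 (cintegrable_Re cf)).
exact: (integrable_Rintegral2 (cintegrable_Im cf)).
Qed.

Lemma cintegrable_param1 f : cintegrable (m1 \x m2)%E f ->
  cintegrable m1 (fun x => cintegral m2 setT (fun y => f (x, y))).
Proof.
move=> cf; apply: cintegrable_ReIm => /=.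
  exact: (integrable_Rintegral1 (cintegrable_Re cf)).
exact: (integrable_Rintegral1 (cintegrable_Im cf)).
Qed.

End complex_fubini.

Lemma measurable_cos {R : realType} : measurable_fun setT (@cos R).
Proof. by apply: continuous_measurable_fun; exact: continuous_cos. Qed.

Lemma measurable_sin {R : realType} : measurable_fun setT (@sin R).
Proof. by apply: continuous_measurable_fun; exact: continuous_sin. Qed.

(** * The Poisson kernel as cosine transform of a one-sided exponential *)

Section poisson.
Context {R : realType}.
Local Notation leb := (@lebesgue_measure R).
Implicit Types a b t x y : R.

(** Adding 1 to the cosine makes the integrand nonnegative, as the fundamental theorem of calculus
    on a half-line asks here. The exponential alone is recovered from the case [a = 0] and then
    subtracted. *)
Let damped t a x := expR (- t * x) * (1 + cos (a * x)).
Let damped_prim t a x := - (expR (- t * x) / t) +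
   expR (- t * x) * (a * sin (a * x) - t * cos (a * x)) / (t ^+ 2 + a ^+ 2).

Lemma t2a2_gt0 t a : 0 < t -> 0 < t ^+ 2 + a ^+ 2.
Proof. by move=> t0; rewrite ltr_wpDr ?sqr_ge0// exprn_gt0. Qed.

Let is_derive_damped_prim t a x : 0 < t ->
  is_derive x 1 (damped_prim t a) (damped t a x).
Proof.
move=> t0; have ta0 := lt0r_neq0 (t2a2_gt0 a t0); have tn0 := lt0r_neq0 t0.
apply: is_derive_eq; rewrite /damped /GRing.scale /= ?derive_val.
by field; rewrite ta0.
Qed.

Let continuous_damped t a : continuous (damped t a).
Proof.
move=> x; apply/differentiable_continuous/derivable1_diffP.
by rewrite /damped; apply: ex_derive.
Qed.

Let cvg_damped_prim t a : 0 < t -> damped_prim t a x @[x --> +oo] --> (0 : R).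
Proof.
move=> t0; have ta0 := t2a2_gt0 a t0.
pose M := t^-1 + (`|a| + t) / (t ^+ 2 + a ^+ 2).
have expNy : M * expR (- (t * x)) @[x --> +oo] --> (0 : R).
  rewrite -(mulr0 M); apply: cvgM; first exact: cvg_cst.
  apply: (cvg_comp (fun x => t * x) (fun y => expR (- y))); last exact: cvgr_expR.
  by apply: gt0_cvgMry => //; exact: cvg_id.
apply/norm_cvg0P.
apply: (squeeze_cvgr _ (cvg_cst 0) expNy); near=> x.
rewrite normr_ge0/= /damped_prim mulNr.
have e0 := expR_gt0 (- (t * x)); set e := expR _ in e0 *.
have hs : `|a * sin (a * x) - t * cos (a * x)| <= `|a| + t.
  apply: (le_trans (ler_normB _ _)); rewrite !normrM (gtr0_norm t0) lerD//.
    by rewrite ler_piMr// sin_max.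
  by rewrite ler_piMr ?cos_max// ltW.
apply: (le_trans (ler_normD _ _)); rewrite normrN /M mulrDl lerD//.
  by rewrite gtr0_norm ?divr_gt0// mulrC.
rewrite !normrM normfV (gtr0_norm e0) (gtr0_norm ta0) -mulrA mulrC.
by rewrite ler_wpM2r ?(ltW e0)// ler_wpM2r// invr_ge0 ltW.
Unshelve. all: by end_near. Qed.

Let integral_damped t a : 0 < t ->
  (\int[leb]_(x in `[0%R, +oo[) (damped t a x)%:E =
   (t^-1 + t / (t ^+ 2 + a ^+ 2))%:E)%E.
Proof.
move=> t0.
rewrite (@ge0_continuous_FTC2y _ _ (damped_prim t a) 0 0).
- rewrite -EFinB /damped_prim !mulr0 expR0 sin0 cos0; congr EFin.
  have h := lt0r_neq0 (t2a2_gt0 a t0); have tn0 := lt0r_neq0 t0.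
  by field; rewrite ?h ?tn0.
- by move=> x _; rewrite /damped mulr_ge0 ?expR_ge0.
- by apply: continuous_subspaceT => x; exact: continuous_damped.
- exact: cvg_damped_prim.
- by move=> x _; have /@ex_derive := is_derive_damped_prim a x t0.
- apply: cvg_at_right_filter; apply/differentiable_continuous/derivable1_diffP.
  by have /@ex_derive := is_derive_damped_prim a 0 t0.
- move=> x _; rewrite derive1E.
  by have /@derive_val := is_derive_damped_prim a x t0.
Qed.

Definition decay t x : R := \1_(`]0, +oo[%classic) x * expR (- t * x).

Lemma decay_ge0 t x : 0 <= decay t x.
Proof. by rewrite mulr_ge0// ?expR_ge0// indicE. Qed.

Lemma measurable_decay t : measurable_fun setT (decay t).
Proof.
apply: measurable_funM; first exact: measurable_indic.
apply: measurableT_comp; first exact: measurable_expR.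
exact: measurable_funM.
Qed.

Let integral_decayE t (g : R -> R) :
  (\int[leb]_x (decay t x * g x)%:E =
   \int[leb]_(x in `]0%R, +oo[) (expR (- t * x) * g x)%:E)%E.
Proof.
rewrite [RHS]integral_mkcond; apply: eq_integral => x _.
rewrite patchE /decay indicE; case: ifPn => _; first by rewrite mul1r.
by rewrite !mul0r.
Qed.

Let integral_decay_damped t a : 0 < t ->
  (\int[leb]_x (decay t x * (1 + cos (a * x)))%:E =
   (t^-1 + t / (t ^+ 2 + a ^+ 2))%:E)%E.
Proof.
move=> t0; rewrite integral_decayE -integral_damped//.
apply: integral_itv_obnd_cbnd.
apply/measurable_EFinP; apply: measurable_funTS.
by apply: continuous_measurable_fun; exact: continuous_damped.
Qed.

Lemma integral_decay t : 0 < t -> (\int[leb]_x (decay t x)%:E = (t^-1)%:E)%E.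
Proof.
move=> t0; have := integral_decay_damped 0 t0.
under eq_integral do rewrite mul0r cos0 mulrC EFinM.
rewrite ge0_integralZl_EFin//; last 2 first.
- by move=> x _; rewrite lee_fin decay_ge0.
- by apply/measurable_EFinP; exact: measurable_decay.
rewrite expr0n/= addr0.
move=> /(congr1 (fun z : \bar R => (2^-1)%:E * z)%E).
rewrite muleA -EFinM mulVf ?pnatr_eq0// mul1e => ->.
by rewrite -EFinM; congr EFin; field; rewrite lt0r_neq0.
Qed.

Lemma integrable_decay t : 0 < t -> leb.-integrable setT (fun x => (decay t x)%:E).
Proof.
move=> t0; apply/integrableP; split.
  by apply/measurable_EFinP; exact: measurable_decay.
under eq_integral do rewrite gee0_abs ?lee_fin ?decay_ge0//.
by rewrite integral_decay// ltry.
Qed.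

Lemma Rintegral_decay_cos t a : 0 < t ->
  \int[leb]_x (decay t x * cos (a * x)) = t / (t ^+ 2 + a ^+ 2).
Proof.
move=> t0; apply: (addrI t^-1).
transitivity (\int[leb]_x (decay t x * (1 + cos (a * x)))); last first.
  by rewrite /Rintegral integral_decay_damped.
rewrite -[X in X + _ = _](_ : \int[leb]_x decay t x = _); last first.
  by rewrite /Rintegral integral_decay.
rewrite -RintegralD//; last 2 first.
- exact: integrable_decay.
- apply: le_integrable (integrable_decay t0) => //.
    apply/measurable_EFinP; apply: measurable_funM; first exact: measurable_decay.
    by apply: (measurableT_comp measurable_cos); exact: measurable_funM.
  move=> x _ /=; rewrite lee_fin normrM ger0_norm ?decay_ge0//.
  by rewrite ler_piMr ?decay_ge0// cos_max.
by apply: eq_Rintegral => x _; rewrite mulrDr mulr1.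
Qed.

(** The Poisson kernel of the half-plane without its factor 1/pi, so that its mass is pi for every
    positive [t]. At [t = 1] it is the derivative of the arctangent. *)
Definition poisson t x : R := t / (t ^+ 2 + x ^+ 2).

Lemma poisson_ge0 t x : 0 < t -> 0 <= poisson t x.
Proof. by move=> t0; rewrite divr_ge0 ?ltW ?t2a2_gt0. Qed.

Lemma continuous_poisson t : 0 < t -> continuous (poisson t).
Proof.
move=> t0 x; apply/differentiable_continuous/derivable1_diffP.
have tx := lt0r_neq0 (t2a2_gt0 x t0).
by rewrite /poisson; apply: ex_derive.
Qed.

Lemma measurable_poisson t : 0 < t -> measurable_fun setT (poisson t).
Proof. by move=> t0; apply: continuous_measurable_fun; exact: continuous_poisson. Qed.

Let integralT_oneDsqr : (\int[leb]_x (poisson 1 x)%:E = (pi : R)%:E)%E.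
Proof.
rewrite ge0_symfun_integralT; last 3 first.
- by move=> x; exact: poisson_ge0.
- exact: continuous_poisson.
- by move=> x; rewrite /poisson /= sqrrN.
rewrite -set_itvcy.
have -> : (\int[leb]_(x in `[0%R, +oo[) (poisson 1 x)%:E = (pi / 2)%:E)%E.
  rewrite -(@integral0y_oneDsqr R); apply: eq_integral => x _.
  by rewrite /poisson expr1n mul1r.
by rewrite -EFinM mulrCA divff ?mulr1// pnatr_eq0.
Qed.

Lemma integral_poisson t x : 0 < t ->
  (\int[leb]_y (poisson t (x - y))%:E = (pi : R)%:E)%E.
Proof.
move=> t0; have tn0 := lt0r_neq0 t0.
rewrite -integralT_oneDsqr [RHS](@ge0_integral_affine _ t^-1 (- (x / t))); last 3 first.
- by rewrite invr_neq0.
- by apply/measurable_EFinP; apply: measurable_poisson; exact: ltr01.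
- by move=> y; rewrite lee_fin poisson_ge0.
rewrite -ge0_integralZl_EFin//; last 2 first.
- by move=> y _; rewrite lee_fin poisson_ge0.
- apply/measurable_EFinP; apply: (measurableT_comp (f := poisson 1)).
    exact: measurable_poisson.
  by apply: measurable_funD => //; exact: measurable_funM.
apply: eq_integral => y _; rewrite -EFinM; congr EFin.
rewrite gtr0_norm ?invr_gt0// /poisson.
have h1 := lt0r_neq0 (t2a2_gt0 (x - y) t0).
have h2 : 1 ^+ 2 + (t^-1 * y - x / t) ^+ 2 != 0.
  by rewrite lt0r_neq0// t2a2_gt0.
field; rewrite tn0/= (_ : _ + _ = t ^+ 2 + (x - y) ^+ 2) ?h1//; last by ring.
Qed.

Lemma integral_poisson_itv t x a b : 0 < t -> a < b ->
  (\int[leb]_(y in `[a, b]) (poisson t (x - y))%:E =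
   (atan ((b - x) / t) - atan ((a - x) / t))%:E)%E.
Proof.
move=> t0 ab; have tn0 := lt0r_neq0 t0.
have dF y : is_derive y 1 (fun y => atan ((y - x) / t)) (poisson t (x - y)).
  apply: is_derive_eq; rewrite /GRing.scale /= /poisson.
  have h1 := lt0r_neq0 (t2a2_gt0 (x - y) t0).
  have h2 : 1 + ((y - x) / t) ^+ 2 != 0.
    by rewrite -[X in X + _](expr1n _ 2) lt0r_neq0// t2a2_gt0.
  by field; rewrite tn0/= (_ : _ + _ = t ^+ 2 + (x - y) ^+ 2) ?h1//; ring.
rewrite (@continuous_FTC2 _ _ (fun y => atan ((y - x) / t))) ?EFinB//.
- apply: continuous_subspaceT => y.
  apply: (@continuous_comp _ _ _ (fun y => x - y) (poisson t)).
    by apply: cvgB; [exact: cvg_cst|exact: cvg_id].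
  exact: continuous_poisson.
- split.
  + by move=> y _; have /@ex_derive := dF y.
  + apply: cvg_at_right_filter; apply/differentiable_continuous/derivable1_diffP.
    by have /@ex_derive := dF a.
  + apply: cvg_at_left_filter; apply/differentiable_continuous/derivable1_diffP.
    by have /@ex_derive := dF b.
- by move=> y _; rewrite derive1E; have /@derive_val := dF y.
Qed.

End poisson.

(** * Cosine and sine transforms of real functions, and their damped energy *)

Section plancherel1.
Context {R : realType}.
Local Notation leb := (@lebesgue_measure R).
Implicit Types (u v : R -> R) (t x y : R).

Definition L12 u := leb.-integrable setT (EFin \o u) /\
  leb.-integrable setT (fun x => (u x ^+ 2)%:E).

Definition nrm2 u : R := \int[leb]_x (u x ^+ 2).
Definition FC u (s : R) : R := \int[leb]_x (u x * cos (s * x)).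
Definition FS u (s : R) : R := \int[leb]_x (u x * sin (s * x)).
(** For real [u] this is the squared modulus of the Fourier transform at [s]. It is even in [s], so
    the half-line of positive [s] carries half of the energy. *)
Definition pw u s := FC u s ^+ 2 + FS u s ^+ 2.

Lemma pw_ge0 u s : 0 <= pw u s. Proof. by rewrite addr_ge0// sqr_ge0. Qed.

Lemma L12_meas u : L12 u -> measurable_fun setT u.
Proof. by move=> [iu _]; apply/measurable_EFinP; exact: (measurable_int _ iu). Qed.

Lemma nrm2_ge0 u : 0 <= nrm2 u.
Proof. by apply: Rintegral_ge0 => x _; rewrite sqr_ge0. Qed.

Lemma EFin_nrm2 u : L12 u -> ((nrm2 u)%:E = \int[leb]_x (u x ^+ 2)%:E)%E.
Proof. by move=> [_ iu]; rewrite fineK//; exact: integrable_fin_num. Qed.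

Lemma L12D u v : L12 u -> L12 v -> L12 (fun x => u x + v x).
Proof.
move=> Lu Lv; have mu := L12_meas Lu; have mv := L12_meas Lv.
move: Lu Lv => [iu iu2] [iv iv2]; split.
  rewrite (_ : _ \o _ = (EFin \o u) \+ (EFin \o v))%E//; exact: integrableD.
have i2 : leb.-integrable setT (fun x => (2 * u x ^+ 2)%:E + (2 * v x ^+ 2)%:E)%E.
  by apply: integrableD => //; under eq_fun do rewrite EFinM; exact: integrableZl.
apply: le_integrable i2 => //.
  by apply/measurable_EFinP; apply: measurable_funX; exact: measurable_funD.
move=> x _ /=; rewrite lee_fin ger0_norm ?sqr_ge0//; apply: le_trans (ler_norm _).
by have := sqr_ge0 (u x - v x); lra.
Qed.

Lemma L12Z c u : L12 u -> L12 (fun x => c * u x).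
Proof.
move=> [iu iu2]; split.
  by rewrite (_ : _ \o _ = (fun x => c%:E * (u x)%:E)%E)//; exact: integrableZl.
by under eq_fun do rewrite exprMn EFinM; exact: integrableZl.
Qed.

Lemma L12B u v : L12 u -> L12 v -> L12 (fun x => u x - v x).
Proof.
move=> Lu Lv; have := L12D Lu (L12Z (-1) Lv).
by under [X in L12 X -> _]eq_fun do rewrite mulN1r.
Qed.

Lemma integrable_trig u (g : R -> R) : leb.-integrable setT (EFin \o u) ->
  measurable_fun setT g -> (forall x, `|g x| <= 1) ->
  leb.-integrable setT (fun x => (u x * g x)%:E).
Proof.
move=> iu mg g1.
have mu : measurable_fun setT u.
  by apply/measurable_EFinP; exact: (measurable_int _ iu).
apply: le_integrable iu => //.
  by apply/measurable_EFinP; exact: measurable_funM.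
by move=> x _ /=; rewrite lee_fin normrM ler_piMr.
Qed.

Lemma measurable_cosM s : measurable_fun setT (fun x : R => cos (s * x)).
Proof. by apply: (measurableT_comp measurable_cos); exact: measurable_funM. Qed.

Lemma measurable_sinM s : measurable_fun setT (fun x : R => sin (s * x)).
Proof. by apply: (measurableT_comp measurable_sin); exact: measurable_funM. Qed.

Hint Resolve measurable_cosM measurable_sinM : core.

Lemma integrable_mcos u s : leb.-integrable setT (EFin \o u) ->
  leb.-integrable setT (fun x => (u x * cos (s * x))%:E).
Proof. by move=> iu; apply: integrable_trig => // x; exact: cos_max. Qed.

Lemma integrable_msin u s : leb.-integrable setT (EFin \o u) ->
  leb.-integrable setT (fun x => (u x * sin (s * x))%:E).
Proof. by move=> iu; apply: integrable_trig => // x; exact: sin_max. Qed.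

Lemma FCD u v s : leb.-integrable setT (EFin \o u) ->
  leb.-integrable setT (EFin \o v) -> FC (fun x => u x + v x) s = FC u s + FC v s.
Proof.
move=> iu iv; rewrite /FC -RintegralD//; [|exact: integrable_mcos..].
by apply: eq_Rintegral => x _; rewrite mulrDl.
Qed.

Lemma FSD u v s : leb.-integrable setT (EFin \o u) ->
  leb.-integrable setT (EFin \o v) -> FS (fun x => u x + v x) s = FS u s + FS v s.
Proof.
move=> iu iv; rewrite /FS -RintegralD//; [|exact: integrable_msin..].
by apply: eq_Rintegral => x _; rewrite mulrDl.
Qed.

Lemma FCZ c u s : leb.-integrable setT (EFin \o u) ->
  FC (fun x => c * u x) s = c * FC u s.
Proof.
move=> iu; rewrite /FC -RintegralZl//; last exact: integrable_mcos.
by apply: eq_Rintegral => x _; rewrite mulrA.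
Qed.

Lemma FSZ c u s : leb.-integrable setT (EFin \o u) ->
  FS (fun x => c * u x) s = c * FS u s.
Proof.
move=> iu; rewrite /FS -RintegralZl//; last exact: integrable_msin.
by apply: eq_Rintegral => x _; rewrite mulrA.
Qed.

Lemma measurable_FC u : measurable_fun setT u -> measurable_fun setT (FC u).
Proof.
move=> mu.
apply: (@measurable_Rintegral_param _ _ (measurableTypeR R) (measurableTypeR R) R
  leb (fun z => u z.2 * cos (z.1 * z.2))).
apply: measurable_funM; first exact: measurableT_comp.
by apply: (measurableT_comp measurable_cos); exact: measurable_funM.
Qed.

Lemma measurable_FS u : measurable_fun setT u -> measurable_fun setT (FS u).
Proof.
move=> mu.
apply: (@measurable_Rintegral_param _ _ (measurableTypeR R) (measurableTypeR R) R
  leb (fun z => u z.2 * sin (z.1 * z.2))).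
apply: measurable_funM; first exact: measurableT_comp.
by apply: (measurableT_comp measurable_sin); exact: measurable_funM.
Qed.

Lemma measurable_pw u : measurable_fun setT u -> measurable_fun setT (pw u).
Proof.
move=> mu; apply: measurable_funD; apply: measurable_funX.
  exact: measurable_FC.
exact: measurable_FS.
Qed.

Lemma integrable_prod d1 d2 (T1 : measurableType d1) (T2 : measurableType d2)
    (m1 : {sigma_finite_measure set T1 -> \bar R})
    (m2 : {sigma_finite_measure set T2 -> \bar R}) (f : T1 -> R) (g : T2 -> R) :
  m1.-integrable setT (EFin \o f) -> m2.-integrable setT (EFin \o g) ->
  (m1 \x m2)%E.-integrable setT (fun z => (f z.1 * g z.2)%:E).
Proof.
move=> iF iG.
have mf : measurable_fun setT f.
  by apply/measurable_EFinP; exact: (measurable_int _ iF).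
have mg : measurable_fun setT g.
  by apply/measurable_EFinP; exact: (measurable_int _ iG).
apply/integrable12ltyP.
  apply/measurable_EFinP; apply: measurable_funM; exact: measurableT_comp.
under eq_integral => x _.
  under eq_integral do rewrite /= normrM EFinM.
  rewrite ge0_integralZl_EFin//; last first.
    by apply/measurable_EFinP; exact: measurableT_comp.
  over.
rewrite ge0_integralZr//; first last.
- exact: integral_ge0.
- by apply/measurable_EFinP; exact: measurableT_comp.
move/integrableP : iF => [_ iF]; move/integrableP : iG => [_ iG].
by apply: lte_mul_pinfty => //; [exact: integral_ge0|rewrite ge0_fin_numE// integral_ge0].
Qed.

Let leb2s : {sigma_finite_measure set _ -> \bar R} := sprod leb leb.

Lemma pwE u s : leb.-integrable setT (EFin \o u) ->
  pw u s = \int[leb2s]_z (u z.1 * u z.2 * cos (s * (z.1 - z.2))).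
Proof.
move=> iu.
have ic := integrable_prod (integrable_mcos s iu) (integrable_mcos s iu).
have is_ := integrable_prod (integrable_msin s iu) (integrable_msin s iu).
transitivity (\int[leb2s]_z (u z.1 * cos (s * z.1) * (u z.2 * cos (s * z.2))) +
    \int[leb2s]_z (u z.1 * sin (s * z.1) * (u z.2 * sin (s * z.2)))).
  congr (_ + _).
    rewrite -(RintegralFubini ic) expr2 {1}/FC -RintegralZr//.
      by apply: eq_Rintegral => x _; rewrite -RintegralZl//; exact: integrable_mcos.
    exact: integrable_mcos.
  rewrite -(RintegralFubini is_) expr2 {1}/FS -RintegralZr//.
    by apply: eq_Rintegral => x _; rewrite -RintegralZl//; exact: integrable_msin.
  exact: integrable_msin.
rewrite -RintegralD//; apply: eq_Rintegral => z _.
by rewrite mulrBr cosB; ring.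
Qed.

(** By [pwE] the power spectrum is a double integral of u(x) u(y) cos(s (x - y)); integrating in [s]
    first replaces the cosine by the Poisson kernel. The exponential factor makes the triple
    integral absolutely convergent. *)
Lemma decay_pwE t u : 0 < t -> leb.-integrable setT (EFin \o u) ->
  \int[leb]_s (decay t s * pw u s) =
  \int[leb2s]_z (u z.1 * u z.2 * poisson t (z.1 - z.2)).
Proof.
move=> t0 iu.
pose f (w : measurableTypeR R * (measurableTypeR R * measurableTypeR R)) : R :=
  decay t w.1 * (u w.2.1 * u w.2.2) * cos (w.1 * (w.2.1 - w.2.2)).
have mu : measurable_fun setT u.
  by apply/measurable_EFinP; exact: (measurable_int _ iu).
have iu2 : leb2s.-integrable setT (EFin \o (fun z => u z.1 * u z.2)).
  exact: (integrable_prod iu iu).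
have idu := @integrable_prod _ _ _ _ leb leb2s _ _ (integrable_decay t0) iu2.
have iF : (leb \x leb2s)%E.-integrable setT (EFin \o f).
  apply: le_integrable idu => //.
    apply/measurable_EFinP; apply: measurable_funM.
      apply: measurable_funM.
        by apply: (measurableT_comp (measurable_decay t)).
      apply: measurable_funM; apply: (measurableT_comp mu); exact: measurableT_comp.
    apply: (measurableT_comp measurable_cos); apply: measurable_funM => //.
    by apply: measurable_funB; exact: measurableT_comp.
  by move=> w _ /=; rewrite lee_fin [leLHS]normrM ler_piMr// cos_max.
transitivity (\int[leb]_s \int[leb2s]_z f (s, z)).
  apply: eq_Rintegral => s _; rewrite pwE//.
  rewrite -RintegralZl//; first by apply: eq_Rintegral => z _; rewrite /f /= mulrA.
  apply: le_integrable iu2 => //.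
    apply/measurable_EFinP; apply: measurable_funM.
      by apply: measurable_funM; exact: measurableT_comp.
    apply: (measurableT_comp (measurable_cosM s)).
    exact: measurable_funB.
  by move=> w _ /=; rewrite lee_fin [leLHS]normrM ler_piMr// cos_max.
rewrite (RintegralFubini iF) -(RintegralFubini2 iF).
apply: eq_Rintegral => -[x y] _; rewrite /f/=.
transitivity (\int[leb]_s (u x * u y * (decay t s * cos ((x - y) * s)))).
  by apply: eq_Rintegral => s _; rewrite [s * _]mulrC; ring.
rewrite RintegralZl//; last exact: (integrable_mcos _ (integrable_decay t0)).
by rewrite Rintegral_decay_cos.
Qed.

End plancherel1.

(** * The Plancherel defect, a nonnegative quadratic form *)

Section defect.
Context {R : realType}.
Local Notation leb := (@lebesgue_measure R).
Implicit Types (u v : R -> R) (t x y : R).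
Let leb2s : {sigma_finite_measure set _ -> \bar R} := sprod leb leb.

Let pos (s : R) : R := \1_(`]0, +oo[%classic) s.

Definition half_energy u : \bar R := (\int[leb]_s (pos s * pw u s)%:E)%E.

Lemma poisson_le t x : 0 < t -> poisson t x <= t^-1.
Proof.
move=> t0; rewrite /poisson ler_pdivrMr ?t2a2_gt0// mulrDr expr2 mulrA.
by rewrite mulVf ?lt0r_neq0// mul1r lerDl mulr_ge0 ?sqr_ge0// invr_ge0 ltW ?sqr_ge0.
Qed.

Lemma poissonN t x : poisson t (- x) = poisson t x.
Proof. by rewrite /poisson sqrrN. Qed.

Lemma measurable_poisson2 t : 0 < t ->
  measurable_fun setT (fun z : measurableTypeR R * measurableTypeR R =>
    poisson t (z.1 - z.2)).
Proof.
move=> t0; apply: (measurableT_comp (f := poisson t)).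
  exact: measurable_poisson.
exact: measurable_funB.
Qed.

Lemma integral_sqr_poisson1 t u : 0 < t -> L12 u ->
  (\int[leb2s]_z (u z.1 ^+ 2 * poisson t (z.1 - z.2))%:E =
   (pi * nrm2 u)%:E)%E.
Proof.
move=> t0 Lu; have mu := L12_meas Lu.
have mf : measurable_fun setT (fun z : measurableTypeR R * measurableTypeR R =>
    (u z.1 ^+ 2 * poisson t (z.1 - z.2))%:E).
  apply/measurable_EFinP; apply: measurable_funM; last exact: measurable_poisson2.
  by apply: measurable_funX; exact: measurableT_comp.
have f0 (z : measurableTypeR R * measurableTypeR R) :
    (0 <= (u z.1 ^+ 2 * poisson t (z.1 - z.2))%:E)%E.
  by rewrite lee_fin mulr_ge0 ?sqr_ge0 ?poisson_ge0.
rewrite (fubini_tonelli1 _ mf f0) /fubini_F /=.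
under eq_integral => x _.
  under eq_integral do rewrite EFinM.
  rewrite ge0_integralZl_EFin ?sqr_ge0//; last 2 first.
  - by move=> y _; rewrite lee_fin poisson_ge0.
  - apply/measurable_EFinP; apply: (measurableT_comp (f := poisson t)).
      exact: measurable_poisson.
    exact: measurable_funB.
  rewrite integral_poisson// muleC.
  over.
rewrite ge0_integralZl_EFin ?pi_ge0//; last 2 first.
- by move=> y _; rewrite lee_fin sqr_ge0.
- by apply/measurable_EFinP; exact: measurable_funX.
by rewrite EFinM EFin_nrm2.
Qed.

Lemma integral_sqr_poisson2 t u : 0 < t -> L12 u ->
  (\int[leb2s]_z (u z.2 ^+ 2 * poisson t (z.1 - z.2))%:E =
   (pi * nrm2 u)%:E)%E.
Proof.
move=> t0 Lu; have mu := L12_meas Lu.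
have mf : measurable_fun setT (fun z : measurableTypeR R * measurableTypeR R =>
    (u z.2 ^+ 2 * poisson t (z.1 - z.2))%:E).
  apply/measurable_EFinP; apply: measurable_funM; last exact: measurable_poisson2.
  by apply: measurable_funX; exact: measurableT_comp.
have f0 (z : measurableTypeR R * measurableTypeR R) :
    (0 <= (u z.2 ^+ 2 * poisson t (z.1 - z.2))%:E)%E.
  by rewrite lee_fin mulr_ge0 ?sqr_ge0 ?poisson_ge0.
rewrite -(integral_sqr_poisson1 t0 Lu) (fubini_tonelli2 _ mf f0) fubini_tonelli1.
- apply: eq_integral => x _; apply: eq_integral => y _ /=.
  by rewrite -poissonN opprB.
- apply/measurable_EFinP; apply: measurable_funM; last exact: measurable_poisson2.
  by apply: measurable_funX; exact: measurableT_comp.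
- by move=> z; rewrite lee_fin mulr_ge0 ?sqr_ge0 ?poisson_ge0.
Qed.

Lemma integrable_prod_poisson t u : 0 < t -> leb.-integrable setT (EFin \o u) ->
  leb2s.-integrable setT
    (EFin \o (fun z => u z.1 * u z.2 * poisson t (z.1 - z.2))).
Proof.
move=> t0 iu; have iu2 := integrable_prod iu iu.
have mu : measurable_fun setT u.
  by apply/measurable_EFinP; exact: (measurable_int _ iu).
apply: le_integrable (integrableZr measurableT t^-1 iu2) => //.
  apply/measurable_EFinP; apply: measurable_funM; last exact: measurable_poisson2.
  by apply: measurable_funM; exact: measurableT_comp.
move=> z _ /=; rewrite lee_fin normrM [leRHS]normrM ler_wpM2l//.
by rewrite !ger0_norm ?poisson_ge0// ?poisson_le// invr_ge0 ltW.
Qed.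

(** The product u(x) u(y) is at most the half sum of the squares, and the Poisson kernel has mass pi
    in either variable. The bound is uniform in [t]. *)
Lemma Rintegral_decay_pw_le t u : 0 < t -> L12 u ->
  \int[leb]_s (decay t s * pw u s) <= pi * nrm2 u.
Proof.
move=> t0 Lu; have mu := L12_meas Lu; rewrite decay_pwE//; last by case: Lu.
pose g (z : measurableTypeR R * measurableTypeR R) :=
  (u z.1 ^+ 2 * poisson t (z.1 - z.2)) + (u z.2 ^+ 2 * poisson t (z.1 - z.2)).
have mg1 : measurable_fun setT (fun z : measurableTypeR R * measurableTypeR R =>
    u z.1 ^+ 2 * poisson t (z.1 - z.2)).
  apply: measurable_funM; last exact: measurable_poisson2.
  by apply: measurable_funX; exact: measurableT_comp.
have mg2 : measurable_fun setT (fun z : measurableTypeR R * measurableTypeR R =>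
    u z.2 ^+ 2 * poisson t (z.1 - z.2)).
  apply: measurable_funM; last exact: measurable_poisson2.
  by apply: measurable_funX; exact: measurableT_comp.
have ig : (\int[leb2s]_z (g z)%:E = (2 * (pi * nrm2 u))%:E)%E.
  under eq_integral do rewrite EFinD.
  rewrite ge0_integralD//; last 4 first.
  - by move=> z _; rewrite lee_fin mulr_ge0 ?sqr_ge0 ?poisson_ge0.
  - exact/measurable_EFinP.
  - by move=> z _; rewrite lee_fin mulr_ge0 ?sqr_ge0 ?poisson_ge0.
  - exact/measurable_EFinP.
  by rewrite integral_sqr_poisson1// integral_sqr_poisson2// -EFinD mulr_natl mulr2n.
have g0 z : 0 <= g z.
  by rewrite addr_ge0// mulr_ge0 ?sqr_ge0 ?poisson_ge0.
have igi : leb2s.-integrable setT (EFin \o g).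
  apply/integrableP; split.
    by apply/measurable_EFinP; exact: measurable_funD.
  by under eq_integral do rewrite gee0_abs ?lee_fin//; rewrite ig ltry.
have -> : pi * nrm2 u = 2^-1 * \int[leb2s]_z g z.
  by rewrite [in RHS]/Rintegral ig /=; lra.
rewrite -RintegralZl//; apply: le_Rintegral => //.
- by apply: integrable_prod_poisson => //; case: Lu.
- exact: (integrableZl measurableT 2^-1 igi).
move=> z _; rewrite /g -mulrDl mulrA ler_wpM2r ?poisson_ge0//.
by have := sqr_ge0 (u z.1 - u z.2); lra.
Qed.

Lemma pw_le u s : leb.-integrable setT (EFin \o u) ->
  pw u s <= 2 * (\int[leb]_x `|u x|) ^+ 2.
Proof.
move=> iu; have ic := integrable_mcos s iu; have is_ := integrable_msin s iu.
have hc : `|FC u s| <= \int[leb]_x `|u x|.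
  apply: (le_trans (le_normr_Rintegral measurableT ic)).
  apply: le_Rintegral => //; [exact: (integrable_norm ic)|exact: integrable_norm|].
  by move=> x _; rewrite normrM ler_piMr// cos_max.
have hs : `|FS u s| <= \int[leb]_x `|u x|.
  apply: (le_trans (le_normr_Rintegral measurableT is_)).
  apply: le_Rintegral => //; [exact: (integrable_norm is_)|exact: integrable_norm|].
  by move=> x _; rewrite normrM ler_piMr// sin_max.
rewrite /pw mulr_natl mulr2n -(real_normK (num_real (FC u s))).
rewrite -(real_normK (num_real (FS u s))).
by apply: lerD; rewrite lerXn2r// nnegrE Rintegral_ge0.
Qed.

Lemma integrable_decay_pw t u : 0 < t -> leb.-integrable setT (EFin \o u) ->
  leb.-integrable setT (EFin \o (fun s => decay t s * pw u s)).
Proof.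
move=> t0 iu.
have mu : measurable_fun setT u.
  by apply/measurable_EFinP; exact: (measurable_int _ iu).
pose C := 2 * (\int[leb]_x `|u x|) ^+ 2.
apply: le_integrable (integrableZr measurableT C (integrable_decay t0)) => //.
  apply/measurable_EFinP; apply: measurable_funM; first exact: measurable_decay.
  exact: measurable_pw.
move=> s _ /=; rewrite lee_fin normrM [leRHS]normrM ler_wpM2l//.
by rewrite ger0_norm ?pw_ge0//; apply: le_trans (ler_norm _); exact: pw_le.
Qed.

Lemma half_energy_ge_decay t u : 0 < t -> leb.-integrable setT (EFin \o u) ->
  ((\int[leb]_s (decay t s * pw u s))%:E <= half_energy u)%E.
Proof.
move=> t0 iu; rewrite EFin_Rintegral; last exact: integrable_decay_pw.
have mu : measurable_fun setT u.
  by apply/measurable_EFinP; exact: (measurable_int _ iu).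
apply: ge0_le_integral => //.
- by move=> s _; rewrite lee_fin mulr_ge0 ?decay_ge0 ?pw_ge0.
- by apply: (measurable_int leb); exact: integrable_decay_pw.
- apply/measurable_EFinP; apply: measurable_funM; first exact: measurable_indic.
  exact: measurable_pw.
- move=> s _; rewrite lee_fin ler_wpM2r ?pw_ge0// /decay /pos indicE.
  case: (boolP (s \in _)); rewrite ?mul0r// mul1r inE/= in_itv/= andbT => s0.
  by rewrite -expR0 ler_expR mulNr oppr_le0 mulr_ge0// ltW.
Qed.

(** Let [t] decrease to 0 along 1/(n+1): the damping factors increase to 1 on the half-line, and
    monotone convergence carries the uniform bound over. *)
Lemma half_energy_le u : L12 u -> (half_energy u <= (pi * nrm2 u)%:E)%E.
Proof.
move=> Lu; have mu := L12_meas Lu; have [iu _] := Lu.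
pose f (n : nat) s := (decay n.+1%:R^-1 s * pw u s)%:E.
have hE : half_energy u = (\int[leb]_s limn (f ^~ s))%E.
  apply: eq_integral => s _; apply/esym/cvg_lim => //.
  apply: cvg_EFin; first by apply: nearW.
  apply: cvgM; last exact: cvg_cst.
  rewrite -[X in _ --> X]mulr1 /decay; apply: cvgM; first exact: cvg_cst.
  rewrite -[X in _ --> X]expR0.
  have h : - n.+1%:R^-1 * s @[n --> \oo] --> (0 : R).
    rewrite -[X in _ --> X](mul0r s); apply: cvgM; last exact: cvg_cst.
    by rewrite -[X in _ --> X]oppr0; apply: cvgN; exact: cvg_harmonic.
  exact: (cvg_comp _ _ h (@continuous_expR R 0)).
have mf n : measurable_fun setT (f n).
  apply/measurable_EFinP; apply: measurable_funM; first exact: measurable_decay.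
  exact: measurable_pw.
have f0 n s : setT s -> (0 <= f n s)%E.
  by move=> _; rewrite lee_fin mulr_ge0 ?decay_ge0 ?pw_ge0.
have ndf s : setT s -> nondecreasing_seq (f ^~ s).
  move=> _ m n mn; rewrite lee_fin ler_wpM2r ?pw_ge0// /decay indicE.
  case: (boolP (s \in _)); rewrite ?mul0r// !mul1r inE/= in_itv/= andbT => s0.
  by rewrite ler_expR !mulNr lerN2 ler_wpM2r ?(ltW s0)// lef_pV2 ?posrE// ler_nat.
rewrite hE monotone_convergence//.
apply: lime_le.
  apply: ereal_nondecreasing_is_cvgn => m n mn; apply: ge0_le_integral => //.
  - exact: f0.
  - exact: mf.
  - exact: mf.
  - by move=> s sT; exact: ndf.
apply: nearW => n; rewrite -EFin_Rintegral; last exact: integrable_decay_pw.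
by rewrite lee_fin Rintegral_decay_pw_le.
Qed.

Lemma measurable_pos_pw u : measurable_fun setT u ->
  measurable_fun setT (fun s => (pos s * pw u s)%:E).
Proof.
move=> mu; apply/measurable_EFinP; apply: measurable_funM.
  exact: measurable_indic.
exact: measurable_pw.
Qed.

Lemma half_energy_ge0 u : (0 <= half_energy u)%E.
Proof.
by apply: integral_ge0 => s _; rewrite lee_fin mulr_ge0 ?pw_ge0// /pos indicE.
Qed.

Lemma half_energy_fin u : L12 u -> half_energy u \is a fin_num.
Proof.
move=> Lu; rewrite ge0_fin_numE ?half_energy_ge0//.
by rewrite (le_lt_trans (half_energy_le Lu))// ltry.
Qed.

(** What the inequality [half_energy_le] loses; Plancherel's identity is its vanishing. As a
    difference of two quadratic forms it obeys the parallelogram law. *)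
Definition defect u : R := pi * nrm2 u - fine (half_energy u).

Lemma defect_ge0 u : L12 u -> 0 <= defect u.
Proof.
move=> Lu; rewrite subr_ge0 -lee_fin fineK ?half_energy_le//.
exact: half_energy_fin.
Qed.

Lemma defectZ c u : L12 u -> defect (fun x => c * u x) = c ^+ 2 * defect u.
Proof.
move=> Lu; have [iu iu2] := Lu; have mu := L12_meas Lu.
rewrite /defect mulrBr; congr (_ - _).
  rewrite mulrCA; congr (_ * _); rewrite /nrm2 -RintegralZl//.
  by apply: eq_Rintegral => x _; rewrite exprMn.
rewrite /half_energy.
under eq_integral do rewrite /pw FCZ// FSZ// !exprMn -mulrDr mulrCA EFinM.
rewrite ge0_integralZl_EFin ?sqr_ge0 ?fineM//.
- exact: half_energy_fin.
- by move=> s _; rewrite lee_fin mulr_ge0 ?pw_ge0// /pos indicE.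
- exact: measurable_pos_pw.
Qed.

Lemma defect_parallelogram u v : L12 u -> L12 v ->
  defect (fun x => u x + v x) + defect (fun x => u x - v x) =
  2 * defect u + 2 * defect v.
Proof.
move=> Lu Lv; have [iu iu2] := Lu; have mu := L12_meas Lu.
have [iv iv2] := Lv; have mv := L12_meas Lv.
have Ls := L12D Lu Lv; have Ld := L12B Lu Lv.
have [is_ is2] := Ls; have [id id2] := Ld.
have hn : nrm2 (fun x => u x + v x) + nrm2 (fun x => u x - v x) =
    2 * nrm2 u + 2 * nrm2 v.
  rewrite /nrm2 -RintegralD// -!RintegralZl// -RintegralD//.
  - by apply: eq_Rintegral => x _; ring.
  - exact: (integrableZl measurableT 2 iu2).
  - exact: (integrableZl measurableT 2 iv2).
have he : (half_energy (fun x => u x + v x)%R + half_energy (fun x => u x - v x)%R =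
    2%:E * half_energy u + 2%:E * half_energy v)%E.
  rewrite /half_energy -ge0_integralD//; last 4 first.
  - by move=> s _; rewrite lee_fin mulr_ge0 ?pw_ge0// /pos indicE.
  - exact: (measurable_pos_pw (L12_meas Ls)).
  - by move=> s _; rewrite lee_fin mulr_ge0 ?pw_ge0// /pos indicE.
  - exact: (measurable_pos_pw (L12_meas Ld)).
  rewrite -!ge0_integralZl_EFin//; last 4 first.
  - by move=> s _; rewrite lee_fin mulr_ge0 ?pw_ge0// /pos indicE.
  - exact: measurable_pos_pw.
  - by move=> s _; rewrite lee_fin mulr_ge0 ?pw_ge0// /pos indicE.
  - exact: measurable_pos_pw.
  rewrite -ge0_integralD//; last 4 first.
  - by move=> s _; rewrite -EFinM lee_fin !mulr_ge0 ?pw_ge0// /pos indicE.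
  - by apply: emeasurable_funM => //; exact: measurable_pos_pw.
  - by move=> s _; rewrite -EFinM lee_fin !mulr_ge0 ?pw_ge0// /pos indicE.
  - by apply: emeasurable_funM => //; exact: measurable_pos_pw.
  apply: eq_integral => s _; rewrite -!EFinM -!EFinD; congr EFin.
  have iNv : leb.-integrable setT (EFin \o (fun x => -1 * v x)).
    by case: (L12Z (-1) Lv).
  have -> : (fun x => u x - v x) = (fun x => u x + -1 * v x).
    by apply/funext => x; rewrite mulN1r.
  by rewrite /pw !FCD// !FSD// FCZ// FSZ//; ring.
move: he (half_energy_fin Ls) (half_energy_fin Ld) (half_energy_fin Lu)
  (half_energy_fin Lv); rewrite /defect.
case: (half_energy (fun x => u x + v x)) => // a.
case: (half_energy (fun x => u x - v x)) => // b.
case: (half_energy u) => // c; case: (half_energy v) => // e.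
by move=> [he] _ _ _ _ /=; have := congr1 ( *%R pi) hn; move: he; lra.
Qed.

Definition tight u := L12 u /\ defect u = 0.

Lemma tightZ c u : tight u -> tight (fun x => c * u x).
Proof.
by move=> [Lu du]; split; [exact: L12Z|rewrite defectZ// du mulr0].
Qed.

(** By the parallelogram law the defects of the sum and of the difference are two nonnegative
    numbers adding up to 0. *)
Lemma tightD u v : tight u -> tight v -> tight (fun x => u x + v x).
Proof.
move=> [Lu du] [Lv dv]; split; first exact: L12D.
have := defect_parallelogram Lu Lv; rewrite du dv.
have := defect_ge0 (L12D Lu Lv); have := defect_ge0 (L12B Lu Lv).
by move: (defect _) (defect _) => p q; clear du dv; lra.
Qed.

Lemma tightB u v : tight u -> tight v -> tight (fun x => u x - v x).
Proof.
move=> tu tv; have := tightD tu (tightZ (-1) tv).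
by under [X in tight X -> _]eq_fun do rewrite mulN1r.
Qed.

(** Put w = u - v. The parallelogram law for [v] and w bounds the defect of u = v + w by twice the
    defect of w, hence by 2 pi times its squared norm. So the zeros of the defect are closed in
    L^2. *)
Lemma tight_lim u : L12 u ->
  (forall e, 0 < e -> exists2 v, tight v & nrm2 (fun x => u x - v x) <= e) ->
  tight u.
Proof.
move=> Lu uv; split => //; apply/eqP; rewrite eq_le defect_ge0// andbT.
apply/ler_addgt0Pl => e e0; rewrite addr0.
have e1 : 0 < e / (2 * pi) by rewrite divr_gt0// mulr_gt0// pi_gt0.
have [v [Lv dv] vu] := uv _ e1.
have Lw := L12B Lu Lv.
have := defect_parallelogram Lv Lw; rewrite dv mulr0 add0r.
have -> : (fun x => v x + (u x - v x)) = u by apply/funext => x; ring.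
have h1 := defect_ge0 (L12B Lv Lw).
have h2 : defect (fun x => u x - v x) <= pi * (e / (2 * pi)).
  rewrite (le_trans _ (ler_wpM2l (pi_ge0 _) vu))// lerBlDr lerDl fine_ge0//.
  exact: half_energy_ge0.
have h3 (p : R) : p != 0 -> 2 * (p * (e / (2 * p))) = e by move=> p0; field.
move: h1 h2 (h3 _ (lt0r_neq0 (pi_gt0 R))).
by move: (pi * _) (defect _) (defect _) (defect _) => q a b c; lra.
Qed.

End defect.

(** * Plancherel's identity for indicators of intervals *)

Section tight_all.
Context {R : realType}.
Local Notation leb := (@lebesgue_measure R).
Implicit Types (u v : R -> R) (t x y : R).
Let leb2s : {sigma_finite_measure set _ -> \bar R} := sprod leb leb.

Lemma L12_indic (A : set R) : measurable A -> (leb A < +oo)%E ->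
  L12 (\1_A : R -> R).
Proof.
move=> mA Aoo; have iA : leb.-integrable setT (EFin \o (\1_A : R -> R)).
  apply/integrableP; split; first exact/measurable_EFinP/measurable_indic.
  have -> : (\int[leb]_x `|(EFin \o (\1_A : R -> R)) x| = leb A)%E.
    rewrite -[A in RHS]setIT -integral_indic//; apply: eq_integral => x _.
    by rewrite gee0_abs// lee_fin indicE.
  by [].
split => //; apply: eq_integrable iA => // x _ /=.
by rewrite indicE; case: (_ \in _); rewrite ?expr1n ?expr0n.
Qed.

Lemma nrm2_indic (A : set R) : measurable A -> nrm2 \1_A = fine (leb A).
Proof.
move=> mA; rewrite /nrm2 /Rintegral; congr fine.
under eq_integral => x _.
  rewrite (_ : \1_A x ^+ 2 = \1_A x); last first.
    by rewrite indicE; case: (_ \in _); rewrite ?expr1n ?expr0n.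
  over.
by rewrite integral_indic// setIT.
Qed.

Let lebI (a b : R) : a < b -> fine (leb `]a, b]) = b - a.
Proof. by move=> ab; rewrite lebesgue_measure_itv/= lte_fin ab. Qed.

(** The damped energy of the indicator is an integral of sums of two arctangents over the interval.
    With [t = dl / s], a point at distance at least [dl] from both ends has both arguments at least
    [s]; the remaining points contribute a nonnegative amount. *)
Lemma half_energy_itv_ge (a b dl s : R) : 0 < dl -> 0 < s -> a + dl < b - dl ->
  (((b - a - 2 * dl) * (2 * atan s))%:E <= half_energy \1_`]a, b])%E.
Proof.
move=> d0 s0 abd; have ab : a < b by lra.
have mI : measurable (`]a, b]%classic : set R) by exact: measurable_itv.
have Ioo : (leb `]a, b] < +oo)%E by rewrite lebesgue_measure_itv/= lte_fin ab ltry.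
have [iI _] := L12_indic mI Ioo.
pose t := dl / s; have t0 : 0 < t by rewrite divr_gt0.
apply: (le_trans _ (half_energy_ge_decay t0 iI)).
rewrite decay_pwE//.
rewrite [leRHS](@EFin_Rintegral _ _ _ leb2s); last exact: integrable_prod_poisson.
rewrite fubini_tonelli1; last 2 first.
- by apply: (measurable_int leb2s); exact: integrable_prod_poisson.
- by move=> z; rewrite lee_fin mulr_ge0 ?poisson_ge0// mulr_ge0.
rewrite /fubini_F /=.
have mP x : measurable_fun setT (fun y => poisson t (x - y)).
  apply: (measurableT_comp (f := poisson t)); first exact: measurable_poisson.
  exact: measurable_funB.
have inner x : (\int[leb]_y (\1_`]a, b] x * \1_`]a, b] y * poisson t (x - y))%:E =
    (\1_`]a, b] x * (atan ((b - x) / t) - atan ((a - x) / t)))%:E)%E.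
  under eq_integral do rewrite -mulrA EFinM.
  rewrite ge0_integralZl_EFin; last 4 first.
  - by [].
  - by move=> y _; rewrite lee_fin mulr_ge0 ?poisson_ge0// ?indicE.
  - by apply/measurable_EFinP; apply: measurable_funM; [exact: measurable_indic|exact: mP].
  - by rewrite indicE.
  rewrite EFinM; congr (_ * _)%E.
  rewrite -integral_poisson_itv// -integral_itv_obnd_cbnd; last first.
    by apply/measurable_EFinP; apply: measurable_funTS.
  rewrite [RHS]integral_mkcond; apply: eq_integral => y _.
  by rewrite patchE indicE; case: ifPn => _; rewrite ?mul1r ?mul0r.
under eq_integral do rewrite inner.
pose J : set R := `](a + dl), (b - dl)]%classic.
have mJ : measurable J by exact: measurable_itv.
apply: (@le_trans _ _ (\int[leb]_x (2 * atan s * \1_J x)%:E)%E).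
  under eq_integral do rewrite EFinM.
  rewrite ge0_integralZl_EFin; last 4 first.
  - by [].
  - by move=> x _; rewrite lee_fin indicE.
  - by apply/measurable_EFinP; exact: measurable_indic.
  - by rewrite mulr_ge0// -atan0 le_atan// ltW.
  rewrite integral_indic// setIT /J /= lebesgue_measure_itv/= lte_fin abd -EFinB -EFinM.
  by rewrite lee_fin mulrC le_eqVlt; apply/orP; left; apply/eqP; ring.
have at0 y : 0 <= y -> 0 <= atan y by move=> y0; rewrite -atan0 le_atan.
apply: ge0_le_integral => //.
- by move=> x _; rewrite lee_fin !mulr_ge0 ?at0 ?(ltW s0)// ?indicE.
- apply/measurable_EFinP; apply: measurable_funM => //; exact: measurable_indic.
- apply/measurable_EFinP; apply: measurable_funM; first exact: measurable_indic.
  have ma : measurable_fun setT (@atan R).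
    by apply: continuous_measurable_fun; exact: continuous_atan.
  apply: measurable_funB; apply: (measurableT_comp ma); apply: measurable_funM => //;
    exact: measurable_funB.
move=> x _; rewrite lee_fin !indicE.
have [|xJ] := boolP (x \in J).
  rewrite /J inE/= in_itv/= => /andP[h1 h2].
  have -> : x \in `]a, b]%classic by rewrite inE/= in_itv/=; apply/andP; split; lra.
  have -> : atan ((a - x) / t) = - atan ((x - a) / t) by rewrite -atanN -mulNr opprB.
  rewrite mulr1 mul1r opprK mulr_natl mulr2n; apply: lerD; apply: le_atan.
    by rewrite ler_pdivlMr// /t mulrCA divff ?lt0r_neq0// mulr1; lra.
  by rewrite ler_pdivlMr// /t mulrCA divff ?lt0r_neq0// mulr1; lra.
rewrite mulr0; have [|_] := boolP (x \in _); last by rewrite mul0r.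
rewrite inE/= in_itv/= mul1r => /andP[h1 h2].
by rewrite subr_ge0 le_atan// ler_pM2r ?invr_gt0//; lra.
Qed.

(** Only the lower bound on the energy is at stake. Letting [s] tend to infinity and then [dl] to 0
    in [half_energy_itv_ge] produces pi times the length. *)
Lemma tight_itv (a b : R) : a < b -> tight (\1_`]a, b] : R -> R).
Proof.
move=> ab.
have mI : measurable (`]a, b]%classic : set R) by exact: measurable_itv.
have Ioo : (leb `]a, b] < +oo)%E by rewrite lebesgue_measure_itv/= lte_fin ab ltry.
have LI := L12_indic mI Ioo; split => //.
apply/eqP; rewrite eq_le defect_ge0// andbT /defect subr_le0 nrm2_indic// lebI//.
have key dl s : 0 < dl -> 0 < s -> a + dl < b - dl ->
    (b - a - 2 * dl) * (2 * atan s) <= fine (half_energy \1_`]a, b]).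
  move=> d0 s0 abd; rewrite -lee_fin fineK ?half_energy_fin//.
  exact: half_energy_itv_ge.
set E := fine _ in key *.
have key2 dl : 0 < dl -> a + dl < b - dl -> (b - a - 2 * dl) * pi <= E.
  move=> d0 abd.
  have cv : (b - a - 2 * dl) * (2 * atan s) @[s --> +oo] -->
      (b - a - 2 * dl) * (2 * (pi / 2)).
    apply: cvgM; first exact: cvg_cst.
    apply: cvgM; first exact: cvg_cst.
    exact: cvgy_atan.
  have -> : (pi : R) = 2 * (pi / 2) by rewrite mulrCA divff ?mulr1// pnatr_eq0.
  rewrite -(cvg_lim _ cv)//; apply: limr_le; first exact: (cvgP _ cv).
  by near=> s; exact: key.
apply/ler_addgt0Pl => e e0.
(* This margin loses at most [e], since 2 dl pi <= e, and keeps the inner interval nonempty. *)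
pose dl := Num.min (e / (2 * pi)) ((b - a) / 4).
have p0 := pi_gt0 R.
have d0 : 0 < dl by rewrite lt_min !divr_gt0 ?mulr_gt0// subr_gt0.
have d1 : dl <= (b - a) / 4 by rewrite ge_min lexx orbT.
have d2 : dl <= e / (2 * pi) by rewrite ge_min lexx.
have := key2 dl d0 ltac:(lra).
have : 2 * dl * pi <= e.
  by move: d2; rewrite ler_pdivlMr ?mulr_gt0//; lra.
lra.
Unshelve. all: by end_near. Qed.

End tight_all.

(** * From intervals to all real functions in L^1 and L^2 *)

Section tight_L12.
Context {R : realType}.
Local Notation leb := (@lebesgue_measure R).
Implicit Types (u v : R -> R) (A B : set R).

Lemma tight_set0 : tight (\1_set0 : R -> R).
Proof.
have := tightZ 0 (tight_itv (@ltr01 R)).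
by congr tight; apply/funext => x; rewrite mul0r indic0.
Qed.

(** The indicators of the [F n] converge in L^2 to that of the union, the squared distance being the
    measure of the difference, so [tight_lim] applies. *)
Lemma tight_nd_bigcup (F : (set R)^nat) : (forall n, measurable (F n)) ->
  nondecreasing_seq F -> (leb (\bigcup_n F n) < +oo)%E ->
  (forall n, tight (\1_(F n) : R -> R)) -> tight (\1_(\bigcup_n F n) : R -> R).
Proof.
move=> mF ndF Foo tF; set U := \bigcup_n F n in Foo *.
have mU : measurable U by exact: bigcup_measurable.
apply: tight_lim; first exact: L12_indic.
move=> e e0.
have cF := nondecreasing_cvg_mu (mu := leb) mF mU ndF.
have Ufin : leb U \is a fin_num by rewrite ge0_fin_numE.
have {}cF : leb (F n) @[n --> \oo] --> (fine (leb U))%:E by rewrite fineK.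
move: cF => /fine_cvgP[_ /cvgrPdist_le /(_ e e0)[n _ /(_ n (leqnn n))]].
have FU : F n `<=` U by exact: bigcup_sup.
have Fn_oo : (leb (F n) < +oo)%E.
  exact: le_lt_trans (le_measure leb (mem_set (mF n)) (mem_set mU) FU) Foo.
move=> /= hn; exists \1_(F n) => //.
have -> : (fun x => \1_U x - \1_(F n) x) = \1_(U `\` F n) :> (R -> R).
  apply/funext => x; rewrite !indicE in_setD.
  have [xF|xF] := boolP (x \in F n); last by rewrite subr0 andbT.
  by rewrite andbF mem_set ?subrr//; apply: FU; rewrite inE in xF.
rewrite nrm2_indic; last exact: measurableD.
have := @measureD _ _ _ leb _ _ mU (mF n) Foo.
have -> : (U `&` F n : set (measurableTypeR R)) = F n by exact/setIidr.
move=> ->.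
rewrite fineB//; last by rewrite ge0_fin_numE.
by apply: le_trans hn; exact: ler_norm.
Qed.

Let box (n : nat) : set R := `](- n%:R), n%:R]%classic.

Let measurable_box n : measurable (box n). Proof. exact: measurable_itv. Qed.

Let box_oo n : (leb (box n) < +oo)%E.
Proof. by rewrite lebesgue_measure_itv/=; case: ifP => _; rewrite -?EFinB ltry. Qed.

Let box_nd : nondecreasing_seq box.
Proof.
move=> m n mn; apply/subsetPset => x; rewrite /box /= !in_itv/= => /andP[h1 h2].
have mn' : (m%:R : R) <= n%:R by rewrite ler_nat.
by apply/andP; split; lra.
Qed.

Let box_cover : \bigcup_n box n = setT.
Proof.
rewrite -subTset => x _; have := archi_boundP (normr_ge0 x).
set n := Num.bound _ => xn; exists n => //; rewrite /box /= in_itv/=.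
have := ler_norm x; have := ler_norm (- x); rewrite normrN => h1 h2.
by apply/andP; split; lra.
Qed.

(** Dynkin's argument from the half-open intervals. Intersecting with a bounded [box] keeps every
    indicator in L^2, in particular that of a complement. *)
Lemma tight_indic_box A n : measurable A -> tight (\1_(A `&` box n) : R -> R).
Proof.
move=> mA; move: n.
apply: (@dynkin_induction _ (measurableTypeR R) (@ocitv R)
  (fun A => forall n, tight (\1_(A `&` box n) : R -> R))) => //.
- exact: ocitvI.
- move=> [|n]; first by rewrite setTI /box oppr0 set_itvoc0; exact: tight_set0.
  by rewrite setTI; apply: tight_itv; rewrite -subr_gt0 opprK.
- move=> B [[a b] _ <-] n /=.
  have -> : `]a, b]%classic `&` box n =
      `](Num.max a (- n%:R)), (Num.min b n%:R)]%classic.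
    apply/seteqP; split=> x; rewrite /box /= !in_itv/= gt_max le_min.
      by move=> [/andP[-> ->] /andP[-> ->]].
    by move=> /andP[/andP[-> ->] /andP[-> ->]].
  have [h|h] := ltP (Num.max a (- n%:R)) (Num.min b n%:R).
    exact: tight_itv.
  by rewrite set_itv_ge ?bnd_simp -?leNgt//; exact: tight_set0.
- move=> S mS tS n.
  have tn : tight (\1_(box n) : R -> R).
    case: n => [|n]; first by rewrite /box oppr0 set_itvoc0; exact: tight_set0.
    by apply: tight_itv; rewrite -subr_gt0 opprK.
  have := tightB tn (tS n); congr tight; apply/funext => x.
  rewrite !indicE !in_setI in_setC; case: (x \in S); case: (x \in box n);
    by rewrite /= ?subrr ?subr0.
(* Partial unions turn the disjoint union into an increasing one, as [tight_nd_bigcup] needs;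
   disjointness makes the indicator of a partial union a sum of indicators. *)
- move=> F mF tF FP n; have -> : \bigcup_k F k = \bigcup_k \big[setU/set0]_(i < k) F i.
    apply/seteqP; split=> x [k _ Fkx].
      by exists k.+1 => //; apply: (bigsetU_sup _ Fkx).
    exact: (bigsetU_bigcup Fkx).
  rewrite setI_bigcupl.
  apply: tight_nd_bigcup.
  + move=> k; apply: measurableI => //.
    by apply: bigsetU_measurable => i _; exact: mF.
  + move=> i j ij; apply/subsetPset; apply: setSI.
    exact: subset_bigsetU.
  + rewrite -setI_bigcupl; apply: le_lt_trans (box_oo n).
    apply: le_measure; rewrite ?inE; last exact: subIsetr.
      apply: measurableI; last exact: measurable_box.
      apply: bigcup_measurable => k _.
      by apply: bigsetU_measurable => i _; exact: mF.
    exact: measurable_box.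
  elim=> [|k IH]; first by rewrite big_ord0 set0I; exact: tight_set0.
  have := tightD IH (FP k n); congr tight; apply/funext => x.
  rewrite big_ord_recr/= !indicE !in_setI in_setU.
  case: (x \in box n); rewrite ?andbF ?addr0// !andbT.
  have [xF|_] := boolP (x \in F k); last by rewrite orbF addr0.
  rewrite orbT memNset ?add0r// -bigcup_mkord => -[i /= ik Fix].
  move: xF; rewrite inE => xF.
  have ik' := tF i k Logic.I Logic.I (ex_intro _ x (conj Fix xF)).
  by rewrite ik' ltnn in ik.
Qed.

Lemma tight_indic A : measurable A -> (leb A < +oo)%E -> tight (\1_A : R -> R).
Proof.
move=> mA Aoo.
have AE : \bigcup_n (A `&` box n) = A by rewrite -setI_bigcupr box_cover setIT.
rewrite -AE; apply: tight_nd_bigcup.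
- by move=> n; exact: measurableI.
- move=> m n mn; apply/subsetPset; apply: setIS.
  by apply/subsetPset; exact: box_nd.
- by rewrite AE.
- by move=> n; exact: tight_indic_box.
Qed.

Import HBNNSimple.

(** A linear combination of indicators of level sets. By integrability the level set of a positive
    value has finite measure; a nonpositive value contributes the zero function, because [f] is
    nonnegative. *)
Lemma tight_nnsfun (f : {nnsfun R >-> R}) :
  leb.-integrable setT (EFin \o f) -> tight f.
Proof.
move=> i_f.
have -> : f = (fun x => \sum_(y <- finmap.enum_fset (fset_set (range f)))
    (y * \1_(f @^-1` [set y]) x)) :> (R -> R).
  by apply/funext => x; rewrite fimfunE fsbig_finite.
elim: (finmap.enum_fset _) => [|y s IH].
  by under eq_fun do rewrite big_nil; have := tight_set0; congr tight; apply/funext => x; rewrite indic0.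
under eq_fun do rewrite big_cons.
apply: tightD => //.
have mY : measurable (f @^-1` [set y]) by [].
have [y0|y0] := leP y 0.
  have := tightZ 0 tight_set0; congr tight; apply/funext => x.
  rewrite mul0r indicE; have [|_] := boolP (x \in _); last by rewrite mulr0.
  rewrite inE/= => fxy; suff -> : y = 0 by rewrite mul0r.
  by apply/eqP; rewrite eq_le y0 -fxy/=.
apply: tightZ; apply: tight_indic => //.
have : (\int[leb]_x (y * \1_(f @^-1` [set y]) x)%:E < +oo)%E.
  move/integrableP : i_f => [mf]; apply: le_lt_trans.
  apply: ge0_le_integral => //.
  - by move=> x _; rewrite lee_fin mulr_ge0 ?(ltW y0)// indicE.
  - by apply/measurable_EFinP; apply: measurable_funM => //; exact: measurable_indic.
  - exact: measurableT_comp.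
  - move=> x _; rewrite /= lee_fin ger0_norm// indicE.
    have [|_] := boolP (x \in _); last by rewrite mulr0.
    by rewrite inE/= => ->; rewrite mulr1.
under eq_integral do rewrite EFinM.
rewrite ge0_integralZl_EFin; last 4 first.
- by [].
- by move=> x _; rewrite lee_fin indicE.
- by apply/measurable_EFinP; exact: measurable_indic.
- exact: ltW.
rewrite integral_indic// setIT.
move=> h; rewrite ltey; apply/eqP => E; move: h.
by rewrite /= E mulry gtr0_sg// mul1e ltxx.
Qed.

(** Simple functions increasing to [u] converge to it in L^2, by dominated convergence with bound
    u^2. *)
Lemma tight_ge0 u : (forall x, 0 <= u x) -> L12 u -> tight u.
Proof.
move=> u0 Lu; have mu := L12_meas Lu; have [iu iu2] := Lu.
have mEu : measurable_fun setT (EFin \o u) by exact/measurable_EFinP.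
pose g := nnsfun_approx measurableT mEu.
have gu n x : g n x <= u x.
  by rewrite -lee_fin nnsfun_approxE; apply: (le_approx n (f := EFin \o u)) => // y _; rewrite lee_fin.
have gcvg x : g n x @[n --> \oo] --> u x.
  by have /fine_cvgP[] := cvg_nnsfun_approx measurableT mEu
    (fun y _ => u0 y : (0 <= (EFin \o u) y)%E) (x := x) Logic.I.
apply: tight_lim => // e e0.
have mg n : measurable_fun setT (fun x => ((u x - g n x) ^+ 2)%:E).
  by apply/measurable_EFinP; apply: measurable_funX; apply: measurable_funB.
have le_g n x : (u x - g n x) ^+ 2 <= u x ^+ 2.
  have gu' := gu n x; have g0 : 0 <= g n x by [].
  by rewrite lerXn2r ?nnegrE ?subr_ge0// gerBl.
have [| | | |_ _] := @dominated_convergence _ _ _ leb setT measurableT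
  (fun n x => ((u x - g n x) ^+ 2)%:E) (cst 0%E) (fun x => (u x ^+ 2)%:E) mg.
- exact: measurable_cst.
- apply: aeW => x _; apply: cvg_EFin; first exact: nearW.
  have h : u x - g n x @[n --> \oo] --> (0 : R).
    rewrite -[X in _ --> X](subrr (u x)).
    by apply: cvgB; [exact: cvg_cst|exact: gcvg].
  by rewrite -(mulr0 (0 : R)); exact: (cvgM h h).
- exact: iu2.
- by apply: aeW => x n _; rewrite gee0_abs ?lee_fin ?sqr_ge0.
rewrite integral0 => /fine_cvgP[_ /cvgrPdist_le /(_ e e0)[n _ /(_ n (leqnn n))]] /=.
rewrite sub0r normrN => hn.
have Lg : L12 (g n).
  have mgn : measurable_fun setT (g n) by [].
  split.
    apply: le_integrable iu => //; first exact/measurable_EFinP.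
    by move=> x _; rewrite /= lee_fin !ger0_norm.
  apply: le_integrable iu2 => //.
    by apply/measurable_EFinP; exact: measurable_funX.
  move=> x _; rewrite /= lee_fin !ger0_norm ?sqr_ge0//.
  by rewrite lerXn2r ?nnegrE.
exists (g n); first by apply: tight_nnsfun; case: Lg.
exact: le_trans (ler_norm _) hn.
Qed.

Theorem tight_L12 u : L12 u -> tight u.
Proof.
move=> Lu; have mu := L12_meas Lu; have [iu iu2] := Lu.
have h (v : R -> R) : measurable_fun setT v -> (forall x, 0 <= v x) ->
    (forall x, v x <= `|u x|) -> tight v.
  move=> mv v0 vu; apply: tight_ge0 => //; split.
    apply: le_integrable iu => //; first exact/measurable_EFinP.
    by move=> x _; rewrite /= lee_fin ger0_norm.
  apply: le_integrable iu2 => //.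
    by apply/measurable_EFinP; exact: measurable_funX.
  move=> x _; rewrite /= lee_fin !normrX lerXn2r ?nnegrE//.
  by rewrite ger0_norm.
have -> : u = (fun x => Num.max (u x) 0 - Num.max (- u x) 0).
  apply/funext => x; have [h1|h1] := leP (u x) 0.
    by rewrite sub0r max_l ?oppr_ge0// opprK.
  by rewrite max_r ?subr0// oppr_le0 ltW.
apply: tightB; apply: h.
- by apply: measurable_maxr => //; exact: measurable_cst.
- by move=> x; rewrite le_max lexx orbT.
- by move=> x; rewrite ge_max normr_ge0 ler_norm.
- apply: measurable_maxr; last exact: measurable_cst.
  exact: measurableT_comp.
- by move=> x; rewrite le_max lexx orbT.
- by move=> x; rewrite ge_max normr_ge0 -normrN ler_norm.
Qed.

End tight_L12.

(** * Plancherel's identity for an abstract kernel; the line, conjugates and products *)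

Definition plancherel {d1 d2} {X : measurableType d1} {Xi : measurableType d2}
    {R : realType} (mu : {measure set X -> \bar R})
    (nu : {measure set Xi -> \bar R}) (e : Xi * X -> R[i]) (c : R) : Prop :=
  forall f : X -> R[i], cintegrable mu f ->
    mu.-integrable setT (fun x => (sqn (f x))%:E) ->
    (\int[nu]_s (sqn (cintegral mu setT (fun x => e (s, x) * f x)))%:E =
     c%:E * \int[mu]_x (sqn (f x))%:E)%E.

Section expi_lemmas.
Context {R : realType}.
Implicit Types a b : R.

Lemma expiD a b : expi (a + b) = expi a * expi b.
Proof. by apply: complex_eq; rewrite !cReImE /= ?cosD ?sinD//; ring. Qed.

Lemma expiN a : expi (- a) = conjc (expi a).
Proof. by rewrite /expi cosN sinN. Qed.

Lemma sqn_expi a : sqn (expi a) = 1.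
Proof. by rewrite /sqn /= cos2Dsin2. Qed.

Lemma l1n_expi a : l1n (expi a) <= 2.
Proof. by rewrite /l1n /=; have := cos_max a; have := sin_max a; lra. Qed.

Lemma cmeas_expi {d} {T : measurableType d} (f : T -> R) :
  measurable_fun setT f -> cmeas (fun x => expi (f x)).
Proof.
move=> mf; split => /=.
  exact: (measurableT_comp measurable_cos mf).
exact: (measurableT_comp measurable_sin mf).
Qed.

End expi_lemmas.

Section plancherel_line.
Context {R : realType}.
Local Notation leb := (@lebesgue_measure R).

Definition fourier_kernel (z : measurableTypeR R * measurableTypeR R) : R[i] :=
  expi (- (z.1 * z.2)).

Lemma cmeas_fourier_kernel : cmeas fourier_kernel.
Proof.
by apply: cmeas_expi; apply: measurableT_comp => //; exact: measurable_funM.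
Qed.

Lemma sqn_fourier_kernel z : sqn (fourier_kernel z) = 1.
Proof. exact: sqn_expi. Qed.

(** For f = u + i v the cross terms in the squared modulus of the transform are odd in the
    frequency. Adding the values at s and -s leaves twice the power spectra of u and v, whose
    half-line energies are pi times their squared norms by [tight_L12]. *)
Lemma plancherel_fourier : plancherel leb leb fourier_kernel (2 * pi).
Proof.
move=> f cf if2.
have ir := cintegrable_Re cf; have ii := cintegrable_Im cf.
pose u x := complex.Re (f x); pose v x := complex.Im (f x).
have [mu mv] : measurable_fun setT u /\ measurable_fun setT v by case: cf.
have Lu : L12 u.
  split => //; apply: le_integrable if2 => //.
    by apply/measurable_EFinP; exact: measurable_funX.
  by move=> x _; rewrite /= lee_fin !ger0_norm ?sqn_ge0 ?sqr_ge0// lerDl sqr_ge0.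
have Lv : L12 v.
  split => //; apply: le_integrable if2 => //.
    by apply/measurable_EFinP; exact: measurable_funX.
  by move=> x _; rewrite /= lee_fin !ger0_norm ?sqn_ge0 ?sqr_ge0// lerDr sqr_ge0.
pose S s := sqn (cintegral leb setT (fun x => fourier_kernel (s, x) * f x)).
have SE s : S s = (FC u s + FS v s) ^+ 2 + (FC v s - FS u s) ^+ 2.
  rewrite /S /sqn; congr (_ ^+ 2 + _ ^+ 2).
    transitivity (\int[leb]_x complex.Re (fourier_kernel (s, x) * f x)) => //.
    rewrite /FC /FS -RintegralD//; [|exact: integrable_mcos|exact: integrable_msin].
    apply: eq_Rintegral => x _. rewrite cReM /= cosN sinN /u /v; ring.
  transitivity (\int[leb]_x complex.Im (fourier_kernel (s, x) * f x)) => //.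
  rewrite /FC /FS -RintegralB//; [|exact: integrable_mcos|exact: integrable_msin].
  by apply: eq_Rintegral => x _; rewrite cImM /= cosN sinN /u /v; ring.
have FCN (w : R -> R) s : FC w (- s) = FC w s.
  by apply: eq_Rintegral => x _; rewrite mulNr cosN.
have FSN w s : leb.-integrable setT (EFin \o w) -> FS w (- s) = - FS w s.
  move=> iw; rewrite -[RHS]mulN1r /FS -RintegralZl//; last exact: integrable_msin.
  by apply: eq_Rintegral => x _; rewrite mulNr sinN; ring.
have mS : measurable_fun setT S.
  rewrite (funext SE : S = _).
  apply: measurable_funD; apply: measurable_funX.
    by apply: measurable_funD; [exact: measurable_FC|exact: measurable_FS].
  by apply: measurable_funB; [exact: measurable_FC|exact: measurable_FS].
have mSN : measurable_fun setT (fun s : R => S (- s)).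
  exact: (measurableT_comp mS).
have S0 s : (0 <= (S s)%:E)%E by rewrite lee_fin sqn_ge0.
transitivity (\int[leb]_s (S s)%:E)%E; first by [].
move: (S) SE mS mSN S0 => {}S SE mS mSN S0.
transitivity (\int[leb]_(s in `]0%R, +oo[) ((S s)%:E + (S (- s))%:E))%E.
  have TE : [set: R] = `]-oo, 0%R] `|` `]0%R, +oo[.
    apply/seteqP; split=> // s _ /=; rewrite !in_itv/= andbT.
    by have [h|h] := leP s 0; [left|right].
  rewrite TE ge0_integral_setU//; last 2 first.
  - by rewrite -TE; exact/measurable_EFinP.
  - apply/disj_setPS => s [] /=; rewrite !in_itv/= andbT => h1 h2.
    by have := lt_le_trans h2 h1; rewrite ltxx.
  rewrite ge0_integralD//; last 2 first.
  - by apply/measurable_EFinP; exact: measurable_funTS.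
  - by apply/measurable_EFinP; exact: measurable_funTS.
  rewrite addeC; congr (_ + _)%E.
  have := @ge0_integration_by_substitution0 R (fun s : R => (S (- s))%:E).
  under [X in _ -> _ -> _ = X]eq_integral do rewrite opprK.
  move=> <-//; last exact/measurable_EFinP.
  apply/esym/integral_itv_obnd_cbnd.
  by apply/measurable_EFinP; exact: measurable_funTS.
pose pos (s : R) : R := \1_(`]0, +oo[%classic) s.
transitivity (\int[leb]_s (2%:E * ((pos s * pw u s)%:E + (pos s * pw v s)%:E)))%E.
  rewrite integral_mkcond; apply: eq_integral => s _.
  rewrite patchE /pos indicE; case: ifPn => _; last by rewrite !mul0r adde0 mule0.
  rewrite !mul1r -!EFinD -EFinM; congr EFin.
  by rewrite !SE !FCN !FSN// /pw; ring.
have pe w : L12 w -> (\int[leb]_s (pos s * pw w s)%:E = pi%:E * (nrm2 w)%:E)%E.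
  move=> Lw; have [_] := tight_L12 Lw; rewrite /defect => /subr0_eq E.
  by rewrite -EFinM E fineK// half_energy_fin.
have p0 w s : setT s -> (0 <= (pos s * pw w s)%:E)%E.
  by move=> _; rewrite lee_fin mulr_ge0 ?pw_ge0// /pos indicE.
rewrite ge0_integralZl_EFin//; last 2 first.
- by move=> s _; rewrite adde_ge0 ?p0.
- by apply: emeasurable_funD; exact: measurable_pos_pw.
rewrite ge0_integralD//; last 4 first.
- by move=> s _; exact: p0.
- exact: measurable_pos_pw.
- by move=> s _; exact: p0.
- exact: measurable_pos_pw.
rewrite !pe// !EFin_nrm2// -ge0_muleDr; last 2 first.
- by apply: integral_ge0 => x _; rewrite lee_fin sqr_ge0.
- by apply: integral_ge0 => x _; rewrite lee_fin sqr_ge0.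
rewrite muleA -EFinM -ge0_integralD//.
- by move=> x _; rewrite lee_fin sqr_ge0.
- by apply/measurable_EFinP; exact: measurable_funX.
- by move=> x _; rewrite lee_fin sqr_ge0.
- by apply/measurable_EFinP; exact: measurable_funX.
Qed.

End plancherel_line.

Section ae_cintegral.
Context {d} {T : measurableType d} {R : realType}.
Variable mu : {measure set T -> \bar R}.

Lemma ae_eq_cintegral (f g : T -> R[i]) : cmeas f -> cmeas g ->
  {ae mu, forall x, f x = g x} ->
  cintegral mu setT f = cintegral mu setT g.
Proof.
move=> [fr fi] [gr gi] fg; apply: complex_eq => /=; congr fine;
  (apply: ae_eq_integral => //; [exact/measurable_EFinP|exact/measurable_EFinP|]);
  by move: fg; apply: filterS => x /= -> .
Qed.

End ae_cintegral.

Section plancherel_conj.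
Context {d1 d2} {X : measurableType d1} {Xi : measurableType d2} {R : realType}.
Variables (mu : {measure set X -> \bar R}) (nu : {measure set Xi -> \bar R}).

(** Transforming [f] with the conjugate kernel amounts to conjugating the transform of the conjugate
    of [f], and [sqn] ignores conjugation. *)
Lemma plancherel_conjc (e : Xi * X -> R[i]) (c : R) : cmeas e ->
  (forall z, l1n (e z) <= 2) ->
  plancherel mu nu e c -> plancherel mu nu (fun z => conjc (e z)) c.
Proof.
move=> me e1 pe f cf if2.
have cf' : cintegrable mu (fun x => conjc (f x)).
  have [mf if1] := cf; split; first exact: cmeas_conj.
  by under eq_fun do rewrite l1n_conj.
have h (a : R[i]) : sqn (conjc a) = sqn a by exact: sqn_conj.
transitivity (c%:E * \int[mu]_x (sqn (conjc (f x)))%:E)%E; last first.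
  by under eq_integral do rewrite h.
rewrite -(pe _ cf'); last by under eq_fun do rewrite h.
apply: eq_integral => s _; rewrite -[in RHS]h -cintegral_conj; last first.
  apply: (@cintegrableM_bounded _ _ _ _ 2) => //.
  exact: (cmeas_comp me (pair1_measurable s)).
congr (sqn _)%:E; apply: eq_cintegral => x _.
by rewrite rmorphM/= conjcK.
Qed.

End plancherel_conj.

Section plancherel_prod.
Context {d1 d2 d3 d4} {X1 : measurableType d1} {X2 : measurableType d2}
  {Y1 : measurableType d3} {Y2 : measurableType d4} {R : realType}.
Variables (m1 : {sigma_finite_measure set X1 -> \bar R})
  (m2 : {sigma_finite_measure set X2 -> \bar R})
  (n1 : {sigma_finite_measure set Y1 -> \bar R})
  (n2 : {sigma_finite_measure set Y2 -> \bar R}).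
Variables (e1 : Y1 * X1 -> R[i]) (e2 : Y2 * X2 -> R[i]) (c1 c2 : R).
Hypotheses (me1 : cmeas e1) (me2 : cmeas e2).
Hypotheses (e1_le : forall z, l1n (e1 z) <= 2) (e2_le : forall z, l1n (e2 z) <= 2).
Hypotheses (c1_ge0 : 0 <= c1) (c2_ge0 : 0 <= c2).
Hypotheses (pl1 : plancherel m1 n1 e1 c1) (pl2 : plancherel m2 n2 e2 c2).

Definition prod_kernel (z : (Y1 * Y2) * (X1 * X2)) : R[i] :=
  e1 (z.1.1, z.2.1) * e2 (z.1.2, z.2.2).

Lemma cmeas_prod_kernel : cmeas prod_kernel.
Proof.
apply: cmeasM.
  apply: (cmeas_comp me1).
  by apply: measurable_fun_pair; exact: measurableT_comp.
apply: (cmeas_comp me2).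
by apply: measurable_fun_pair; exact: measurableT_comp.
Qed.

Section transform.
Variable f : X1 * X2 -> R[i].
Hypothesis cf : cintegrable (m1 \x m2)%E f.
Hypothesis if2 : (m1 \x m2)%E.-integrable setT (fun x => (sqn (f x))%:E).

Let mf : cmeas f. Proof. by case: cf. Qed.

(** The partial transform in the first variable. Its energy comes from [pl1] on sections of [f];
    then [pl2] is applied to its own sections. *)
Let G (z : Y1 * X2) : R[i] :=
  cintegral m1 setT (fun x => e1 (z.1, x) * f (x, z.2)).

Let mG : cmeas G.
Proof.
apply: (cmeas_cintegral_param m1
  (f := fun w : (Y1 * X2) * X1 => e1 (w.1.1, w.2) * f (w.2, w.1.2))).
apply: cmeasM.
  apply: (cmeas_comp me1).
  by apply: measurable_fun_pair => //; exact: measurableT_comp.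
apply: (cmeas_comp mf).
by apply: measurable_fun_pair => //; exact: measurableT_comp.
Qed.

Let sqnE0 (T : Type) (g : T -> R[i]) x : (0 <= (sqn (g x))%:E)%E.
Proof. by rewrite lee_fin sqn_ge0. Qed.

Let msqn d (T : measurableType d) (g : T -> R[i]) : cmeas g ->
  measurable_fun setT (fun x => (sqn (g x))%:E).
Proof. by move=> mg; apply/measurable_EFinP; exact: measurable_sqn. Qed.

Let G_energy : (\int[n1 \x m2]_z (sqn (G z))%:E =
  c1%:E * \int[m1 \x m2]_z (sqn (f z))%:E)%E.
Proof.
rewrite fubini_tonelli2//; last exact: msqn.
rewrite [in RHS]fubini_tonelli2//; last exact: msqn.
rewrite -ge0_integralZl_EFin//; last 2 first.
- by move=> y _; apply: integral_ge0 => x _; exact: sqnE0.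
- by apply: measurable_fun_fubini_tonelli_G => //; exact: msqn.
apply: ge0_ae_eq_integral => //.
- by apply: measurable_fun_fubini_tonelli_G => //; exact: msqn.
- apply: emeasurable_funM => //.
  by apply: measurable_fun_fubini_tonelli_G => //; exact: msqn.
- by move=> y _; apply: integral_ge0 => x _; exact: sqnE0.
- move=> y _; rewrite mule_ge0//; apply: integral_ge0 => x _; exact: sqnE0.
have h1 := ae_integrable2 (cf.2); have h2 := ae_integrable2 if2.
apply: filterS2 h1 h2 => y fy1 fy2 _.
rewrite -pl1//; split => //.
exact: (cmeas_comp mf (pair2_measurable y)).
Qed.

Let integrable_sqnG : (n1 \x m2)%E.-integrable setT (fun z => (sqn (G z))%:E).
Proof.
apply/integrableP; split; first exact: msqn.
under eq_integral do rewrite gee0_abs//.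
rewrite G_energy lte_mul_pinfty//; last by case/integrableP : if2 => _;
  under eq_integral do rewrite gee0_abs//.
Qed.

(** True for every [s] and not just almost every one: [G (s, y)] is a marginal of an integrable
    function of two variables, the kernel being bounded. *)
Let cintegrable_G s : cintegrable m2 (fun y => G (s, y)).
Proof.
have : cintegrable (m1 \x m2)%E (fun z => e1 (s, z.1) * f z).
  apply: (@cintegrableM_bounded _ _ _ _ 2) => //.
  apply: (cmeas_comp me1); apply: measurable_fun_pair => //; exact: measurable_cst.
exact: cintegrable_param2.
Qed.

Let F (s : Y1 * Y2) : R[i] :=
  cintegral (m1 \x m2)%E setT (fun x => prod_kernel (s, x) * f x).

Let FE s1 s2 : F (s1, s2) =
  cintegral m2 setT (fun y => e2 (s2, y) * G (s1, y)).
Proof.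
have ce : cintegrable (m1 \x m2)%E (fun z => e1 (s1, z.1) * f z).
  apply: (@cintegrableM_bounded _ _ _ _ 2) => //.
  apply: (cmeas_comp me1); apply: measurable_fun_pair => //; exact: measurable_cst.
have ck : cintegrable (m1 \x m2)%E (fun z => prod_kernel (s1, s2, z) * f z).
  apply: (@cintegrableM_bounded _ _ _ _ 4) => //.
    exact: (cmeas_comp cmeas_prod_kernel (pair1_measurable _)).
  move=> z; apply: (le_trans (l1nM _ _)).
  have := e1_le (s1, z.1); have := e2_le (s2, z.2) => /= h1 h2.
  by rewrite (_ : 4 = 2 * 2 :> R) ?ler_pM ?l1n_ge0//; ring.
rewrite /F -(cintegral_fubini2 ck).
apply: ae_eq_cintegral.
- exact: (cintegrable_param2 ck).1.
- apply: cmeasM; last exact: (cintegrable_G s1).1.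
  exact: (cmeas_comp me2 (pair1_measurable _)).
have := ae_integrable2 ce.2; apply: filterS => y iy.
rewrite /G -cintegralZ; last first.
  split => //; apply: cmeasM.
    exact: (cmeas_comp me1 (pair1_measurable _)).
  exact: (cmeas_comp mf (pair2_measurable _)).
by apply: eq_cintegral => x _; rewrite /prod_kernel /= mulrCA mulrA.
Qed.

Let mF : cmeas F.
Proof.
have := @cmeas_cintegral_param _ _ _ _ R (sprod m1 m2)
  (fun z : (Y1 * Y2) * (X1 * X2) => prod_kernel z * f z.2).
apply; apply: cmeasM; first exact: cmeas_prod_kernel.
exact: (cmeas_comp mf).
Qed.

(** The full transform is the transform of [G] in its second variable ([FE]), so the two identities
    compose. Sections of [G] are known to be square integrable for almost every frequency, which is
    enough under the outer integral. *)
Lemma plancherel_prod_transform :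
  (\int[n1 \x n2]_s (sqn (F s))%:E =
   (c1 * c2)%:E * \int[m1 \x m2]_z (sqn (f z))%:E)%E.
Proof.
rewrite fubini_tonelli1//; last exact: msqn.
rewrite mulrC EFinM -muleA -G_energy fubini_tonelli1//; last exact: msqn.
rewrite -ge0_integralZl_EFin//; last 2 first.
- by move=> y _; apply: integral_ge0 => x _; exact: sqnE0.
- by apply: measurable_fun_fubini_tonelli_F => //; exact: msqn.
apply: ge0_ae_eq_integral => //.
- by apply: measurable_fun_fubini_tonelli_F => //; exact: msqn.
- apply: emeasurable_funM => //.
  by apply: measurable_fun_fubini_tonelli_F => //; exact: msqn.
- by move=> y _; apply: integral_ge0 => x _; exact: sqnE0.
- move=> y _; rewrite mule_ge0//; apply: integral_ge0 => x _; exact: sqnE0.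
have := ae_integrable1 integrable_sqnG; apply: filterS => s is_ _.
rewrite /fubini_F -(pl2 (cintegrable_G s) is_).
by apply: eq_integral => t _; rewrite FE.
Qed.

End transform.

Lemma plancherel_prod :
  plancherel (m1 \x m2)%E (n1 \x n2)%E prod_kernel (c1 * c2).
Proof. by move=> f cf if2; exact: plancherel_prod_transform. Qed.

End plancherel_prod.

(** * Inversion in L^2 from the Plancherel identities of a kernel and its adjoint *)

Section inversion.
Context {d1 d2} {X : measurableType d1} {Xi : measurableType d2} {R : realType}.
Variables (mu : {sigma_finite_measure set X -> \bar R})
  (nu : {sigma_finite_measure set Xi -> \bar R}).
Variables (e : Xi * X -> R[i]) (c : R).
Hypotheses (me : cmeas e) (e_le : forall z, l1n (e z) <= 2) (c_gt0 : 0 < c).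
Hypothesis pl : plancherel mu nu e c.
Hypothesis pl_adj : plancherel nu mu (fun z : X * Xi => conjc (e (z.2, z.1))) c.
Variable f : X -> R[i].
Hypotheses (cf : cintegrable mu f)
  (if2 : mu.-integrable setT (fun x => (sqn (f x))%:E)).

Definition transform (s : Xi) : R[i] :=
  cintegral mu setT (fun x => e (s, x) * f x).

Definition trunc_transform (B : set Xi) (s : Xi) : R[i] :=
  (\1_B s)%:C * transform s.

Definition partial_inverse (B : set Xi) (x : X) : R[i] :=
  (c^-1)%:C * cintegral nu setT (fun s => conjc (e (s, x)) * trunc_transform B s).

Lemma cmeas_transform : cmeas transform.
Proof.
apply: (cmeas_cintegral_param mu (f := fun z => e z * f z.2)).
by apply: cmeasM => //; apply: (cmeas_comp cf.1).
Qed.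

(** With this bound, the transform cut to a set of finite measure is integrable, so that [pl_adj]
    applies to it. *)
Lemma l1n_transform_le s :
  l1n (transform s) <= 2 * fine (\int[mu]_x (l1n (f x))%:E).
Proof.
have ce : cintegrable mu (fun x => e (s, x) * f x).
  apply: (@cintegrableM_bounded _ _ _ _ 2) => //.
  exact: (cmeas_comp me (pair1_measurable s)).
apply: (le_trans (l1n_cintegral_le ce)).
rewrite -!/(Rintegral mu setT (fun x => l1n _)) -RintegralZl//; last exact: cf.2.
apply: le_Rintegral => //; first exact: ce.2.
  exact: (integrableZl measurableT 2 cf.2).
by move=> x _; apply: (le_trans (l1nM _ _)); rewrite ler_wpM2r// l1n_ge0.
Qed.

Lemma transform_energy : (\int[nu]_s (sqn (transform s))%:E =
  (c * \int[mu]_x sqn (f x))%:E)%E.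
Proof. by rewrite EFinM EFin_Rintegral//; exact: pl. Qed.

Lemma integrable_sqn_transform : nu.-integrable setT (fun s => (sqn (transform s))%:E).
Proof.
apply/integrableP; split.
  by apply/measurable_EFinP; apply: measurable_sqn; exact: cmeas_transform.
by under eq_integral do rewrite gee0_abs ?lee_fin ?sqn_ge0//;
  rewrite transform_energy ltry.
Qed.

Section truncated.
Variable B : set Xi.
Hypotheses (mB : measurable B) (B_oo : (nu B < +oo)%E).

Let g := trunc_transform B.

Let mg : cmeas g.
Proof.
apply: cmeasM; last exact: cmeas_transform.
by apply: cmeas_real; exact: measurable_indic.
Qed.

Let cg : cintegrable nu g.
Proof.
pose M := 2 * fine (\int[mu]_x (l1n (f x))%:E).
have i1 : nu.-integrable setT (fun x => (M * \1_B x)%:E).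
  have : nu.-integrable setT (fun x => (\1_B x)%:E).
    apply/integrableP; split; first exact/measurable_EFinP/measurable_indic.
    rewrite (eq_integral (fun x => (\1_B x)%:E)); last first.
      by move=> x _; rewrite gee0_abs// lee_fin indicE.
    by rewrite integral_indic// setIT.
  exact: integrableZl.
apply: (cintegrable_le mg i1) => s; apply: (le_trans (l1nM _ _)).
rewrite mulrC; apply: ler_pM; rewrite ?l1n_ge0 ?l1n_transform_le//.
by rewrite /l1n /= normr0 addr0 ger0_norm// indicE.
Qed.

Let sqn_g s : sqn (g s) = \1_B s * sqn (transform s).
Proof.
rewrite /g /trunc_transform sqnM; congr (_ * _).
by rewrite /sqn /= expr0n addr0 indicE; case: (_ \in _); rewrite ?expr1n ?expr0n.
Qed.

Lemma integrable_trunc_energy :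
  nu.-integrable setT (fun s => (\1_B s * sqn (transform s))%:E).
Proof.
apply: le_integrable integrable_sqn_transform => //.
  apply/measurable_EFinP; apply: measurable_funM; first exact: measurable_indic.
  by apply: measurable_sqn; exact: cmeas_transform.
move=> s _; rewrite /= lee_fin normrM ler_piMl// indicE.
by case: (_ \in _); rewrite ?normr1 ?normr0.
Qed.

Let ig2 : nu.-integrable setT (fun s => (sqn (g s))%:E).
Proof. by under eq_fun do rewrite sqn_g; exact: integrable_trunc_energy. Qed.

Let T (x : X) := cintegral nu setT (fun s => conjc (e (s, x)) * g s).

Let mT : cmeas T.
Proof.
apply: (cmeas_cintegral_param nu (f := fun z => conjc (e (z.2, z.1)) * g z.2)).
apply: cmeasM; last exact: (cmeas_comp mg).
apply: cmeas_conj; apply: (cmeas_comp me).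
by apply: measurable_fun_pair.
Qed.

Let T_energy : (\int[mu]_x (sqn (T x))%:E = (c * \int[nu]_s sqn (g s))%:E)%E.
Proof. by rewrite EFinM EFin_Rintegral//; exact: pl_adj. Qed.

Let S := partial_inverse B.

Let iT : mu.-integrable setT (fun x => (sqn (T x))%:E).
Proof.
apply/integrableP; split.
  by apply/measurable_EFinP; exact: measurable_sqn.
by under eq_integral do rewrite gee0_abs ?lee_fin ?sqn_ge0//; rewrite T_energy ltry.
Qed.

Lemma cmeas_partial_inverse : cmeas (partial_inverse B).
Proof. by apply: cmeasM => //; exact: cmeas_cst. Qed.

Let sqnS x : sqn (S x) = c^-2 * sqn (T x).
Proof.
by rewrite /S /partial_inverse sqnM /T; congr (_ * _); rewrite /sqn /= expr0n addr0 exprVn.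
Qed.

Lemma integrable_sqn_partial_inverse :
  mu.-integrable setT (fun x => (sqn (partial_inverse B x))%:E).
Proof.
by under eq_fun do rewrite sqnS; exact: (integrableZl measurableT (c^-2) iT).
Qed.

Let E := \int[nu]_s (\1_B s * sqn (transform s)).

Let int_sqnS : \int[mu]_x sqn (S x) = c^-1 * E.
Proof.
rewrite /Rintegral; under eq_integral do rewrite sqnS EFinM.
rewrite ge0_integralZl_EFin//.
- rewrite T_energy /= /E; under [in LHS]eq_Rintegral do rewrite sqn_g.
  by rewrite mulrA; congr (_ * _); field; rewrite lt0r_neq0.
- by move=> x _; rewrite lee_fin sqn_ge0.
- by apply/measurable_EFinP; exact: measurable_sqn.
- by rewrite invr_ge0 exprn_ge0// ltW.
Qed.

(** Fubini moves the adjoint kernel from [g] onto [f] and leaves the pairing of the truncated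
    transform with the full one. The double integral converges absolutely: the kernel is bounded,
    and [f] and [g] are integrable. *)
Let cross : cintegral mu setT (fun x => T x * conjc (f x)) = E%:C.
Proof.
pose h (z : X * Xi) : R[i] := conjc (e (z.2, z.1)) * (conjc (f z.1) * g z.2).
have ch0 : cintegrable (mu \x nu)%E (fun z => conjc (f z.1) * g z.2).
  have i0 := integrable_prod cf.2 cg.2.
  apply: (cintegrable_le _ i0).
    apply: cmeasM; last exact: (cmeas_comp mg).
    by apply: cmeas_conj; exact: (cmeas_comp cf.1).
  by move=> z; apply: (le_trans (l1nM _ _)); rewrite l1n_conj.
have ch : cintegrable (mu \x nu)%E h.
  apply: (@cintegrableM_bounded _ _ _ _ 2) => //.
    by apply: cmeas_conj; apply: (cmeas_comp me); exact: measurable_fun_pair.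
  by move=> z; rewrite l1n_conj.
have ceg x : cintegrable nu (fun s => conjc (e (s, x)) * g s).
  apply: (@cintegrableM_bounded _ _ _ _ 2) => //.
    by apply: cmeas_conj; exact: (cmeas_comp me (pair2_measurable x)).
  by move=> s; rewrite l1n_conj.
transitivity (cintegral mu setT (fun x => cintegral nu setT (fun s => h (x, s)))).
  apply: eq_cintegral => x _; rewrite mulrC -cintegralZ//.
  by apply: eq_cintegral => s _; rewrite /h/=; ring.
rewrite (cintegral_fubini1 ch) -(cintegral_fubini2 ch).
transitivity (cintegral nu setT (fun s => (sqn (g s))%:C)).
  apply: eq_cintegral => s _.
  have cef : cintegrable mu (fun x => e (s, x) * f x).
    apply: (@cintegrableM_bounded _ _ _ _ 2) => //.
    exact: (cmeas_comp me (pair1_measurable s)).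
  transitivity (g s * conjc (transform s)).
    rewrite /transform -cintegral_conj// -cintegralZ.
      by apply: eq_cintegral => x _; rewrite /h/= rmorphM/=; ring.
    have [mef ief] := cef; split; first exact: cmeas_conj.
    by under eq_fun do rewrite l1n_conj.
  rewrite sqn_g /g /trunc_transform -mulrA mul_conjc_sqn.
  by rewrite -rmorphM.
rewrite /E /cintegral; apply: complex_eq => /=.
  by apply: eq_Rintegral => s _; rewrite sqn_g.
by rewrite /Rintegral integral0.
Qed.

(** Let E be the energy of the transform on [B]. In the expanded square, the partial inverse
    contributes E/c by [pl_adj], and the cross term contributes -2E/c by [cross]. *)
Lemma partial_inverse_error :
  \int[mu]_x sqn (partial_inverse B x - f x) =
  \int[mu]_x sqn (f x) - c^-1 * \int[nu]_s (\1_B s * sqn (transform s)).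
Proof.
have iS := integrable_sqn_partial_inverse.
have cST : cintegrable mu (fun x => T x * conjc (f x)).
  apply: (cintegrable_le (g := fun x => 2 * sqn (T x) + 2 * sqn (f x))).
  - by apply: cmeasM => //; apply: cmeas_conj; exact: cf.1.
  - exact: (integrableD measurableT (integrableZl measurableT 2 iT)
      (integrableZl measurableT 2 if2)).
  - move=> x; apply: (le_trans (l1nM _ _)); rewrite l1n_conj.
    have h (a : R[i]) : l1n a ^+ 2 <= 2 * sqn a.
      rewrite /l1n /sqn -(real_normK (num_real (complex.Re a))).
      rewrite -(real_normK (num_real (complex.Im a))).
      by have := sqr_ge0 (`|complex.Re a| - `|complex.Im a|); lra.
    have := h (T x); have := h (f x).
    by have := sqr_ge0 (l1n (T x) - l1n (f x)); have := sqr_ge0 (l1n (T x) + l1n (f x)); lra.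
have iRe := cintegrable_Re cST.
have iRe2 : mu.-integrable setT
    (fun x => (2 * c^-1 * complex.Re (T x * conjc (f x)))%:E).
  exact: (integrableZl measurableT (2 * c^-1) iRe).
transitivity (\int[mu]_x (sqn (S x) + sqn (f x) -
    2 * c^-1 * complex.Re (T x * conjc (f x)))).
  apply: eq_Rintegral => x _; rewrite sqnB; congr (_ - _).
  rewrite -mulrA; congr (_ * _).
  by rewrite /S /partial_inverse -mulrA cReM /= mul0r subr0.
rewrite RintegralB//; last exact: (integrableD measurableT iS if2).
rewrite RintegralD// int_sqnS RintegralZl//.
have -> : \int[mu]_x complex.Re (T x * conjc (f x)) = E.
  exact: (congr1 (@complex.Re R) cross).
rewrite /E; set I := \int[nu]_s _; set J := \int[mu]_x _.
by rewrite -mulrA mulr_natl mulr2n; ring.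
Qed.

End truncated.

(** The energy on [B r] grows to that of the whole transform, which is [c] times the energy of [f]
    by [pl], so the error of [partial_inverse_error] vanishes in the limit. Dominated convergence is
    applied along the integers; monotonicity in [r] extends the bound to real parameters. *)
Lemma partial_inverse_cvg (B : R -> set Xi) :
  (forall r, measurable (B r)) -> (forall r, (nu (B r) < +oo)%E) ->
  (forall r s, r <= s -> B r `<=` B s) -> \bigcup_n B n%:R = setT ->
  forall eps, 0 < eps -> exists r0 : R, forall r, r0 <= r ->
    \int[mu]_x sqn (partial_inverse (B r) x - f x) <= eps.
Proof.
move=> mB B_oo ndB covB eps eps0.
pose E r := \int[nu]_s (\1_(B r) s * sqn (transform s)).
have E_nd r s : r <= s -> E r <= E s.
  move=> rs; apply: le_Rintegral => //; [exact: integrable_trunc_energy..|].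
  move=> x _; rewrite ler_wpM2r ?sqn_ge0// !indicE ler_nat.
  by case: (boolP (x \in B r)) => // /set_mem xr; rewrite mem_set//; exact: ndB xr.
have cvE : E n%:R @[n --> \oo] --> c * \int[mu]_x sqn (f x).
  have := @dominated_convergence _ _ _ nu setT measurableT
    (fun n s => (\1_(B n%:R) s * sqn (transform s))%:E)
    (fun s => (sqn (transform s))%:E) (fun s => (sqn (transform s))%:E).
  case.
  - by move=> n; apply: (measurable_int nu); exact: integrable_trunc_energy.
  - by apply/measurable_EFinP; apply: measurable_sqn; exact: cmeas_transform.
  - apply: aeW => s _; apply: cvg_near_cst.
    have : (\bigcup_n B n%:R) s by rewrite covB.
    move=> [n _ Bns]; near=> m; rewrite indicE mem_set ?mul1r//.
    apply: ndB Bns; rewrite ler_nat; near: m; exact: nbhs_infty_ge.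
  - exact: integrable_sqn_transform.
  - apply: aeW => s n _; rewrite gee0_abs ?lee_fin ?mulr_ge0 ?sqn_ge0// ?indicE//.
    by rewrite ler_piMl ?sqn_ge0//; case: (_ \in _).
  move=> _ _; rewrite transform_energy => /fine_cvgP[_].
  by apply: cvg_trans; apply: near_eq_cvg; apply: nearW.
have ce0 : 0 < c * eps by rewrite mulr_gt0.
move/cvgrPdist_le : cvE => /(_ _ ce0)[n _ /(_ n (leqnn n))] hn.
exists n%:R => r nr; rewrite partial_inverse_error// lerBlDl -lerBlDr.
rewrite -(ler_pM2l c_gt0) mulrBr mulrA divff ?lt0r_neq0// mul1r.
have := E_nd _ _ nr; rewrite -/(E r).
by have := ler_norm (c * \int[mu]_x sqn (f x) - E n%:R); move: hn; lra.
Unshelve. all: by end_near. Qed.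

End inversion.

(** * Change of variables through uniqueness of measures *)

Section transfer.
Context {d1 d2 d3} {X1 : measurableType d1} {X2 : measurableType d2}
  {Y : measurableType d3} {R : realType}.
Variables (m1 : {measure set X1 -> \bar R}) (m2 : {measure set X2 -> \bar R}).
Variables (w1 : X1 -> R) (w2 : X2 -> R) (p1 : X1 -> Y) (p2 : X2 -> Y).
Hypotheses (mw1 : measurable_fun setT w1) (mw2 : measurable_fun setT w2).
Hypotheses (mp1 : measurable_fun setT p1) (mp2 : measurable_fun setT p2).
Hypotheses (w1_ge0 : forall x, 0 <= w1 x) (w2_ge0 : forall x, 0 <= w2 x).

Let w_indic_meas d (X : measurableType d) (w : X -> R) (p : X -> Y) (A : set Y) :
  measurable_fun setT w -> measurable_fun setT p -> measurable A ->
  measurable_fun setT (fun x => (w x * \1_A (p x))%:E).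
Proof.
move=> mw mp mA; apply/measurable_EFinP; apply: measurable_funM => //.
have mI : measurable_fun setT (\1_A : Y -> R) by exact: measurable_indic.
exact: (measurableT_comp mI mp).
Qed.

Let w_indic_ge0 (X : Type) (w : X -> R) (p : X -> Y) (A : set Y) x :
  (forall x, 0 <= w x) -> (0 <= (w x * \1_A (p x))%:E)%E.
Proof. by move=> w0; rewrite lee_fin mulr_ge0// indicE. Qed.

(** Both sides, as functions of [A], are images of weighted measures under [p1] and [p2]; the sets
    on which they agree form a Dynkin system. Finiteness of the total mass allows the subtraction
    needed for complements. *)
Lemma weighted_measure_unique (G : set (set Y)) :
  @measurable _ Y = <<s G >> -> setI_closed G ->
  (\int[m1]_x (w1 x)%:E < +oo)%E ->
  (\int[m1]_x (w1 x)%:E = \int[m2]_x (w2 x)%:E)%E ->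
  (forall A, G A -> (\int[m1]_x (w1 x * \1_A (p1 x))%:E =
                     \int[m2]_x (w2 x * \1_A (p2 x))%:E)%E) ->
  forall A, measurable A -> (\int[m1]_x (w1 x * \1_A (p1 x))%:E =
                     \int[m2]_x (w2 x * \1_A (p2 x))%:E)%E.
Proof.
move=> GE GI w1oo w12 HG A mA.
have mG B : G B -> measurable B by rewrite GE; exact: sub_sigma_algebra.
rewrite GE in mA; move: A mA.
apply: (@dynkin_induction _ Y G (fun A => (\int[m1]_x (w1 x * \1_A (p1 x))%:E =
                     \int[m2]_x (w2 x * \1_A (p2 x))%:E)%E)) => //.
- by under eq_integral do rewrite indicT mulr1;
    under [RHS]eq_integral do rewrite indicT mulr1.
- move=> S mS HS.
  have split_int d (X : measurableType d) (m : {measure set X -> \bar R})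
      (w : X -> R) (p : X -> Y) : measurable_fun setT w -> measurable_fun setT p ->
      (forall x, 0 <= w x) -> (\int[m]_x (w x)%:E =
        \int[m]_x (w x * \1_S (p x))%:E + \int[m]_x (w x * \1_(~` S) (p x))%:E)%E.
    move=> mw mp w0; rewrite -ge0_integralD//; last 4 first.
    + by move=> x _; exact: w_indic_ge0.
    + exact: w_indic_meas.
    + by move=> x _; exact: w_indic_ge0.
    + by apply: w_indic_meas => //; exact: measurableC.
    apply: eq_integral => x _; rewrite -EFinD -mulrDr !indicE in_setC.
    by case: (_ \in _); rewrite /= ?addr0 ?add0r mulr1.
  have := split_int _ _ m1 w1 p1 mw1 mp1 w1_ge0.
  have := split_int _ _ m2 w2 p2 mw2 mp2 w2_ge0.
  rewrite -w12 -HS => e1 e2; move: e2 w1oo; rewrite e1.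
  set a := (\int[m1]_x (w1 x * \1_S (p1 x))%:E)%E.
  have a0 : (0 <= a)%E by apply: integral_ge0 => x _; exact: w_indic_ge0.
  move=> /[swap] afin.
  have {afin}afin : a \is a fin_num.
    rewrite ge0_fin_numE//; apply: le_lt_trans afin; rewrite leeDl//.
    by apply: integral_ge0 => x _; exact: w_indic_ge0.
  by move/(congr1 (fun z => z - a)%E); rewrite [LHS]addeAC subee// add0e
    [RHS]addeAC subee// add0e => ->.
- move=> F mF tF HF.
  have int_bigcup d (X : measurableType d) (m : {measure set X -> \bar R})
      (w : X -> R) (p : X -> Y) : measurable_fun setT w -> measurable_fun setT p ->
      (forall x, 0 <= w x) -> (\int[m]_x (w x * \1_(\bigcup_k F k) (p x))%:E =
        \sum_(k <oo) \int[m]_x (w x * \1_(F k) (p x))%:E)%E.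
    move=> mw mp w0; rewrite -integral_nneseries//; last 2 first.
    + by move=> n; exact: w_indic_meas.
    + by move=> n x _; exact: w_indic_ge0.
    apply: eq_integral => x _.
    have [[k _ Fk]|nF] := pselect ((\bigcup_k F k) (p x)).
      rewrite indicE mem_set; last by exists k.
      rewrite (@nneseriesD1 _ _ k)//; last by move=> n _; exact: w_indic_ge0.
      rewrite eseries0 ?adde0; first by rewrite indicE mem_set.
      move=> n _ nk; rewrite indicE memNset ?mulr0// => Fn.
      by move/eqP: nk; apply; apply: tF => //; exists (p x).
    rewrite indicE memNset// mulr0 eseries0// => n _ _.
    by rewrite indicE memNset ?mulr0// => Fn; apply: nF; exists n.
  rewrite !int_bigcup//; apply: eq_eseriesr => k _; exact: HF.
Qed.

Import HBNNSimple.

(** A substitution formula in which the weights play the role of Jacobians: from sets to simple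
    functions by linearity, then to [h] by monotone convergence. *)
Lemma ge0_transfer (h : Y -> \bar R) :
  (forall A, measurable A -> (\int[m1]_x (w1 x * \1_A (p1 x))%:E =
                     \int[m2]_x (w2 x * \1_A (p2 x))%:E)%E) ->
  measurable_fun setT h -> (forall y, 0 <= h y)%E ->
  (\int[m1]_x ((w1 x)%:E * h (p1 x)) = \int[m2]_x ((w2 x)%:E * h (p2 x)))%E.
Proof.
move=> HA mh h0.
pose g := nnsfun_approx measurableT mh.
have gcvg y : (g n y)%:E @[n --> \oo] --> h y.
  exact: (cvg_nnsfun_approx measurableT mh (fun y _ => h0 y)).
have key d (X : measurableType d) (m : {measure set X -> \bar R})
      (w : X -> R) (p : X -> Y) : measurable_fun setT w -> measurable_fun setT p ->
      (forall x, 0 <= w x) ->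
    (\int[m]_x ((w x)%:E * h (p x)) =
     limn (fun n => \sum_(y <- finmap.enum_fset (fset_set (range (g n))))
       (y%:E * \int[m]_x (w x * \1_(g n @^-1` [set y]) (p x))%:E)))%E.
  move=> mw mp w0.
  transitivity (\int[m]_x limn (fun n => (w x)%:E * (g n (p x))%:E))%E.
    apply: eq_integral => x _; apply/esym/cvg_lim => //.
    by apply: cvgeZl => //; exact: gcvg.
  rewrite monotone_convergence//; last 3 first.
  - move=> n; apply/measurable_EFinP; apply: measurable_funM => //.
    exact: measurableT_comp.
  - by move=> n x _; rewrite mule_ge0// lee_fin.
  - move=> x _ a b ab; rewrite lee_wpmul2l ?lee_fin//.
    by have /lefP := nd_nnsfun_approx measurableT mh ab; apply.
  congr (limn _); apply/funext => n.
  transitivity (\int[m]_x (\sum_(y <- finmap.enum_fset (fset_set (range (g n))))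
      y%:E * (w x * \1_(g n @^-1` [set y]) (p x))%:E))%E.
    apply: eq_integral => x _; rewrite fimfunE fsbig_finite//= -EFinM mulr_sumr.
    by rewrite -sumEFin; apply: eq_bigr => y _; rewrite -EFinM mulrCA.
  have term_ge0 y x : (0 <= y%:E * (w x * \1_(g n @^-1` [set y]) (p x))%:E)%E.
    rewrite -EFinM lee_fin indicE; have [|_] := boolP (_ \in _); last by rewrite !mulr0.
    by rewrite inE/= mulr1 => <-; rewrite mulr_ge0.
  rewrite ge0_integral_sum//; last first.
    by move=> y; apply: emeasurable_funM => //; exact: w_indic_meas.
  apply: eq_bigr => y _.
  have [y0|y0] := leP 0 y.
    rewrite ge0_integralZl_EFin//; first by move=> x _; exact: w_indic_ge0.
    exact: w_indic_meas.
  (* A negative value is not attained, so its term is 0 on both sides. *)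
  have E : g n @^-1` [set y] = set0.
    rewrite -subset0 => z /= gz; have : 0 <= g n z by [].
    by rewrite gz leNgt y0.
  under eq_integral do rewrite E indic0 mulr0 mule0.
  rewrite integral0; under eq_integral do rewrite E indic0 mulr0.
  by rewrite integral0 mule0.
rewrite !key//; congr (limn _); apply/funext => n; apply: eq_bigr => y _.
by rewrite HA.
Qed.

End transfer.

(** * Polar coordinates in the plane *)

Section polar.
Context {R : realType}.
Local Notation leb := (@lebesgue_measure R).

Let I : set R := `](- (pi / 2)), (pi / 2)[%classic.

Let mI : measurable I. Proof. exact: measurable_itv. Qed.

(** Extending the tangent by 0 outside [I] gives a measurable map on the whole line; the weight
    supported in [I] hides the extension. *)
Let measurable_tanI : measurable_fun setT (tan \_ I : R -> R).
Proof.
apply/(measurable_restrictT _ mI).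
apply: open_continuous_measurable_fun; first exact: interval_open.
move=> x; rewrite inE /I/= in_itv/= => xI; apply: continuous_tan.
by rewrite lt0r_neq0// cos_gt0_pihalf.
Qed.

Let tanI x : I x -> (tan \_ I) x = tan x :> R.
Proof. by move=> Ix; rewrite patchE mem_set. Qed.

Let indic_ge0' (A : set R) x : 0 <= \1_A x :> R.
Proof. by rewrite indicE. Qed.

Let leb_I : leb I = (pi : R)%:E.
Proof.
rewrite /I lebesgue_measure_itv/= lte_fin.
have p0 := pi_gt0 R; rewrite ifT; last by lra.
by rewrite -EFinB; congr EFin; lra.
Qed.

(** The tangent carries Lebesgue measure on [I] to the measure of density 1/(1+y^2): both have mass
    pi, and on a half-open interval both give a difference of arctangents. *)
Lemma integral_tan (h : R -> \bar R) : measurable_fun setT h ->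
  (forall y, 0 <= h y)%E ->
  (\int[leb]_x ((\1_I x)%:E * h (tan x)) = \int[leb]_y ((poisson 1 y)%:E * h y))%E.
Proof.
move=> mh h0.
have mi : measurable_fun setT (\1_I : R -> R) by exact: measurable_indic.
have mp : measurable_fun setT (poisson 1 : R -> R) by apply: measurable_poisson; exact: ltr01.
have p0 (x : R) : 0 <= poisson 1 x by apply: poisson_ge0.
have total2 : (\int[leb]_x (poisson 1 x)%:E = (pi : R)%:E)%E.
  rewrite -(integral_poisson 0 ltr01); apply: eq_integral => x _.
  by rewrite sub0r /poisson sqrrN.
have total1 : (\int[leb]_x (\1_I x)%:E = (pi : R)%:E)%E.
  by rewrite integral_indic// setIT; exact: leb_I.
transitivity (\int[leb]_x ((\1_I x)%:E * h ((tan \_ I) x)))%E.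
  apply: eq_integral => x _; rewrite indicE; case: (boolP (x \in I)) => [xI|_].
    by rewrite tanI// -inE.
  by rewrite !mul0e.
apply: (@ge0_transfer _ _ _ _ _ (measurableTypeR R) R leb leb _ _ _ id) => //.
apply: (@weighted_measure_unique _ _ _ _ _ (measurableTypeR R) R leb leb _ _ _ _ _ _ _ _ _ _ (@ocitv R)) => //.
- exact: ocitvI.
- by rewrite total1 ltry.
- by rewrite total1 total2.
move=> A [[a b] _ <-] /=.
have [ab|ba] := ltP a b; last first.
  have -> : `]a, b]%classic = set0 by apply: set_itv_ge; rewrite bnd_simp -leNgt.
  by under eq_integral do rewrite indic0 mulr0;
    under [RHS]eq_integral do rewrite indic0 mulr0.
transitivity (atan b - atan a)%:E.
  have -> : (\int[leb]_x (\1_I x * \1_`]a, b] ((tan \_ I) x))%:E =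
      \int[leb]_x (\1_`](atan a), (atan b)] x)%:E)%E.
    apply: eq_integral => x _; rewrite !indicE.
    have ta := atan_gtNpi2 a; have tb := atan_ltpi2 b.
    have [xI|xI] := boolP (x \in I); last first.
      rewrite mul0r memNset// /= in_itv/= => /andP[h1 h2].
      move/negP: xI; apply; rewrite inE /I /= in_itv/=.
      by apply/andP; split; [exact: lt_trans ta h1|exact: le_lt_trans h2 tb].
    rewrite mul1r; move: xI; rewrite inE => xI; rewrite tanI//.
    congr (_ %:R)%:E; congr nat_of_bool.
    have xE : x = atan (tan x) by rewrite tanK// inE; move: xI; rewrite /I /=.
    apply/idP/idP; rewrite !inE/= !in_itv/= => /andP[h1 h2]; apply/andP; split.
    - by rewrite xE; exact: lt_atan.
    - by rewrite xE; exact: le_atan.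
    - by rewrite ltNge; apply/negP => /le_atan; rewrite -xE leNgt h1.
    - by rewrite leNgt; apply/negP => /lt_atan; rewrite -xE ltNge h2.
  rewrite integral_indic//= setIT lebesgue_measure_itv/= lte_fin lt_atan//.
have -> : atan b - atan a = atan ((b - 0) / 1) - atan ((a - 0) / 1).
  by rewrite !divr1 !subr0.
rewrite -integral_poisson_itv// -integral_itv_obnd_cbnd; last first.
  apply/measurable_EFinP; apply: measurable_funTS.
  apply: (measurableT_comp mp); exact: measurable_funB.
rewrite integral_mkcond; apply: eq_integral => x _.
rewrite patchE indicE; case: ifPn => _; last by rewrite mulr0.
by rewrite mulr1 sub0r /poisson sqrrN.
Qed.

Definition ipos (x : R) : R := \1_(`]0, +oo[%classic) x.

Lemma iposE x : ipos x = (0 < x)%R%:R.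
Proof.
rewrite /ipos indicE; congr (nat_of_bool _)%:R.
by apply/idP/idP; rewrite inE/= in_itv/= andbT.
Qed.

Lemma ipos_ge0 x : 0 <= ipos x. Proof. by rewrite iposE. Qed.

Lemma measurable_ipos : measurable_fun setT ipos.
Proof. exact: measurable_indic. Qed.

Lemma integral_indicM (A : set R) (f : R -> \bar R) :
  (\int[leb]_x ((\1_A x)%:E * f x) = \int[leb]_(x in A) f x)%E.
Proof.
rewrite [RHS]integral_mkcond; apply: eq_integral => x _.
by rewrite patchE indicE; case: ifPn => _; rewrite ?mul1e ?mul0e.
Qed.

Let Rm := measurableTypeR R.

Definition polar_radial (G : Rm * Rm -> \bar R) (t : R) : \bar R :=
  (\int[leb]_k ((ipos k * k)%:E * G (k * cos t, k * sin t)%R))%E.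

Section polar_measurable.
Variables (G : Rm * Rm -> \bar R).
Hypotheses (mG : measurable_fun setT G) (G0 : forall z, (0 <= G z)%E).

Lemma ipos_id_ge0 x : 0 <= ipos x * x.
Proof. by rewrite iposE; case: ltP => [/ltW h|_]; rewrite ?mul1r ?mul0r. Qed.

Lemma measurable_ipos_id : measurable_fun setT (fun x => ipos x * x).
Proof. by apply: measurable_funM => //; exact: measurable_ipos. Qed.

Lemma polar_radial_ge0 t : (0 <= polar_radial G t)%E.
Proof. by apply: integral_ge0 => k _; rewrite mule_ge0// lee_fin ipos_id_ge0. Qed.

Lemma measurable_polar_radial : measurable_fun setT (polar_radial G).
Proof.
apply: (@measurable_fun_fubini_tonelli_F _ _ Rm Rm R leb
  (fun w => ((ipos w.2 * w.2)%:E * G (w.2 * cos w.1, w.2 * sin w.1)%R)%E)).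
  apply: emeasurable_funM.
    apply/measurable_EFinP; apply: (measurableT_comp measurable_ipos_id).
    exact: measurable_snd.
  apply: (measurableT_comp mG); apply: measurable_fun_pair.
    apply: measurable_funM => //; exact: (measurableT_comp measurable_cos).
  apply: measurable_funM => //; exact: (measurableT_comp measurable_sin).
by move=> w; rewrite mule_ge0// lee_fin ipos_id_ge0.
Qed.

(** At positive abscissa a, the ordinate is replaced by the slope t = b/a, with Jacobian a. On the
    ray of slope t the abscissa is k cos(atan t), so a da brings the factor cos^2(atan t) =
    1/(1+t^2), which [integral_tan] absorbs when the slope becomes an angle. *)
Lemma polar_half_tan :
  (\int[leb \x leb]_z ((ipos z.1)%:E * G z) =
   \int[leb]_t ((\1_I t)%:E * polar_radial G t))%E.
Proof.
have mG1 (a : R) : measurable_fun setT (fun b : R => G (a, b)).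
  exact: (measurableT_comp mG (pair1_measurable _)).
rewrite fubini_tonelli1; last 2 first.
- apply: emeasurable_funM => //; apply/measurable_EFinP.
  by apply: (measurableT_comp measurable_ipos); exact: measurable_fst.
- by move=> z; rewrite mule_ge0// lee_fin ipos_ge0.
pose H (w : Rm * Rm) := ((ipos w.1 * w.1)%:E * G (w.1, w.1 * w.2)%R)%E.
have mH : measurable_fun setT H.
  apply: emeasurable_funM.
    apply/measurable_EFinP; apply: (measurableT_comp measurable_ipos_id).
    exact: measurable_fst.
  by apply: (measurableT_comp mG); apply: measurable_fun_pair => //; exact: measurable_funM.
have H0 w : (0 <= H w)%E by rewrite mule_ge0// lee_fin ipos_id_ge0.
transitivity (\int[leb]_a \int[leb]_t H (a, t))%E.
  apply: eq_integral => a _; rewrite /fubini_F /H /= iposE.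
  case: (ltP 0 a) => a0; last first.
    rewrite mul0r; under eq_integral do rewrite mul0e.
    by rewrite integral0; under eq_integral do rewrite mul0e; rewrite integral0.
  under eq_integral do rewrite mul1e.
  rewrite (@ge0_integral_affine _ a 0)// ?lt0r_neq0//.
  rewrite mul1r gtr0_norm// -ge0_integralZl_EFin ?(ltW a0)//; last first.
    by apply: (measurableT_comp (mG1 a)); apply: measurable_funD => //; exact: measurable_funM.
  by apply: eq_integral => b _; rewrite addr0.
rewrite fubini_tonelli//.
pose h (t : R) := polar_radial G (atan t).
have mh : measurable_fun setT h.
  apply: (measurableT_comp measurable_polar_radial).
  by apply: continuous_measurable_fun; exact: continuous_atan.
transitivity (\int[leb]_t ((poisson 1 t)%:E * h t))%E.
  apply: eq_integral => t _.
  pose s : R := (Num.sqrt (1 + t ^+ 2))^-1.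
  have t1 : 0 < 1 + t ^+ 2 by rewrite ltr_pwDl// sqr_ge0.
  have s0 : 0 < s by rewrite invr_gt0 sqrtr_gt0.
  have ca : cos (atan t) = s by rewrite cos_atan.
  have sa : sin (atan t) = s * t.
    have h1 := atanK t; rewrite /tan ca in h1.
    by rewrite -{2}h1 mulrCA divff ?mulr1// lt0r_neq0.
  have s2 : poisson 1 t = s * s.
    by rewrite /poisson expr1n mul1r -expr2 /s exprVn sqr_sqrtr// ltW.
  rewrite (@ge0_integral_affine _ s 0)// ?lt0r_neq0//; last first.
    exact: (measurableT_comp mH (pair2_measurable _)).
  rewrite gtr0_norm// s2 EFinM -muleA; congr (_ * _)%E.
  rewrite -ge0_integralZl_EFin ?(ltW s0)//; last 2 first.
  - by move=> k _; rewrite mule_ge0// lee_fin ipos_id_ge0.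
  - apply: emeasurable_funM; first by apply/measurable_EFinP; exact: measurable_ipos_id.
    by apply: (measurableT_comp mG); apply: measurable_fun_pair; apply: measurable_funM.
  apply: eq_integral => k _; rewrite /H /= addr0 muleA -EFinM ca sa.
  congr (_%:E * G (_, _))%E; [|ring|ring].
  by rewrite !iposE pmulr_rgt0//; ring.
rewrite -integral_tan//; last by move=> t; exact: polar_radial_ge0.
apply: eq_integral => t _; rewrite indicE.
have [tI|_] := boolP (t \in I); last by rewrite !mul0e.
by rewrite !mul1e /h tanK// inE; move: tI; rewrite inE /I.
Qed.

End polar_measurable.

(** The angle is measured from the second axis, through t -> pi/2 - t. In spherical coordinates the
    half-plane has coordinates (distance to the axis, height), and this angle is the colatitude. *)
Lemma polar_half (G : Rm * Rm -> \bar R) : measurable_fun setT G ->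
  (forall z, (0 <= G z)%E) ->
  (\int[leb \x leb]_z ((ipos z.1)%:E * G z) =
   \int[leb]_t ((\1_`]0, pi[ t)%:E *
     \int[leb]_k ((ipos k * k)%:E * G (k * sin t, k * cos t)%R)))%E.
Proof.
move=> mG G0; rewrite polar_half_tan//.
rewrite (@ge0_integral_affine _ (-1) (pi / 2)); last 3 first.
- by rewrite oppr_eq0 oner_eq0.
- apply: emeasurable_funM; last exact: measurable_polar_radial.
  exact/measurable_EFinP/measurable_indic.
- by move=> t; rewrite mule_ge0 ?lee_fin ?polar_radial_ge0.
rewrite normrN1 mul1e; apply: eq_integral => t _; congr (_ * _)%E.
  congr EFin; rewrite !indicE; congr (nat_of_bool _)%:R.
  by apply/idP/idP; rewrite !inE /I/= !in_itv/= => /andP[h1 h2]; apply/andP; split; lra.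
apply: eq_integral => k _; rewrite mulN1r addrC sinB cosB sin_pihalf cos_pihalf.
by rewrite !mul0r !mul1r add0r subr0.
Qed.

Lemma ge0_integral_symmetrize (g : R -> \bar R) : measurable_fun setT g ->
  (forall x, (0 <= g x)%E) ->
  (\int[leb]_x g x = \int[leb]_x ((ipos x)%:E * g x) +
                     \int[leb]_x ((ipos x)%:E * g (- x)%R))%E.
Proof.
move=> mg g0; rewrite !integral_indicM.
have TE : [set: R] = `]-oo, 0%R] `|` `]0%R, +oo[.
  apply/seteqP; split=> // s _ /=; rewrite !in_itv/= andbT.
  by have [h|h] := leP s 0; [left|right].
rewrite [in LHS]TE ge0_integral_setU//; last 2 first.
- by rewrite -TE.
- apply/disj_setPS => s [] /=; rewrite !in_itv/= andbT => h1 h2.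
  by have := lt_le_trans h2 h1; rewrite ltxx.
have mgN : measurable_fun setT (fun x : R => g (- x)) by exact: measurableT_comp.
rewrite addeC; congr (_ + _)%E.
have := @ge0_integration_by_substitution0 R (fun s : R => g (- s)).
under [X in _ -> _ -> _ = X]eq_integral do rewrite opprK.
move=> <-//; apply/esym/integral_itv_obnd_cbnd.
exact: measurable_funTS.
Qed.

(** The half-planes of positive and negative ordinate are brought to that of [polar_half] by the
    reflections in [G1] and [G2]; they account for the angles in ]0,
    pi[ and, after a shift by pi, in ]pi, 2 pi[. The end points are negligible. *)
Lemma polar_full (G : Rm * Rm -> \bar R) : measurable_fun setT G ->
  (forall z, (0 <= G z)%E) ->
  (\int[leb \x leb]_z G z =
   \int[leb]_t ((\1_`[0, 2 * pi] t)%:E * polar_radial G t))%E.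
Proof.
move=> mG G0.
have mPsi := measurable_polar_radial mG G0.
have Psi0 := polar_radial_ge0 G0.
rewrite fubini_tonelli2// [LHS]ge0_integral_symmetrize; last 2 first.
- exact: (@measurable_fun_fubini_tonelli_G _ _ Rm Rm R leb G mG G0).
- by move=> b; exact: integral_ge0.
pose G1 (z : Rm * Rm) := G (z.2, z.1).
pose G2 (z : Rm * Rm) := G (- z.2, - z.1).
have mG1 : measurable_fun setT G1.
  by apply: (measurableT_comp mG); exact: measurable_fun_pair.
have mG2 : measurable_fun setT G2.
  by apply: (measurableT_comp mG); apply: measurable_fun_pair; exact: measurableT_comp.
have mi (F : Rm * Rm -> \bar R) : measurable_fun setT F ->
    measurable_fun setT (fun z => (ipos z.1)%:E * F z)%E.
  move=> mF; apply: emeasurable_funM => //; apply/measurable_EFinP.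
  by apply: (measurableT_comp measurable_ipos); exact: measurable_fst.
have part1 : (\int[leb]_x ((ipos x)%:E * fubini_G leb G x) =
    \int[leb]_t ((\1_`]0, pi[ t)%:E * polar_radial G t))%E.
  transitivity (\int[leb \x leb]_z ((ipos z.1)%:E * G1 z))%E; last first.
    by rewrite polar_half// => z; exact: G0.
  rewrite fubini_tonelli1; last 2 first.
  - exact: mi.
  - by move=> z; rewrite mule_ge0 ?lee_fin ?ipos_ge0//; exact: G0.
  apply: eq_integral => x _; rewrite /fubini_F /fubini_G /=.
  rewrite ge0_integralZl_EFin ?ipos_ge0//; last 2 first.
  - by move=> y _; exact: G0.
  - exact: (measurableT_comp mG1 (pair1_measurable _)).
have part2 : (\int[leb]_x ((ipos x)%:E * fubini_G leb G (- x)%R) =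
    \int[leb]_t ((\1_`]pi, (2 * pi)[ t)%:E * polar_radial G t))%E.
  rewrite [RHS](@ge0_integral_affine _ 1 pi); last 3 first.
  - exact: oner_neq0.
  - by apply: emeasurable_funM => //; exact/measurable_EFinP/measurable_indic.
  - by move=> t; rewrite mule_ge0 ?lee_fin// indicE.
  rewrite normr1 mul1e.
  transitivity (\int[leb \x leb]_z ((ipos z.1)%:E * G2 z))%E.
    rewrite fubini_tonelli1//; first last.
    - by move=> z; rewrite mule_ge0 ?lee_fin ?ipos_ge0//; exact: G0.
    - exact: mi.
    apply: eq_integral => x _; rewrite /fubini_F /fubini_G /=.
    rewrite ge0_integralZl_EFin ?ipos_ge0//; last 2 first.
    - by move=> y _; exact: G0.
    - exact: (measurableT_comp mG2 (pair1_measurable _)).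
    congr (_ * _)%E; rewrite [LHS](@ge0_integral_affine _ (-1) 0); last 3 first.
    - by rewrite oppr_eq0 oner_eq0.
    - exact: (measurableT_comp mG (pair2_measurable _)).
    - by move=> y; exact: G0.
    rewrite normrN1 mul1e; apply: eq_integral => y _.
    by rewrite /G2 /= mulN1r addr0.
  rewrite polar_half//; last by move=> z; exact: G0.
  apply: eq_integral => t _; congr (_ * _)%E.
    congr EFin; rewrite !indicE; congr (nat_of_bool _)%:R.
    by apply/idP/idP; rewrite !inE/= !in_itv/= => /andP[h1 h2]; apply/andP; split; lra.
  apply: eq_integral => k _; rewrite /G2 /= mul1r cosDpi sinDpi.
  by rewrite !mulrN.
rewrite part1 part2 !integral_indicM {part1 part2}.
have p0 := pi_gt0 R.
have cut : `[0%R, (2 * pi)%R]%classic = `[0%R, pi%R] `|` `]pi%R, (2 * pi)%R] :> set R.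
  apply/seteqP; split=> x /=; rewrite !in_itv/=.
    by move=> /andP[h1 h2]; have [h|h] := leP x pi; [left|right]; apply/andP; split; lra.
  by move=> [] /andP[h1 h2]; apply/andP; split; lra.
rewrite cut ge0_integral_setU//; last 2 first.
- exact: measurable_funTS.
- apply/disj_setPS => x [] /=; rewrite !in_itv/= => /andP[_ h1] /andP[h2 _].
  by have := lt_le_trans h2 h1; rewrite ltxx.
by congr (_ + _)%E; apply/esym/integral_itv_bndoo; exact: measurable_funTS.
Qed.

End polar.

(** * Spherical coordinates in space *)

Section spherical.
Context {R : realType}.
Local Notation leb := (@lebesgue_measure R).
Let Rm := measurableTypeR R.

Definition spherical_map (p : R3 R) : R3 R :=
  (p.2 * (sin p.1.1 * cos p.1.2), p.2 * (sin p.1.1 * sin p.1.2), p.2 * cos p.1.1).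

(** The parameters are ordered ((theta, phi), k). The Jacobian k^2 sin theta is multiplied by the
    indicator of the parameter domain, so that integrals run over the whole parameter space. *)
Definition spherical_weight (p : R3 R) : R :=
  \1_`[0, pi] p.1.1 * \1_`[0, 2 * pi] p.1.2 * (ipos p.2 * p.2 ^+ 2 * sin p.1.1).

Lemma spherical_weight_ge0 p : 0 <= spherical_weight p.
Proof.
rewrite /spherical_weight indicE; case: (boolP (p.1.1 \in _)) => [|_]; last by rewrite !mul0r.
rewrite inE/= in_itv/= => t0pi; apply: mulr_ge0; first by rewrite mul1r indicE.
by rewrite mulr_ge0 ?sin_ge0_pi// mulr_ge0 ?sqr_ge0 ?ipos_ge0.
Qed.

Let mtheta : measurable_fun setT (fun p : R3 R => p.1.1).
Proof. exact: (measurableT_comp measurable_fst measurable_fst). Qed.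

Let mphi : measurable_fun setT (fun p : R3 R => p.1.2).
Proof. exact: (measurableT_comp measurable_snd measurable_fst). Qed.

Let mk : measurable_fun setT (fun p : R3 R => p.2).
Proof. exact: measurable_snd. Qed.

Let mindic (A : set R) : measurable A -> measurable_fun setT (\1_A : R -> R).
Proof. exact: measurable_indic. Qed.

Lemma measurable_spherical_map : measurable_fun setT spherical_map.
Proof.
have ms := measurableT_comp measurable_sin mtheta.
have mc := measurableT_comp measurable_cos mtheta.
have ms' := measurableT_comp measurable_sin mphi.
have mc' := measurableT_comp measurable_cos mphi.
apply: measurable_fun_pair; first apply: measurable_fun_pair.
- by apply: measurable_funM => //; exact: measurable_funM.
- by apply: measurable_funM => //; exact: measurable_funM.
- exact: measurable_funM.
Qed.

Lemma measurable_spherical_weight : measurable_fun setT spherical_weight.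
Proof.
apply: measurable_funM; first apply: measurable_funM.
- exact: (measurableT_comp (mindic _) mtheta).
- exact: (measurableT_comp (mindic _) mphi).
apply: measurable_funM; last exact: (measurableT_comp measurable_sin mtheta).
apply: measurable_funM; last exact: measurable_funX.
exact: (measurableT_comp measurable_ipos mk).
Qed.

(** Polar coordinates twice: in the horizontal plane, giving (r, phi) with Jacobian r, then in the
    half-plane of (r, z), giving (k, theta) with Jacobian k. As r = k sin theta, the product is k^2
    sin theta. *)
Lemma ge0_integral_spherical (G : R3 R -> \bar R) : measurable_fun setT G ->
  (forall x, (0 <= G x)%E) ->
  (\int[leb3 R]_x G x =
   \int[leb3 R]_p ((spherical_weight p)%:E * G (spherical_map p)))%E.
Proof.
move=> mG G0.
pose F (p : R3 R) := ((spherical_weight p)%:E * G (spherical_map p))%E.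
have mF : measurable_fun setT F.
  apply: emeasurable_funM.
    by apply/measurable_EFinP; exact: measurable_spherical_weight.
  exact: (measurableT_comp mG measurable_spherical_map).
have F0 p : (0 <= F p)%E by rewrite mule_ge0 ?lee_fin ?spherical_weight_ge0.
have -> : (\int[leb3 R]_p F p = \int[leb]_f \int[leb]_t \int[leb]_k F (t, f, k))%E.
  rewrite (@fubini_tonelli1 _ _ _ _ R (sprod leb leb) leb F mF F0).
  rewrite fubini_tonelli2//.
  - exact: (@measurable_fun_fubini_tonelli_F _ _ _ _ R leb F mF F0).
  - by move=> z; exact: integral_ge0.
rewrite (@fubini_tonelli2 _ _ _ _ R (sprod leb leb) leb G mG G0) /fubini_G.
(* The integrand in cylindrical coordinates, ordered ((z, phi), r). *)
pose Q (w : Rm * Rm * Rm) : \bar R :=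
  ((\1_`[0%R, (2 * pi)%R] w.1.2)%:E *
   ((ipos w.2 * w.2)%:E * G (w.2 * cos w.1.2, w.2 * sin w.1.2, w.1.1)%R))%E.
have mQ : measurable_fun setT Q.
  apply: emeasurable_funM.
    by apply/measurable_EFinP; exact: (measurableT_comp (mindic _) mphi).
  apply: emeasurable_funM.
    by apply/measurable_EFinP; exact: (measurableT_comp measurable_ipos_id mk).
  apply: (measurableT_comp mG); apply: measurable_fun_pair => //.
  apply: measurable_fun_pair; apply: measurable_funM => //.
    exact: (measurableT_comp measurable_cos mphi).
  exact: (measurableT_comp measurable_sin mphi).
have Q0 w : (0 <= Q w)%E.
  by rewrite !mule_ge0// lee_fin ?ipos_id_ge0// indicE.
have mGz z : measurable_fun setT (fun xy : Rm * Rm => G (xy, z)).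
  exact: (measurableT_comp mG (pair2_measurable z)).
transitivity (\int[leb]_z \int[leb]_f \int[leb]_r Q (z, f, r))%E.
  apply: eq_integral => z _; rewrite polar_full//.
  apply: eq_integral => f _; rewrite /Q /= ge0_integralZl_EFin//.
  - by move=> r _; rewrite mule_ge0// lee_fin ipos_id_ge0.
  - apply: emeasurable_funM.
      by apply/measurable_EFinP; exact: measurable_ipos_id.
    apply: (measurableT_comp (mGz z)).
    by apply: measurable_fun_pair; exact: measurable_funM.
rewrite (@fubini_tonelli _ _ _ _ R leb leb
  (fun zf => \int[leb]_r Q (zf, r))%E); last 2 first.
- exact: (@measurable_fun_fubini_tonelli_F _ _ _ _ R leb Q mQ Q0).
- by move=> z; exact: integral_ge0.
apply: eq_integral => f _.
pose P (w : Rm * Rm) : \bar R :=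
  ((ipos w.1 * w.1)%:E * G (w.1 * cos f, w.1 * sin f, w.2)%R)%E.
have mP : measurable_fun setT P.
  apply: emeasurable_funM.
    by apply/measurable_EFinP; apply: (measurableT_comp measurable_ipos_id);
      exact: measurable_fst.
  apply: (measurableT_comp mG); apply: measurable_fun_pair => //.
  by apply: measurable_fun_pair; exact: measurable_funM.
have P0 w : (0 <= P w)%E by rewrite mule_ge0// lee_fin ipos_id_ge0.
have mPz z : measurable_fun setT (fun r => P (r, z)).
  exact: (measurableT_comp mP (pair2_measurable z)).
have i0 : 0 <= \1_`[0, 2 * pi] f :> R by rewrite indicE.
transitivity ((\1_`[0%R, (2 * pi)%R] f)%:E *
    \int[leb \x leb]_w ((ipos w.1)%:E * P w))%E.
  rewrite (@fubini_tonelli2 _ _ _ _ R leb leb); last 2 first.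
  - apply: emeasurable_funM => //; apply/measurable_EFinP.
    by apply: (measurableT_comp measurable_ipos); exact: measurable_fst.
  - by move=> w; rewrite mule_ge0// lee_fin ipos_ge0.
  rewrite -ge0_integralZl_EFin//; last 2 first.
  - move=> z _; apply: integral_ge0 => r _.
    by rewrite mule_ge0// lee_fin ipos_ge0.
  - apply: (@measurable_fun_fubini_tonelli_G _ _ Rm Rm R leb
      (fun w => (ipos w.1)%:E * P w)%E).
      apply: emeasurable_funM => //; apply/measurable_EFinP.
      by apply: (measurableT_comp measurable_ipos); exact: measurable_fst.
    by move=> w; rewrite mule_ge0// lee_fin ipos_ge0.
  apply: eq_integral => z _; rewrite /Q /= ge0_integralZl_EFin//; last 2 first.
  - by move=> r _; exact: (P0 (r, z)).
  - exact: mPz.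
  congr (_ * _)%E; apply: eq_integral => r _.
  by rewrite /P /= muleA -EFinM !iposE; case: ltP; rewrite ?mul1r ?mul0r// !mul0r.
rewrite polar_half// -ge0_integralZl_EFin//; last 2 first.
- move=> t _; rewrite mule_ge0 ?lee_fin ?indicE//; apply: integral_ge0 => k _.
  by rewrite mule_ge0// lee_fin ipos_id_ge0.
- apply: emeasurable_funM.
    by apply/measurable_EFinP; apply: mindic; exact: measurable_itv.
  apply: (@measurable_fun_fubini_tonelli_F _ _ Rm Rm R leb (fun w =>
    ((ipos w.2 * w.2)%:E * P (w.2 * sin w.1, w.2 * cos w.1)%R)%E)).
    apply: emeasurable_funM.
      by apply/measurable_EFinP; apply: (measurableT_comp measurable_ipos_id);
        exact: measurable_snd.
    apply: (measurableT_comp mP); apply: measurable_fun_pair.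
      by apply: measurable_funM => //; exact: (measurableT_comp measurable_sin).
    by apply: measurable_funM => //; exact: (measurableT_comp measurable_cos).
  by move=> w; rewrite mule_ge0// lee_fin ipos_id_ge0.
apply: eq_integral => t _.
(* [polar_half] ranges over an open interval of colatitudes and the weight over a closed one; at
   both ends the weight vanishes together with the sine. *)
have [|t0pi] := boolP (t \in `]0, pi[%classic); last first.
  have W0 k : spherical_weight (t, f, k) = 0.
    rewrite /spherical_weight /= indicE.
    case: (boolP (t \in _)) => [|_]; last by rewrite !mul0r.
    rewrite inE/= in_itv/= => /andP[]; rewrite !le_eqVlt.
    move=> /orP[/eqP <-|t0]; first by rewrite sin0 !mulr0.
    move=> /orP[/eqP ->|tpi]; first by rewrite sinpi !mulr0.
    by move: t0pi; rewrite notin_setE/= in_itv/= t0 tpi.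
  under [RHS]eq_integral do rewrite /F W0 mul0e.
  have i0' : \1_`]0, pi[ t = 0 :> R by rewrite indicE (negbTE t0pi).
  by rewrite integral0 i0' mul0e mule0.
rewrite inE/= in_itv/= => t0pi; have st := sin_gt0_pi t0pi.
have -> : \1_`]0, pi[ t = 1 :> R by rewrite indicE mem_set//= in_itv/=.
have W1 k : spherical_weight (t, f, k) =
    \1_`[0, 2 * pi] f * (ipos k * k ^+ 2 * sin t).
  rewrite /spherical_weight /= indicE mem_set ?mul1r//= in_itv/=.
  by case/andP: t0pi => /ltW -> /ltW ->.
rewrite mul1e -ge0_integralZl_EFin//; last 2 first.
- by move=> k _; rewrite mule_ge0// lee_fin ipos_id_ge0.
- apply: emeasurable_funM; first by apply/measurable_EFinP; exact: measurable_ipos_id.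
  by apply: (measurableT_comp mP); apply: measurable_fun_pair; exact: measurable_funM.
apply: eq_integral => k _; rewrite /F /P W1 /spherical_map /= !mulrA.
rewrite !muleA -!EFinM; congr (_%:E * _)%E.
rewrite !iposE pmulr_lgt0//; case: ltP => _; last by rewrite !(mul0r, mulr0).
by rewrite !(mul1r, mulr1); ring.
Qed.

Lemma integral_spherical (h : R3 R -> R) : measurable_fun setT h ->
  (\int[leb3 R]_x (h x)%:E =
   \int[leb3 R]_p (spherical_weight p * h (spherical_map p))%:E)%E.
Proof.
move=> mh.
have mEh : measurable_fun setT (EFin \o h) by exact/measurable_EFinP.
rewrite [LHS]integralE [RHS]integralE; congr (_ - _)%E.
  rewrite (@ge0_integral_spherical (EFin \o h)^\+%E)//; last exact: measurable_funepos.
  apply: eq_integral => p _; rewrite !funeposE /= EFinM.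
  by rewrite maxe_pMr ?mule0// lee_fin spherical_weight_ge0.
rewrite (@ge0_integral_spherical (EFin \o h)^\-%E)//; last exact: measurable_funeneg.
apply: eq_integral => p _; rewrite !funenegE.
rewrite maxe_pMr ?lee_fin ?spherical_weight_ge0// mule0.
by rewrite /= -EFinM mulrN.
Qed.

End spherical.

(** * Smooth cutoffs, and a syntax of smooth functions *)

Section bump.
Context {R : realType}.
Implicit Types (m : nat) (x : R).

(** The power [m] is carried along because differentiating e^{-1/x} x^{-m} yields a combination of
    the same functions with powers m+1 and m+2: the family is stable. *)
Definition bump m x : R := if 0 < x then expR (- x^-1) * x^-1 ^+ m else 0.

Lemma bump_ge0 m x : 0 <= bump m x.
Proof.
rewrite /bump; case: ltP => // x0.
by rewrite mulr_ge0 ?expR_ge0// exprn_ge0// invr_ge0 ltW.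
Qed.

(** A single term of the exponential series at 1/x beats any power of 1/x. With [n = 1] this is the
    quadratic vanishing at 0 that makes the bump differentiable there. *)
Lemma bump_le m n x : 0 <= x -> bump m x <= (m + n).+1`!%:R * x ^+ n.+1.
Proof.
move=> x0; rewrite /bump; case: ltP => [x_gt0|_]; last by rewrite mulr_ge0// exprn_ge0.
have u0 : 0 < x^-1 by rewrite invr_gt0.
have := expR_ge1Dxn (m + n) (ltW u0).
have f0 : 0 < (m + n).+1`!%:R :> R by rewrite ltr0n fact_gt0.
move=> h; have {}h : x^-1 ^+ (m + n).+1 <= (m + n).+1`!%:R * expR x^-1.
  by rewrite mulrC -ler_pdivrMr//; lra.
have -> : x^-1 ^+ m = x^-1 ^+ (m + n).+1 * x ^+ n.+1.
  by rewrite -addnS exprD -mulrA -exprMn mulVf ?lt0r_neq0// expr1n mulr1.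
rewrite mulrA ler_wpM2r ?exprn_ge0//.
by rewrite expRN ler_pdivrMl ?expR_gt0// mulrC.
Qed.

Lemma bump_le_fact m x : bump m x <= m`!%:R.
Proof.
rewrite /bump; case: ltP => // x0.
have u0 : 0 < x^-1 by rewrite invr_gt0.
case: m => [|m]; first by rewrite expr0 mulr1 fact0 expR_le1 oppr_le0 ltW.
have f0 : 0 < m.+1`!%:R :> R by rewrite ltr0n fact_gt0.
have h := expR_ge1Dxn m (ltW u0).
have {}h : x^-1 ^+ m.+1 <= m.+1`!%:R * expR x^-1.
  by rewrite mulrC -ler_pdivrMr//; lra.
by rewrite expRN ler_pdivrMl ?expR_gt0// mulrC.
Qed.

Lemma is_derive_bump m x :
  is_derive x 1 (bump m) (- m%:R * bump m.+1 x + bump m.+2 x).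
Proof.
have [x0|x0|->] := ltgtP x 0.
- have : is_derive x 1 (cst 0 : R -> R) 0 by exact: is_derive_cst.
  rewrite {2 3}/bump ltNge (ltW x0)/= mulr0 addr0.
  apply: near_eq_is_derive.
  near=> y; rewrite /bump ifN// -leNgt ltW//; near: y.
  exact: lt_nbhsl.
- pose h (y : R) : R := expR (- y^-1) * y^-1 ^+ m.
  have xn0 := lt0r_neq0 x0.
  have dh : is_derive x 1 h (- m%:R * bump m.+1 x + bump m.+2 x).
    have dV : is_derive x 1 (fun y : R => y^-1) (- x ^- 2).
      have did : derivable (@id R) x 1 by [].
      apply: DeriveDef; first exact: (@derivableV _ _ id x 1 xn0 did).
      by rewrite (@deriveV _ _ id x 1 xn0 did) derive_id /GRing.scale /= mulr1.
    have dN : is_derive x 1 (fun y : R => - y^-1) (x ^- 2).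
      by rewrite -[x ^- 2]opprK; exact: (is_deriveN dV).
    have dE : is_derive x 1 (expR \o (fun y : R => - y^-1)) (expR (- x^-1) * x ^- 2).
      exact: is_derive1_comp.
    have dX := is_deriveX m dV.
    have -> : h = (expR \o (fun y : R => - y^-1)) * (fun y : R => y^-1) ^+ m.
      by apply/funext => y; rewrite /h !fctE.
    refine (is_derive_eq (is_deriveM dE dX) _).
    have fX k : ((fun y : R => y^-1) ^+ k) x = x^-1 ^+ k by rewrite !fctE.
    rewrite fX /bump x0 /GRing.scale /=.
    case: (m) => [|k] /=; first by rewrite expr0; field.
    by rewrite -natr1 !exprS; field.
  apply: near_eq_is_derive dh.
  near=> y; rewrite /bump /h ifT//; near: y.
  exact: lt_nbhsr.
- have b0 k : bump k 0 = 0 by rewrite /bump ltxx.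
  rewrite !b0 mulr0 addr0.
  (* For positive h the bump is at most [C] h^2, so the difference quotient at 0 is at most [C]
     |h|. *)
  pose C : R := (m + 1).+1`!%:R.
  have cv : h^-1 *: ((bump m \o shift 0) (h *: (1 : R)) - bump m 0) @[h --> 0^'] --> (0 : R).
    apply/norm_cvg0P.
    have cC : C * `|h| @[h --> (0 : R)^'] --> (0 : R).
      rewrite -[X in _ --> X](mulr0 C); apply: cvgM; first exact: cvg_cst.
      rewrite -[X in _ --> X](@normr0 _ R); apply: cvg_norm; exact: cvg_within.
    apply: (squeeze_cvgr _ (cvg_cst 0) cC); near=> h.
    have hn0 : h != 0 by near: h; exact: nbhs_dnbhs_neq.
    rewrite normr_ge0/= b0 subr0 addr0 /GRing.scale /= mulr1 normrM normfV.
    rewrite ler_pdivrMl ?normr_gt0// (ger0_norm (bump_ge0 _ _)).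
    rewrite mulrCA -expr2; have [h0|h0] := leP 0 h.
      by rewrite (ger0_norm h0); exact: (bump_le m 1).
    by rewrite /bump ltNge (ltW h0)/= mulr_ge0 ?sqr_ge0.
  apply: DeriveDef; first exact: (cvgP _ cv).
  exact: (cvg_lim _ cv).
Unshelve. all: by end_near. Qed.

End bump.

Section smooth_expr.
Context {R : realType}.

(** Since these expressions are stable under [sderiv], every iterated partial derivative of one is
    again the value of one; smoothness follows from first-order differentiability alone. *)
Inductive sexpr : Type :=
| SCst of R
| SVar of 'I_3
| SAdd of sexpr & sexpr
| SMul of sexpr & sexpr
| SCos of sexpr
| SSin of sexpr
| SBump of nat & sexpr.

Fixpoint seval (a : sexpr) (x : R3 R) : R :=
  match a with
  | SCst c => c
  | SVar i => vec x 0 i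
  | SAdd b c => seval b x + seval c x
  | SMul b c => seval b x * seval c x
  | SCos b => cos (seval b x)
  | SSin b => sin (seval b x)
  | SBump m b => bump m (seval b x)
  end.

Fixpoint sderiv (j : 'I_3) (a : sexpr) : sexpr :=
  match a with
  | SCst c => SCst 0
  | SVar i => SCst (i == j)%:R
  | SAdd b c => SAdd (sderiv j b) (sderiv j c)
  | SMul b c => SAdd (SMul (sderiv j b) c) (SMul b (sderiv j c))
  | SCos b => SMul (SMul (SCst (-1)) (SSin b)) (sderiv j b)
  | SSin b => SMul (SCos b) (sderiv j b)
  | SBump m b => SMul (SAdd (SMul (SCst (- m%:R)) (SBump m.+1 b)) (SBump m.+2 b))
                   (sderiv j b)
  end.

Lemma derive_chain (V : normedModType R) (h : R -> R) (q : V -> R) (x v : V) (d : R) :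
  is_derive (q x) 1 h d -> differentiable q x ->
  differentiable (h \o q) x /\ 'D_v (h \o q) x = d * 'D_v q x.
Proof.
move=> dh dq; have hd : differentiable h (q x).
  by apply/derivable1_diffP; exact: ex_derive.
split; first exact: differentiable_comp.
rewrite !deriveE//; last exact: differentiable_comp.
rewrite diff_comp//= deriv1E; last exact: ex_derive.
by rewrite derive1E derive_val /GRing.scale /= mulrC.
Qed.

Lemma differentiable_fst (V W : normedModType R) (z : V * W) :
  differentiable (fst : V * W -> V) z.
Proof.
have cf : continuous (fst : V * W -> V) by move=> ?; exact: cvg_fst.
exact: linear_differentiable.
Qed.

Lemma differentiable_snd (V W : normedModType R) (z : V * W) :
  differentiable (snd : V * W -> W) z.
Proof.
have cf : continuous (snd : V * W -> W) by move=> ?; exact: cvg_snd.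
exact: linear_differentiable.
Qed.

Lemma differentiable_coord (i : 'I_3) (x : R3 R) :
  differentiable (fun y : R3 R => vec y 0 i) x.
Proof.
have d11 : differentiable (fun y : R3 R => y.1.1 : R) x.
  exact: (differentiable_comp (differentiable_fst _) (differentiable_fst _)).
have d12 : differentiable (fun y : R3 R => y.1.2 : R) x.
  exact: (differentiable_comp (differentiable_fst _) (differentiable_snd _)).
have d2 : differentiable (fun y : R3 R => y.2 : R) x by exact: differentiable_snd.
under eq_fun do rewrite mxE.
by case: i => [[|[|[|]]]] //= _.
Qed.

Lemma derive_coord (i j : 'I_3) (x : R3 R) :
  'D_(std_basis R j) (fun y : R3 R => vec y 0 i) x = (i == j)%:R.
Proof.
have c : (h^-1 *: (vec (h *: std_basis R j + x) 0 i - vec x 0 i))%R @[h --> 0^'] --> ((i == j)%:R : R).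
  apply: cvg_near_cst; near=> h.
  have hn0 : h != 0 by near: h; exact: nbhs_dnbhs_neq.
  rewrite !mxE /std_basis; case: i => [[|[|[|]]]] //= ip; case: j => [[|[|[|]]]] //= jp;
    by rewrite addrK /GRing.scale /= ?(mulr0, mulr1) ?mulVf.
exact: (cvg_lim _ c).
Unshelve. all: by end_near. Qed.

Lemma seval_derive (a : sexpr) (x : R3 R) : differentiable (seval a) x /\
  forall j, 'D_(std_basis R j) (seval a) x = seval (sderiv j a) x.
Proof.
elim: a x => [c|i|b IHb c IHc|b IHb c IHc|b IHb|b IHb|m b IHb] x /=.
- split; first exact: differentiable_cst.
  by move=> j; rewrite derive_cst.
- by split => [|j]; [exact: differentiable_coord|exact: derive_coord].
- have [db Db] := IHb x; have [dc Dc] := IHc x; split; first exact: differentiableD.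
  by move=> j; rewrite -Db -Dc; apply: deriveD; exact: diff_derivable.
- have [db Db] := IHb x; have [dc Dc] := IHc x; split; first exact: differentiableM.
  move=> j; rewrite -Db -Dc; etransitivity; first by apply: deriveM; exact: diff_derivable.
  by rewrite /GRing.scale /=; ring.
- have [db Db] := IHb x; split=> [|j].
    by have [] := derive_chain 0 (is_derive_cos (seval b x)) db.
  have [_ ->] := derive_chain (std_basis R j) (is_derive_cos (seval b x)) db.
  by rewrite Db mulN1r.
- have [db Db] := IHb x; split=> [|j].
    by have [] := derive_chain 0 (is_derive_sin (seval b x)) db.
  have [_ ->] := derive_chain (std_basis R j) (is_derive_sin (seval b x)) db.
  by rewrite Db.
- have [db Db] := IHb x; split=> [|j].
    by have [] := derive_chain 0 (is_derive_bump m (seval b x)) db.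
  have [_ ->] := derive_chain (std_basis R j) (is_derive_bump m (seval b x)) db.
  by rewrite Db.
Qed.

Lemma seval_continuous (a : sexpr) : continuous (seval a).
Proof. by move=> x; apply: differentiable_continuous; case: (seval_derive a x). Qed.

Lemma seval_smooth (a : sexpr) : smooth (seval a).
Proof.
move=> s; have [b ->] : exists b, partial s (seval a) = seval b.
  elim: s => [|j s [b IH]]; first by exists a.
  exists (sderiv j b); apply/funext => x.
  by rewrite -(seval_derive b x).2 -IH.
split; first exact: seval_continuous.
by move=> j x; apply: diff_derivable; case: (seval_derive b x).
Qed.

Definition ssq : sexpr :=
  SAdd (SAdd (SMul (SVar 0) (SVar 0)) (SMul (SVar 1) (SVar 1))) (SMul (SVar 2) (SVar 2)).

Definition sdot (xi : R3 R) : sexpr :=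
  SAdd (SAdd (SMul (SCst (vec xi 0 0)) (SVar 0)) (SMul (SCst (vec xi 0 1)) (SVar 1)))
       (SMul (SCst (vec xi 0 2)) (SVar 2)).

(** For positive [c], a radial cutoff that vanishes outside the ball of radius 1/c and equals e^{-1}
    at the origin. *)
Definition scutoff (c : R) : sexpr :=
  SBump 0 (SAdd (SCst 1) (SMul (SCst (- c ^+ 2)) ssq)).

Lemma sum3 (V : nmodType) (F : 'I_3 -> V) : \sum_j F j = F 0 + F 1 + F 2.
Proof.
rewrite !big_ord_recr big_ord0 /= add0r.
by congr (F _ + F _ + F _); apply: val_inj.
Qed.

Lemma seval_ssq x : seval ssq x = \sum_j vec x 0 j ^+ 2.
Proof. by rewrite sum3 !expr2. Qed.

Lemma seval_sdot xi x : seval (sdot xi) x = dot (vec xi) (vec x).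
Proof. by rewrite /dot sum3. Qed.

Lemma seval_scutoff c x : seval (scutoff c) x = bump 0 (1 - c ^+ 2 * \sum_j vec x 0 j ^+ 2).
Proof. by rewrite -seval_ssq /= mulNr. Qed.

Lemma seval_sderiv_sdot xi j x : seval (sderiv j (sdot xi)) x = vec xi 0 j.
Proof.
by rewrite /=; case: j => [[|[|[|]]]] //= jp; rewrite ?mulr1 ?mulr0 ?mul0r ?addr0 ?add0r; congr (_ _ _); apply: val_inj.
Qed.

Lemma seval_sderiv_scutoff c j x : seval (sderiv j (scutoff c)) x =
  - (2 * c ^+ 2 * vec x 0 j) * bump 2 (1 - c ^+ 2 * \sum_j vec x 0 j ^+ 2).
Proof.
have -> : seval (sderiv j (scutoff c)) x =
  (bump 2 (seval (SAdd (SCst 1) (SMul (SCst (- c ^+ 2)) ssq)) x)) *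
  (- c ^+ 2 * seval (sderiv j ssq) x).
  by rewrite /= ; ring.
have -> : seval (sderiv j ssq) x = 2 * vec x 0 j.
  rewrite /=; case: j => [[|[|[|]]]] //= jp;
  rewrite ?mulr1 ?mulr0 ?mul1r ?mul0r ?addr0 ?add0r mulr_natl mulr2n;
  by congr (vec _ _ _ + vec _ _ _); apply: val_inj.
have -> : seval (SAdd (SCst 1) (SMul (SCst (- c ^+ 2)) ssq)) x =
    1 - c ^+ 2 * \sum_j vec x 0 j ^+ 2 by rewrite -seval_ssq /= mulNr.
ring.
Qed.

End smooth_expr.

(** * Plane waves as test functions for the divergence *)

Section cintegral_dct.
Context {d} {T : measurableType d} {R : realType}.
Variable mu : {measure set T -> \bar R}.

(** Dominated convergence for the real and imaginary parts separately, in the form that passes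
    vanishing integrals to the limit. *)
Lemma cintegral_limit0 (F : nat -> T -> R[i]) (f : T -> R[i]) (g : T -> R) :
  (forall n, cmeas (F n)) -> cmeas f ->
  (forall x, complex.Re (F n x) @[n --> \oo] --> complex.Re (f x)) ->
  (forall x, complex.Im (F n x) @[n --> \oo] --> complex.Im (f x)) ->
  mu.-integrable setT (fun x => (g x)%:E) -> (forall n x, l1n (F n x) <= g x) ->
  (forall n, cintegral mu setT (F n) = 0) -> cintegral mu setT f = 0.
Proof.
move=> mF mf cRe cIm ig Fg F0.
have key (p : R[i] -> R) : (forall n, measurable_fun setT (fun x => p (F n x))) ->
    measurable_fun setT (fun x => p (f x)) ->
    (forall x, p (F n x) @[n --> \oo] --> p (f x)) ->
    (forall a, `|p a| <= l1n a) ->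
    (forall n, \int[mu]_x p (F n x) = 0) -> \int[mu]_x p (f x) = 0.
  move=> mpF mpf cp ple pF0.
  have [| | | | |_ _] := @dominated_convergence _ _ _ mu setT measurableT
    (fun n x => (p (F n x))%:E) (fun x => (p (f x))%:E) (fun x => (g x)%:E).
  - by move=> n; exact/measurable_EFinP.
  - exact/measurable_EFinP.
  - by apply: aeW => x _; apply: cvg_EFin; [exact: nearW|exact: cp].
  - exact: ig.
  - by apply: aeW => x n _; rewrite /= lee_fin; exact: le_trans (ple _) (Fg _ _).
  rewrite /Rintegral => cv.
  have : (fine (\int[mu]_x (p (F n x))%:E)%E) @[n --> \oo] --> fine (\int[mu]_x (p (f x))%:E)%E.
    apply: fine_cvg; rewrite fineK//; apply: integrable_fin_num => //.
    apply: le_integrable ig => //; first exact/measurable_EFinP.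
    move=> x _; rewrite /= lee_fin; apply: le_trans (ler_norm _).
    have cg : `|p (F n x)| @[n --> \oo] --> `|p (f x)| by apply: cvg_norm; exact: cp.
    rewrite -(cvg_lim _ cg)//; apply: limr_le; first exact: (cvgP _ cg).
    by apply: nearW => n; exact: le_trans (ple _) (Fg _ _).
  rewrite (_ : (fun n => fine _) = fun=> 0); last by apply/funext => n; exact: pF0.
  by move=> /(cvg_lim (@Rhausdorff R)) <-; rewrite lim_cst.
apply: complex_eq => /=.
  apply: (key (@complex.Re R)) => //.
  - by move=> n; case: (mF n).
  - by case: mf.
  - by move=> a; rewrite lerDl.
  - by move=> n; have := congr1 (@complex.Re R) (F0 n).
apply: (key (@complex.Im R)) => //.
- by move=> n; case: (mF n).
- by case: mf.
- by move=> a; rewrite lerDr.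
- by move=> n; have := congr1 (@complex.Im R) (F0 n).
Qed.

End cintegral_dct.

Section divergence.
Context {R : realType}.
Variable J : R3 R -> 'rV[R[i]]_3.
Hypothesis cJ : forall j, cintegrable (leb3 R) (fun y => J y 0 j).
Hypothesis divJ : divergence_free J.

Lemma measurable_seval (a : sexpr) : measurable_fun setT (seval a : R3 R -> R).
Proof.
have mv (i : 'I_3) : measurable_fun setT (fun x : R3 R => vec x 0 i).
  under eq_fun do rewrite mxE.
  case: i => [[|[|[|//]]]] _ /=.
  - exact: (measurableT_comp measurable_fst measurable_fst).
  - exact: (measurableT_comp measurable_snd measurable_fst).
  - exact: measurable_snd.
elim: a => [c|i|b IHb c IHc|b IHb c IHc|b IHb|b IHb|m b IHb] /=.
- by change (measurable_fun [set: R3 R] (fun=> c)).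
- exact: mv.
- exact: (measurable_funD IHb IHc).
- exact: (measurable_funM IHb IHc).
- exact: (measurableT_comp measurable_cos IHb).
- exact: (measurableT_comp measurable_sin IHb).
apply: (measurableT_comp (f := bump m) _ IHb).
apply: continuous_measurable_fun => x.
apply/differentiable_continuous/derivable1_diffP.
by have /@ex_derive := is_derive_bump m x.
Qed.

Lemma compact_box (N : R) : compact (`[- N, N] `*` `[- N, N] `*` `[- N, N] : set (R3 R)).
Proof.
apply: compact_setX; first apply: compact_setX; exact: segment_compact.
Qed.

(** Where the cutoff is nonzero every coordinate is at most 1/c in absolute value, so the support is
    a closed subset of a compact box. *)
Lemma test_function_cutoff (c : R) (a : sexpr) : 0 < c ->
  test_function (seval (SMul (scutoff c) a) : R3 R -> R).
Proof.
move=> c0; split; first exact: seval_smooth.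
have cb := @compact_box c^-1.
apply: (subclosed_compact _ cb); first exact: closed_closure.
have clb : closed (`[- c^-1, c^-1] `*` `[- c^-1, c^-1] `*` `[- c^-1, c^-1] : set (R3 R)).
  by apply: compact_closed => //; exact: norm_hausdorff.
rewrite closureE; apply: smallest_sub => // x /= /eqP ne0.
have h : 0 < 1 - c ^+ 2 * \sum_j vec x 0 j ^+ 2.
  rewrite ltNge; apply/negP => h; apply: ne0.
  have e0 : seval (scutoff c) x = 0 by rewrite seval_scutoff /bump ltNge h.
  by rewrite -[LHS]/(seval (scutoff c) x * seval a x) e0 mul0r.
have hj j : - c^-1 <= vec x 0 j <= c^-1.
  rewrite -ler_norml -(ler_pM2l c0) divff ?lt0r_neq0//.
  rewrite -(@ler_pXn2r _ 2)// ?nnegrE ?mulr_ge0// ?(ltW c0)// expr1n exprMn real_normK ?num_real//.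
  apply: le_trans (_ : c ^+ 2 * \sum_j vec x 0 j ^+ 2 <= 1); last by move: h; lra.
  rewrite ler_wpM2l ?sqr_ge0// (bigD1 j)//= lerDl sumr_ge0// => i _.
  exact: sqr_ge0.
have := hj 0; have := hj 1; have := hj 2; rewrite !mxE /= => h2 h1 h0.
by split; [split|]; rewrite /= in_itv/=.
Qed.

(** Let c = 1/(n+1). Where the bump is nonzero, c |y_j| <= 1 and c <= 1, hence 2 c^2 |y_j| <= 2,
    while [bump 2] is at most 2! = 2. The bound does not depend on [n], as domination requires. *)
Lemma cutoff_slope_le (n : nat) (j : 'I_3) (y : R3 R) :
  `|- (2 * (n.+1%:R^-1 : R) ^+ 2 * vec y 0 j)| *
    `|bump 2 (1 - (n.+1%:R^-1) ^+ 2 * \sum_j vec y 0 j ^+ 2)| <= 4.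
Proof.
set c := n.+1%:R^-1.
have c0 : 0 < c by rewrite invr_gt0.
have c1 : c <= 1 by rewrite invf_le1// ler1n.
have [h|h] := leP (1 - c ^+ 2 * \sum_j vec y 0 j ^+ 2) 0.
  by rewrite /bump ltNge h /= normr0 mulr0.
have cy : c * `|vec y 0 j| <= 1.
  rewrite -(@ler_pXn2r _ 2)// ?nnegrE ?mulr_ge0// ?(ltW c0)// expr1n exprMn real_normK ?num_real//.
  apply: le_trans (_ : c ^+ 2 * \sum_j vec y 0 j ^+ 2 <= 1); last by move: h; lra.
  rewrite ler_wpM2l ?sqr_ge0// (bigD1 j)//= lerDl sumr_ge0// => i _.
  exact: sqr_ge0.
have b2 := bump_le_fact 2 (1 - c ^+ 2 * \sum_j vec y 0 j ^+ 2).
have -> : 4 = 2 * 2`!%:R :> R by rewrite /factorial /=; lra.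
apply: ler_pM => //; last by rewrite ger0_norm ?bump_ge0.
have c20 : 0 <= 2 * c ^+ 2 by rewrite mulr_ge0// sqr_ge0.
rewrite normrN normrM (ger0_norm c20) -(mulrA 2) -[leRHS]mulr1.
rewrite ler_wpM2l// expr2 -mulrA -[leRHS]mulr1.
by apply: ler_pM => //; rewrite ?mulr_ge0// ltW.
Qed.

Lemma cintegral_limit0_dot (D : nat -> 'I_3 -> R3 R -> R) (D' : 'I_3 -> R3 R -> R) (M : R) :
  (forall n j, measurable_fun setT (D n j)) -> (forall j, measurable_fun setT (D' j)) ->
  (forall j y, D n j y @[n --> \oo] --> D' j y) -> (forall n j y, `|D n j y| <= M) ->
  (forall n, cintegral (leb3 R) setT (fun y => \sum_j J y 0 j * (D n j y)%:C) = 0) ->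
  cintegral (leb3 R) setT (fun y => \sum_j J y 0 j * (D' j y)%:C) = 0.
Proof.
move=> mD mD' cD leD.
have mJ j : cmeas (fun y => J y 0 j) by case: (cJ j).
have mS (E : 'I_3 -> R3 R -> R) : (forall j, measurable_fun setT (E j)) ->
    cmeas (fun y => \sum_j J y 0 j * (E j y)%:C).
  move=> mE; under eq_fun do rewrite sum3.
  by apply: cmeasD; first apply: cmeasD; apply: cmeasM => //; exact: cmeas_real.
have cM (p : R) j y : p * D n j y @[n --> \oo] --> p * D' j y.
  by apply: cvgM; [exact: cvg_cst|exact: cD].
apply: (@cintegral_limit0 _ _ _ (leb3 R) (fun n y => \sum_j J y 0 j * (D n j y)%:C) _
  (fun y => M * (l1n (J y 0 0) + l1n (J y 0 1) + l1n (J y 0 2)))).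
- by move=> n; exact: mS.
- exact: mS.
- move=> y; rewrite !sum3 !cReD.
  under eq_fun do rewrite sum3 !cReD !cReM /= !mulr0 !subr0.
  rewrite !cReM /= !mulr0 !subr0.
  exact: (cvgD (cvgD (cM _ _ _) (cM _ _ _)) (cM _ _ _)).
- move=> y; rewrite !sum3 !cImD.
  under eq_fun do rewrite sum3 !cImD !cImM /= !mulr0 !add0r.
  rewrite !cImM /= !mulr0 !add0r.
  exact: (cvgD (cvgD (cM _ _ _) (cM _ _ _)) (cM _ _ _)).
- have i1 := integrableD measurableT (integrableD measurableT (cJ 0).2 (cJ 1).2) (cJ 2).2.
  exact: (integrableZl measurableT M i1).
- move=> n y; rewrite sum3 (mulrDr M (_ + _)) (mulrDr M (l1n (J y 0 0))) .
  have h j : l1n (J y 0 j * (D n j y)%:C) <= M * l1n (J y 0 j).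
    apply: (le_trans (l1nM _ _)); rewrite mulrC ler_wpM2r ?l1n_ge0//.
    by rewrite /l1n /= normr0 addr0; exact: leD.
  apply: (le_trans (l1nD _ _)); apply: lerD; last exact: h.
  by apply: (le_trans (l1nD _ _)); apply: lerD; exact: h.
Qed.

Section against.
Variable a : sexpr (R := R).
Variable M : R.
Hypotheses (a_le1 : forall y, `|seval a y| <= 1)
  (da_le : forall j y, `|seval (sderiv j a) y| <= M).

(** Because [J] is integrable, bounds on [a] and its gradient replace compact support. Test with a
    cutoff times [a] and let the cutoff widen: the gradient of the cutoff tends to 0 and stays
    bounded, so only the gradient of [a] survives in the limit. *)
Lemma divergence_free_against :
  cintegral (leb3 R) setT
    (fun y => \sum_j J y 0 j * (seval (sderiv j a) y)%:C) = 0.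
Proof.
pose phi n := SMul (scutoff (n.+1%:R^-1)) a.
pose F n (y : R3 R) : R[i] := \sum_j J y 0 j * (seval (sderiv j (phi n)) y)%:C.
(* The cutoffs tend to the constant e^{-1} and not to 1; this nonzero factor is divided out at the
   end. *)
pose b : R := bump 0 1.
pose G (y : R3 R) : R[i] := \sum_j J y 0 j * (b * seval (sderiv j a) y)%:C.
have mJ j : cmeas (fun y => J y 0 j) by case: (cJ j).
have mterm j (s : sexpr) : cmeas (fun y => J y 0 j * (seval s y)%:C).
  by apply: cmeasM => //; apply: cmeas_real; exact: measurable_seval.
have F0 n : cintegral (leb3 R) setT (F n) = 0.
  have c0 : 0 < n.+1%:R^-1 :> R by rewrite invr_gt0.
  have := divJ (test_function_cutoff a c0); rewrite /distr_div => /eqP.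
  rewrite oppr_eq0 => /eqP h; rewrite -[RHS]h; apply: eq_cintegral => y _.
  by apply: eq_bigr => j _; rewrite (seval_derive _ y).2.
have cS (y : R3 R) : 1 - (n.+1%:R^-1 : R) ^+ 2 * \sum_j vec y 0 j ^+ 2 @[n --> \oo] --> (1 : R).
  have ch : (n.+1%:R^-1 : R) @[n --> \oo] --> (0 : R) by exact: cvg_harmonic.
  rewrite -[X in _ --> X]subr0 -[X in _ - X](mul0r (\sum_j vec y 0 j ^+ 2)).
  rewrite -[X in X * _](expr0n R 2).
  apply: cvgB; first exact: cvg_cst.
  apply: cvgM; last exact: cvg_cst.
  by rewrite expr2; apply: cvgM.
have cbump m (y : R3 R) : bump m (1 - (n.+1%:R^-1 : R) ^+ 2 * \sum_j vec y 0 j ^+ 2) @[n --> \oo]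
    --> bump m (1 : R).
  apply: (cvg_comp _ _ (cS y)).
  apply/differentiable_continuous/derivable1_diffP.
  by have /@ex_derive := is_derive_bump m (1 : R).
have DE n j y : seval (sderiv j (phi n)) y =
    - (2 * (n.+1%:R^-1) ^+ 2 * vec y 0 j) *
      bump 2 (1 - (n.+1%:R^-1) ^+ 2 * \sum_j vec y 0 j ^+ 2) * seval a y +
    bump 0 (1 - (n.+1%:R^-1) ^+ 2 * \sum_j vec y 0 j ^+ 2) * seval (sderiv j a) y.
  by rewrite -seval_sderiv_scutoff -seval_scutoff.
pose b2 : R := bump 2 1.
have cD j y : seval (sderiv j (phi n)) y @[n --> \oo] --> b * seval (sderiv j a) y.
  have -> : b * seval (sderiv j a) y = 0 * b2 * seval a y + b * seval (sderiv j a) y.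
    by rewrite !mul0r add0r.
  under eq_fun do rewrite DE.
  apply: cvgD; last by apply: cvgM; [exact: cbump|exact: cvg_cst].
  apply: cvgM; last exact: cvg_cst.
  apply: cvgM; last exact: cbump.
  have ch : (n.+1%:R^-1 : R) @[n --> \oo] --> (0 : R) by exact: cvg_harmonic.
  rewrite -[X in _ --> X](_ : - (2 * (0 * 0) * vec y 0 j) = 0); last first.
    by rewrite mul0r mulr0 mul0r oppr0.
  apply: cvgN; apply: cvgM; last exact: cvg_cst.
  apply: cvgM; first exact: cvg_cst.
  exact: (cvgM ch ch).
have leD n j y : `|seval (sderiv j (phi n)) y| <= 4 + M.
  rewrite DE; apply: (le_trans (ler_normD _ _)); rewrite !normrM; apply: lerD.
    rewrite -[leRHS]mulr1; apply: ler_pM => //.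
    exact: cutoff_slope_le.
  rewrite -[leRHS]mul1r; apply: ler_pM => //.
  by rewrite ger0_norm ?bump_ge0//; exact: (bump_le_fact 0).
have G0 : cintegral (leb3 R) setT G = 0.
  apply: (@cintegral_limit0_dot (fun n j y => seval (sderiv j (phi n)) y) _ (4 + M)) => //.
  - by move=> n j; exact: measurable_seval.
  - by move=> j; exact: (measurable_seval (SMul (SCst b) (sderiv j a))).
have b0 : b != 0.
  by rewrite /b /bump ltr01 mulf_neq0 ?expr0 ?oner_neq0// gt_eqF// expR_gt0.
have bC0 : b%:C != 0 :> R[i] by rewrite eq_complex /= eqxx andbT.
apply: (mulfI bC0); rewrite mulr0 -cintegralZ; last first.
  have ib j : cintegrable (leb3 R) (fun y => J y 0 j * (seval (sderiv j a) y)%:C).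
    apply: cintegrable_le (mterm _ _) (integrableZl measurableT M (cJ j).2) _ => y.
    apply: (le_trans (l1nM _ _)); rewrite mulrC ler_wpM2r ?l1n_ge0//.
    by rewrite /l1n /= normr0 addr0.
  under eq_fun do rewrite sum3.
  by apply: cintegrableD; first apply: cintegrableD.
rewrite -[RHS]G0; apply: eq_cintegral => y _; rewrite /G mulr_sumr.
by apply: eq_bigr => j _; rewrite rmorphM/= mulrCA.
Qed.

End against.

(** Test with sin(xi.y) and cos(xi.y), whose gradients are xi cos(xi.y) and -xi sin(xi.y). The first
    plus i times the second is xi e^{-i xi.y}. *)
Lemma divergence_free_transform (xi : R3 R) :
  \sum_j (vec xi 0 j)%:C * cintegral (leb3 R) setT
    (fun y => expi (- dot (vec xi) (vec y)) * J y 0 j) = 0.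
Proof.
pose M : R := \sum_j `|vec xi 0 j|.
have xiM j : `|vec xi 0 j| <= M.
  by rewrite /M (bigD1 j)//= lerDl sumr_ge0.
have hs := @divergence_free_against (SSin (sdot xi)) M.
have hc := @divergence_free_against (SCos (sdot xi)) M.
have {}hs : cintegral (leb3 R) setT (fun y => \sum_j J y 0 j *
    (cos (dot (vec xi) (vec y)) * vec xi 0 j)%:C) = 0.
  rewrite -[RHS]hs; first last.
  - move=> j y.
    have -> : seval (sderiv j (SSin (sdot xi))) y =
      cos (seval (sdot xi) y) * seval (sderiv j (sdot xi)) y by [].
    by rewrite seval_sderiv_sdot normrM (le_trans _ (xiM j))// ler_piMl// cos_max.
  - by move=> y /=; exact: sin_max.
  apply: eq_cintegral => y _; apply: eq_bigr => j _.
  by rewrite -seval_sdot -(seval_sderiv_sdot xi j y).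
have {}hc : cintegral (leb3 R) setT (fun y => \sum_j J y 0 j *
    (- sin (dot (vec xi) (vec y)) * vec xi 0 j)%:C) = 0.
  rewrite -[RHS]hc; first last.
  - move=> j y.
    have -> : seval (sderiv j (SCos (sdot xi))) y =
      -1 * sin (seval (sdot xi) y) * seval (sderiv j (sdot xi)) y by [].
    by rewrite seval_sderiv_sdot mulN1r normrM normrN (le_trans _ (xiM j))// ler_piMl// sin_max.
  - by move=> y /=; exact: cos_max.
  apply: eq_cintegral => y _; apply: eq_bigr => j _.
  by rewrite -seval_sdot -(seval_sderiv_sdot xi j y) -mulN1r.
pose th y := dot (vec xi) (vec y).
have mth : measurable_fun setT (th : R3 R -> R).
  have -> : th = seval (sdot xi) :> (R3 R -> R).
    by apply/funext => y; rewrite /th seval_sdot.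
  exact: measurable_seval.
have ig j : cintegrable (leb3 R) (fun y => expi (- th y) * J y 0 j).
  apply: (cintegrableM_bounded (M := 2)) (cJ j); last by move=> y; exact: l1n_expi.
  by apply: cmeas_expi; exact: (measurableT_comp _ mth).
have it (t : R -> R) : measurable_fun setT t -> (forall s, `|t s| <= 1) ->
    cintegrable (leb3 R) (fun y => \sum_j J y 0 j * (t (th y) * vec xi 0 j)%:C).
  move=> mt t1.
  have ij j : cintegrable (leb3 R) (fun y => J y 0 j * (t (th y) * vec xi 0 j)%:C).
    under eq_fun do rewrite mulrC.
    apply: (cintegrableM_bounded (M := `|vec xi 0 j|)) (cJ j).
      apply: cmeas_real; apply: measurable_funM => //.
      exact: (measurableT_comp mt mth).
    by move=> y; rewrite /l1n /= normr0 addr0 normrM ler_piMl.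
  under eq_fun do rewrite sum3.
  by apply: cintegrableD; first apply: cintegrableD.
have iZ j := cintegrableZ (vec xi 0 j)%:C (ig j).
rewrite sum3 -!cintegralZ; try exact: ig.
rewrite -(cintegralD (iZ 0) (iZ 1)) -(cintegralD (cintegrableD (iZ 0) (iZ 1)) (iZ 2)).
have h : cintegral (leb3 R) setT (fun y =>
    \sum_j J y 0 j * (cos (th y) * vec xi 0 j)%:C +
    'i * \sum_j J y 0 j * (- sin (th y) * vec xi 0 j)%:C) = 0.
  rewrite cintegralD; last 2 first.
  - by apply: (it cos) => [|s]; [exact: measurable_cos|exact: cos_max].
  - apply: cintegrableZ; apply: (it (fun s => - sin s)) => [|s]; last by rewrite normrN sin_max.
    exact: (measurableT_comp (@oppr_measurable R setT) measurable_sin).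
  rewrite cintegralZ ?hs ?hc ?mulr0 ?addr0//.
  apply: (it (fun s => - sin s)) => [|s]; last by rewrite normrN sin_max.
  exact: (measurableT_comp (@oppr_measurable R setT) measurable_sin).
rewrite -[RHS]h; apply: eq_cintegral => y _; rewrite !sum3 expiN.
have -> : conjc (expi (th y)) = (cos (th y))%:C + 'i * (- sin (th y))%:C.
  by apply/eqP; rewrite eq_complex cReD cImD cReM cImM /= !(mul0r, mul1r, mulr0, subr0, sub0r, oppr0, add0r, addr0) !eqxx.
by rewrite !rmorphM/=; ring.
Qed.

End divergence.

(** * The Fourier transform on space, and the balls that exhaust the frequencies *)

Section fourier3.
Context {R : realType}.
Local Notation leb := (@lebesgue_measure R).

Definition leb3s : {sigma_finite_measure set (R3 R) -> \bar R} := sprod (sprod leb leb) leb.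

Definition fourier_kernel3 (z : R3 R * R3 R) : R[i] :=
  expi (- dot (vec z.1) (vec z.2)).

Lemma dotE (x y : R3 R) :
  dot (vec x) (vec y) = x.1.1 * y.1.1 + x.1.2 * y.1.2 + x.2 * y.2.
Proof. by rewrite /dot sum3 !mxE. Qed.

Lemma dotC (x y : R3 R) : dot (vec x) (vec y) = dot (vec y) (vec x).
Proof. by rewrite !dotE; ring. Qed.

Lemma fourier_kernel3E : fourier_kernel3 =
  prod_kernel (prod_kernel fourier_kernel fourier_kernel) fourier_kernel.
Proof.
apply/funext => z; rewrite /fourier_kernel3 /prod_kernel /fourier_kernel /=.
by rewrite -!expiD dotE; congr expi; ring.
Qed.

Lemma cmeas_fourier_kernel3 : cmeas fourier_kernel3.
Proof.
rewrite fourier_kernel3E; have m1 := @cmeas_fourier_kernel R.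
by apply: cmeas_prod_kernel => //; exact: cmeas_prod_kernel.
Qed.

Lemma l1n_fourier_kernel3 z : l1n (fourier_kernel3 z) <= 2.
Proof. exact: l1n_expi. Qed.

Lemma plancherel_fourier3 :
  plancherel (leb3 R) (leb3 R) fourier_kernel3 ((2 * pi) ^+ 3).
Proof.
have pi0 := pi_ge0 R.
have h0 : 0 <= 2 * pi :> R by rewrite mulr_ge0.
have le1 (z : measurableTypeR R * measurableTypeR R) : l1n (fourier_kernel z) <= 2 by exact: l1n_expi.
have m1 := @cmeas_fourier_kernel R.
have p1 := @plancherel_fourier R.
have p2 := plancherel_prod m1 m1 le1 le1 h0 h0 p1 p1.
have m2 := cmeas_prod_kernel m1 m1.
rewrite fourier_kernel3E.
have le2 z : l1n (prod_kernel (@fourier_kernel R) (@fourier_kernel R) z) <= 2.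
  by rewrite /prod_kernel /fourier_kernel -expiD l1n_expi.
rewrite exprS mulrC expr2.
exact: (@plancherel_prod _ _ _ _ _ _ _ _ R (sprod leb leb) leb (sprod leb leb) leb
  _ _ _ _ m2 m1 le2 le1 (mulr_ge0 h0 h0) h0 p2 p1).
Qed.

(** The kernel is symmetric in its two arguments, so its adjoint is its conjugate. *)
Lemma plancherel_fourier3_adj :
  plancherel (leb3 R) (leb3 R) (fun z : R3 R * R3 R => conjc (fourier_kernel3 (z.2, z.1)))
    ((2 * pi) ^+ 3).
Proof.
have -> : (fun z : R3 R * R3 R => conjc (fourier_kernel3 (z.2, z.1))) =
    fun z => conjc (fourier_kernel3 z).
  by apply/funext => z; rewrite /fourier_kernel3 dotC.
apply: plancherel_conjc plancherel_fourier3; first exact: cmeas_fourier_kernel3.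
exact: l1n_fourier_kernel3.
Qed.

(** The condition on the sign of [r] makes balls of negative radius empty, so that the family
    increases with [r] on the whole line. *)
Definition cball (r : R) : set (R3 R) := [set x | 0 <= r /\ dot (vec x) (vec x) <= r ^+ 2].

Lemma measurable_coord (j : 'I_3) : measurable_fun setT (fun x : R3 R => vec x 0 j).
Proof. exact: (@measurable_seval R (SVar j)). Qed.

Lemma measurable_dot (x : R3 R) : measurable_fun setT (fun y : R3 R => dot (vec x) (vec y)).
Proof.
have -> : (fun y : R3 R => dot (vec x) (vec y)) = seval (sdot x).
  by apply/funext => y; rewrite seval_sdot.
exact: measurable_seval.
Qed.

Lemma measurable_dot2 : measurable_fun setT (fun y : R3 R => dot (vec y) (vec y)).
Proof.
have -> : (fun y : R3 R => dot (vec y) (vec y)) = seval (@ssq R).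
  by apply/funext => y; rewrite seval_ssq /dot; apply: eq_bigr => j _; rewrite expr2.
exact: measurable_seval.
Qed.

Lemma measurable_cball r : measurable (cball r).
Proof.
have [r0|r0] := leP 0 r; last first.
  rewrite (_ : cball r = set0)//; apply/seteqP; split => // x [].
  by rewrite leNgt r0.
have := measurable_dot2 measurableT (@measurable_itv R `]-oo, r ^+ 2]).
rewrite setTI; congr measurable.
by apply/seteqP; split => x /=; rewrite in_itv/=; [split|case].
Qed.

Definition box (N : R) : set (R3 R) := `[- N, N] `*` `[- N, N] `*` `[- N, N].

Lemma measurable_box N : measurable (box N).
Proof. by apply: measurableX => //; exact: measurableX. Qed.

Lemma leb3_box N : (leb3 R (box N) < +oo)%E.
Proof.
pose A : set (measurableTypeR R) := `[- N, N]%classic.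
have fin : (leb A < +oo)%E by rewrite lebesgue_measure_itv/=; case: ifP; rewrite ltry.
have fin1 : (leb A \is a fin_num)%E by rewrite ge0_fin_numE.
have mA : measurable A by exact: measurable_itv.
have -> : leb3 R (box N) = (leb A * leb A * leb A)%E.
  rewrite -(@product_measure1E _ _ _ _ R leb leb)//.
  rewrite -(@product_measure1E _ _ _ _ R (sprod leb leb) leb)//.
  exact: measurableX.
by rewrite -ge0_fin_numE ?fin_numM// !mule_ge0.
Qed.

Lemma cball_box r : cball r `<=` box r.
Proof.
move=> x [r0]; rewrite dotE => h.
have key (t : R) : t ^+ 2 <= r ^+ 2 -> (t \in `[- r, r]).
  by move=> tr; rewrite in_itv/= -ler_norml -(@ler_pXn2r _ 2)// ?nnegrE// real_normK ?num_real.
have := sqr_ge0 x.1.1; have := sqr_ge0 x.1.2; have := sqr_ge0 x.2.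
rewrite !expr2 => h1 h2 h3.
by split; [split|]; apply: key; rewrite expr2; lra.
Qed.

Lemma leb3_cball r : (leb3 R (cball r) < +oo)%E.
Proof.
apply: le_lt_trans (leb3_box r); apply: le_measure.
- by rewrite inE; exact: measurable_cball.
- by rewrite inE; exact: measurable_box.
- exact: cball_box.
Qed.

Lemma le_cball r s : r <= s -> cball r `<=` cball s.
Proof.
move=> rs x [r0 h]; split; first exact: le_trans rs.
by apply: le_trans h _; rewrite ler_pXn2r// ?nnegrE// (le_trans r0).
Qed.

Lemma bigcup_cball : \bigcup_n cball n%:R = setT.
Proof.
apply/seteqP; split => // x _.
have d0 : 0 <= dot (vec x) (vec x).
  by rewrite dotE -!expr2 !addr_ge0// sqr_ge0.
exists (Num.truncn (dot (vec x) (vec x))).+1 => //; split => //.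
have h := truncnS_gt (dot (vec x) (vec x)).
set n := (Num.truncn _).+1 in h *.
apply: (le_trans (ltW h)); rewrite expr2 ler_peMr//.
by rewrite ler1n.
Qed.

End fourier3.

(** * Compact essential support, L^2 norms, and integrability of the field *)

Lemma normed_compact_cover (K : realType) (V : normedModType K) (A : set V) :
  compact A -> cover_compact A.
Proof. by rewrite compact_cover. Qed.

Section ess_support_box.
Context {R : realType}.
Variable J : R3 R -> 'rV[R[i]]_3.

Let norm3E (x : R3 R) : `|x| = Num.max (Num.max `|x.1.1| `|x.1.2|) `|x.2|.
Proof. by rewrite prod_normE; congr Num.max; rewrite prod_normE. Qed.

(** Each point off the support has a neighbourhood on which [J] vanishes almost everywhere, but
    uncountably many null sets cannot be joined. So the region |x| >= M + 1 is exhausted by compact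
    sets [K n]: each is covered by finitely many neighbourhoods, and a countable union of null sets
    remains. *)
Lemma ess_support_box : compact (ess_support J) ->
  exists N : R, {ae leb3 R, forall x, ~ box N x -> J x = 0}.
Proof.
move=> /compact_bounded[M0 [_ hM]].
pose M : R := `|M0| + 1.
have MJ x : ess_support J x -> `|x| <= M.
  by apply: hM; rewrite /M (le_lt_trans (ler_norm _))// ltrDl.
pose U := [set U : set (R3 R) | open U /\ {ae leb3 R, forall x, U x -> J x = 0}].
pose K n : set (R3 R) := box n%:R `&` [set x | M + 1 <= `|x|].
have cK n : compact (K n).
  apply: (subclosed_compact _ (@compact_box R n%:R)); last by move=> x [].
  apply: closedI.
    by apply: compact_closed; [exact: norm_hausdorff|exact: compact_box].
  apply: (@closed_comp _ _ (fun x : R3 R => `|x|) [set t | M + 1 <= t]).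
    by move=> x _; exact: norm_continuous.
  exact: closed_ge.
have aeK n : {ae leb3 R, forall x, K n x -> J x = 0}.
  have : cover_compact (K n) by exact: normed_compact_cover (cK n).
  move=> /(_ _ U id) [].
  - by move=> V [].
  - move=> x [_ /= Mx]; apply: contrapT => nx.
    have := MJ x nx; rewrite leNgt => /negP; apply.
    by apply: lt_le_trans Mx; rewrite ltrDl.
  move=> D DU covD.
  have h := @filter_bigI _ _ D (fun V => [set x : R3 R | V x -> J x = 0]) _
    (ae_filter_ringOfSetsType (leb3 R)).
  apply: (filterS _ (h _)); last by move=> V /DU; rewrite inE => -[].
  by move=> x xD /covD[V VD Vx]; exact: (xD V VD Vx).
exists (M + 1).
have := @ae_foralln _ _ R (leb3 R) _ aeK; apply: filterS => x xK xM.
apply: (xK (Num.truncn `|x|).+1); split.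
  have h := truncnS_gt `|x|; set n := _.+1 in h *.
  move: h; rewrite norm3E !gt_max => /andP[/andP[h1 h2] h3].
  by split; [split|]; rewrite /= in_itv/= -ler_norml ltW.
rewrite /= leNgt; apply/negP => h; apply: xM.
move: h; rewrite norm3E !gt_max => /andP[/andP[h1 h2] h3].
by split; [split|]; rewrite /= in_itv/= -ler_norml ltW.
Qed.

End ess_support_box.

Section L2norm.
Context {R : realType}.
Implicit Types f : R3 R -> 'rV[R[i]]_3.

Lemma L2normE f : L2norm f =
  sqrte (\int[leb3 R]_x (\sum_j sqn (f x 0 j))%:E)%E.
Proof.
rewrite /L2norm unlock /= -poweR12_sqrt; last first.
  by apply: integral_ge0 => x _; rewrite lee_fin sumr_ge0// => j _; exact: sqn_ge0.
congr (poweR _ _); apply: eq_integral => x _.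
congr _%:E; rewrite /= -[2]/(2%:R) powR_mulrn// real_normK ?num_real//.
by rewrite sqr_sqrtr// sumr_ge0// => j _; exact: sqn_ge0.
Qed.

Lemma in_L2_cmeas f j : in_L2 f -> cmeas (fun x => f x 0 j).
Proof. by case=> /(_ j). Qed.

Lemma in_L2_integrable_sqn f j : in_L2 f ->
  (leb3 R).-integrable setT (fun x => (sqn (f x 0 j))%:E).
Proof.
move=> f2; have mj i : measurable_fun setT (fun x => sqn (f x 0 i)).
  by apply: measurable_sqn; exact: in_L2_cmeas.
have S0 x : 0 <= \sum_i sqn (f x 0 i) by rewrite sumr_ge0// => i _; exact: sqn_ge0.
have iS : (leb3 R).-integrable setT (fun x => (\sum_i sqn (f x 0 i))%:E).
  apply/integrableP; split; first exact/measurable_EFinP/measurable_sum.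
  under eq_integral do rewrite gee0_abs ?lee_fin//.
  have := f2.2; rewrite L2normE; case: (integral _ _ _) => [r||]//= _.
  exact: ltry.
apply: le_integrable iS => //; first exact/measurable_EFinP.
move=> x _; rewrite /= lee_fin !ger0_norm ?sqn_ge0// (bigD1 j)//= lerDl.
by rewrite sumr_ge0// => i _; exact: sqn_ge0.
Qed.

(** Almost everywhere the component is dominated by the indicator of a bounded box plus its own
    squared modulus. *)
Lemma in_L2_cintegrable f j : in_L2 f -> compact (ess_support f) ->
  cintegrable (leb3 R) (fun x => f x 0 j).
Proof.
move=> f2 /ess_support_box[N aef].
have mf := in_L2_cmeas j f2; split => //.
have mbox := @measurable_box R N.
have i1 : (leb3 R).-integrable setT (fun x => (\1_(box N) x + sqn (f x 0 j))%:E).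
  have i0 : (leb3 R).-integrable setT (fun x => (\1_(box N) x)%:E).
    apply/integrableP; split; first exact/measurable_EFinP/measurable_indic.
    under eq_integral do rewrite gee0_abs ?lee_fin//.
    by rewrite integral_indic// setIT; exact: leb3_box.
  exact: (integrableD measurableT i0 (in_L2_integrable_sqn j f2)).
apply/integrableP; split; first exact/measurable_EFinP/measurable_l1n.
have [mi oo] := integrableP _ _ _ i1.
apply: le_lt_trans oo; apply: ae_ge0_le_integral => //.
- apply: measurableT_comp => //; exact/measurable_EFinP/measurable_l1n.
- exact: measurableT_comp.
move: aef; apply: filterS => x fx _ /=; rewrite lee_fin.
rewrite !ger0_norm ?l1n_ge0//; last by rewrite addr_ge0 ?sqn_ge0// indicE.
have [xb|xb] := pselect (box N x).
  by rewrite indicE mem_set//; exact: l1n_le_sqn.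
by rewrite fx// mxE /l1n /= normr0 addr0 addr_ge0 ?sqn_ge0// indicE.
Qed.

End L2norm.

(** * Complex integrals over balls, in spherical coordinates *)

Section spherical_complex.
Context {R : realType}.
Local Notation leb := (@lebesgue_measure R).
Implicit Type h : R3 R -> R[i].

Lemma cintegral_mkcond d (T : measurableType d) (mu : {measure set T -> \bar R})
    (D : set T) (f : T -> R[i]) :
  cintegral mu D f = cintegral mu setT (fun x => (\1_D x)%:C * f x).
Proof.
have key (g : T -> R) : \int[mu]_(x in D) g x = \int[mu]_x (\1_D x * g x).
  rewrite Rintegral_mkcond; apply: eq_Rintegral => x _.
  by rewrite patchE indicE; case: ifP => _; rewrite ?mul1r ?mul0r.
apply: complex_eq => /=; rewrite key; apply: eq_Rintegral => x _ /=.
  by rewrite cReM /= mul0r subr0.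
by rewrite cImM /= mul0r addr0.
Qed.

Lemma cintegral_spherical h : cmeas h -> cintegral (leb3 R) setT h =
  cintegral (leb3 R) setT (fun p => (spherical_weight p)%:C * h (spherical_map p)).
Proof.
move=> [mr mi]; apply: complex_eq => /=; rewrite /Rintegral integral_spherical//;
  congr fine; apply: eq_integral => p _; congr _%:E.
- by rewrite cReM /= mul0r subr0.
- by rewrite cImM /= mul0r addr0.
Qed.

Lemma cintegrable_spherical h : cintegrable (leb3 R) h ->
  cintegrable (leb3 R) (fun p => (spherical_weight p)%:C * h (spherical_map p)).
Proof.
move=> [mh ih]; split.
  apply: cmeasM; first exact: (cmeas_real (@measurable_spherical_weight R)).
  exact: (cmeas_comp mh (@measurable_spherical_map R)).
have E p : l1n ((spherical_weight p)%:C * h (spherical_map p)) =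
    spherical_weight p * l1n (h (spherical_map p)).
  move: (spherical_weight p) (spherical_weight_ge0 p) (h _) => w w0 a.
  by rewrite /l1n cReM cImM /= !mul0r subr0 addr0 !normrM -mulrDr ger0_norm.
have ml := measurable_l1n mh.
apply/integrableP; split.
  apply/measurable_EFinP; under eq_fun do rewrite E.
  apply: measurable_funM; first exact: measurable_spherical_weight.
  exact: (measurableT_comp ml (@measurable_spherical_map R)).
have [_] := integrableP _ _ _ ih.
under eq_integral do rewrite gee0_abs ?lee_fin ?l1n_ge0//.
rewrite (ge0_integral_spherical (G := fun x => (l1n (h x))%:E))//; last 2 first.
- exact/measurable_EFinP.
- by move=> x; rewrite lee_fin l1n_ge0.
apply: le_lt_trans; rewrite le_eqVlt; apply/orP; left; apply/eqP.
by apply: eq_integral => p _; rewrite gee0_abs ?lee_fin ?l1n_ge0// E EFinM.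
Qed.

Lemma dot_spherical_map p (z : R3 R) : dot (vec (spherical_map p)) (vec z) =
  p.2 * dot (vec (sphere_point p.1.1 p.1.2)) (vec z).
Proof. by rewrite !dotE /=; ring. Qed.

Lemma dot_sphere_point (t u : R) :
  dot (vec (sphere_point t u)) (vec (sphere_point t u)) = 1.
Proof.
rewrite dotE /=; have h1 := cos2Dsin2 t; have h2 := cos2Dsin2 u.
transitivity (sin t ^+ 2 * (cos u ^+ 2 + sin u ^+ 2) + cos t ^+ 2); first by ring.
by rewrite h2 mulr1 addrC.
Qed.

(** The image point has squared length k^2, so membership in the ball is a condition on k alone;
    [ipos] discards the nonpositive k, whose sign the square forgets. *)
Lemma cball_spherical_map (K : R) p : 0 < K ->
  \1_(cball K) (spherical_map p) * ipos p.2 = \1_(`]0, K]%classic) p.2 :> R.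
Proof.
move=> K0; rewrite iposE indicE indicE.
have E : dot (vec (spherical_map p)) (vec (spherical_map p)) = p.2 ^+ 2.
  rewrite dot_spherical_map dotC dot_spherical_map.
  by rewrite dot_sphere_point mulr1 expr2.
have -> : (spherical_map p \in cball K) = (p.2 ^+ 2 <= K ^+ 2).
  apply/idP/idP => [|h]; first by rewrite inE /cball /= E => -[].
  by rewrite inE; split; [exact: ltW|rewrite E].
rewrite mem_setE in_itv/=; case: (ltP 0 p.2) => p0 /=; last by rewrite mulr0.
by rewrite mulr1 ler_pXn2r// nnegrE ltW.
Qed.

Lemma cintegrable_cball (K : R) :
  cintegrable (leb3 R) (fun s : R3 R => (\1_(cball K) s)%:C).
Proof.
have mB := @measurable_cball R K.
split; first exact/cmeas_real/measurable_indic.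
apply/integrableP; split; first exact/measurable_EFinP/measurable_l1n/cmeas_real/measurable_indic.
under eq_integral do rewrite /l1n /= normr0 addr0 normr_id ger0_norm ?indicE//.
by rewrite integral_indic// setIT; exact: leb3_cball.
Qed.

(** Spherical substitution followed by Fubini, arranged in the nested shape of [I_E]: a radial
    integral over ]0, K] inside an integral over the angles with area element sin theta. *)
Lemma cintegral_cball (K M : R) (T : R3 R -> R[i]) : 0 < K -> cmeas T ->
  (forall s, l1n (T s) <= M) ->
  cintegral (leb3 R) setT (fun s => (\1_(cball K) s)%:C * T s) =
  cintegral (leb2 R) (`[0, pi] `*` `[0, 2 * pi])
    (fun a => (sin a.1)%:C *
      cintegral leb `]0, K] (fun k => (k ^+ 2)%:C * T (spherical_map (a, k)))).
Proof.
move=> K0 mT TM.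
have iB : cintegrable (leb3 R) (fun s => (\1_(cball K) s)%:C * T s).
  under eq_fun do rewrite mulrC.
  exact: (cintegrableM_bounded mT TM (cintegrable_cball K)).
rewrite cintegral_spherical; last exact: iB.1.
rewrite -(@cintegral_fubini1 _ _ _ _ R (sprod leb leb) leb _ (cintegrable_spherical iB)).
rewrite [RHS]cintegral_mkcond; apply: eq_cintegral => a _.
have ik : cintegrable leb (fun k : measurableTypeR R => (\1_(`]0, K]%classic) k)%:C * ((k ^+ 2)%:C * T (spherical_map (a, k)))).
  have mk : measurable_fun setT (fun k : measurableTypeR R => \1_(`]0, K]%classic) k : R).
    exact: measurable_indic.
  have mI : cmeas (fun k : measurableTypeR R => (\1_(`]0, K]%classic) k)%:C * ((k ^+ 2)%:C * T (spherical_map (a, k)))).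
    apply: cmeasM; first exact: cmeas_real.
    apply: cmeasM; first by apply: cmeas_real; exact: exprn_measurable.
    apply: (cmeas_comp (cmeas_comp mT (@measurable_spherical_map R))).
    exact: pair1_measurable.
  have iM : leb.-integrable setT
      (fun k : measurableTypeR R => (K ^+ 2 * M * \1_(`]0, K]%classic) k)%:E).
    exact: (integrableZl measurableT (K ^+ 2 * M) (@integrable_indic_itv R 0 K false false)).
  apply: (cintegrable_le mI iM).
  move=> k; apply: (le_trans (l1nM _ _)).
  rewrite indicE mem_setE; case: (boolP (k \in `]0, K])) => kK; last first.
    by rewrite mulr0 {1}/l1n /= normr0 addr0 mul0r.
  rewrite mulr1 {1}/l1n /= normr1 normr0 addr0 mul1r.
  apply: (le_trans (l1nM _ _)); apply: ler_pM => //; rewrite ?l1n_ge0//.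
  move: kK; rewrite in_itv/= => /andP[k0 kK].
  rewrite /l1n /= normr0 addr0 ger0_norm ?sqr_ge0//.
  by rewrite ler_pXn2r// nnegrE ltW.
rewrite [in RHS]cintegral_mkcond mulrA -cintegralZ//; apply: eq_cintegral => k _.
have -> : spherical_weight (a, k) =
    \1_(`[0, pi] `*` `[0, 2 * pi]) a * sin a.1 * (ipos k * k ^+ 2).
  rewrite /spherical_weight /= !indicE in_setX !mem_setE -mulnb natrM.
  by ring.
rewrite -(cball_spherical_map (a, k) K0) /=.
by rewrite !rmorphM/=; ring.
Qed.

End spherical_complex.

(** * The far field as a Fourier transform *)

Section double_cross.
Context {F : comPzRingType}.
Implicit Types u v : 'rV[F]_3.

(** Indices of ['I_3] are added modulo 3, so j, j+1, j+2 run through all three. This cyclic form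
    matches the definition of [cross]. *)
Lemma dot_ord3 u v (j : 'I_3) :
  dot u v = u 0 j * v 0 j + u 0 (j + 1) * v 0 (j + 1) + u 0 (j + 2) * v 0 (j + 2).
Proof.
rewrite /dot sum3.
have E (i : 'I_3) : i = 0 \/ i = 1 \/ i = 2.
  by case: i => [[|[|[|//]]]] ip; [left|right; left|right; right]; exact: val_inj.
have [->|[->|->]] := E j.
- by rewrite !add0r.
- rewrite (_ : 1 + 1 = 2 :> 'I_3); last exact: val_inj.
  by rewrite (_ : 1 + 2 = 0 :> 'I_3); [ring|exact: val_inj].
- rewrite (_ : 2 + 1 = 0 :> 'I_3); last exact: val_inj.
  by rewrite (_ : 2 + 2 = 1 :> 'I_3); [ring|exact: val_inj].
Qed.

Lemma double_cross u v : cross u (cross v u) = dot u u *: v - dot u v *: u.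
Proof.
apply/rowP => j; rewrite !mxE.
have e12 : j + 1 + 2 = j by rewrite -addrA (_ : 1 + 2 = 0) ?addr0//; exact: val_inj.
have e21 : j + 2 + 1 = j by rewrite -addrA (_ : 2 + 1 = 0) ?addr0//; exact: val_inj.
have e11 : j + 1 + 1 = j + 2 by rewrite -addrA; congr (_ + _); exact: val_inj.
have e22 : j + 2 + 2 = j + 1 by rewrite -addrA; congr (_ + _); exact: val_inj.
rewrite e12 e21 e11 e22 !(dot_ord3 _ _ j); ring.
Qed.

End double_cross.

Section far_field.
Context {R : realType}.
Local Notation leb := (@lebesgue_measure R).
Variables (eps : R) (J : R3 R -> 'rV[R[i]]_3).
Hypothesis eps_gt0 : 0 < eps.
Hypothesis cJ : forall j, cintegrable (leb3 R) (fun y => J y 0 j).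
Hypothesis divJ : divergence_free J.

Let f j (y : R3 R) : R[i] := J y 0 j.
Let T j : R3 R -> R[i] := transform (@leb3s R) (@fourier_kernel3 R) (f j).

Lemma vintegral_transform (x : R3 R) : vintegral (leb3 R) setT
    (fun y => expi (- dot (vec x) (vec y)) *: J y) = \row_j T j x.
Proof.
by apply/rowP => j; rewrite !mxE; apply: eq_cintegral => y _; rewrite mxE.
Qed.

Let c1 : R[i] := 'i / (4 * pi * Num.sqrt eps)%:C.

(** The double cross product is |x|^2 A - (x.A) x, with |x| = 1 and A the transform of [J] at k x.
    The second term is 0: [divergence_free_transform] gives (k x).A = 0, and k is positive. *)
Lemma E_far_sphere (t u k : R) : 0 < k -> E_far eps J (sphere_point t u) k =
  (k%:C * c1) *: \row_j T j (spherical_map ((t, u), k)).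
Proof.
move=> k0; set x := sphere_point t u; rewrite /E_far.
have -> : vintegral (leb3 R) setT (fun y => expi (- (k * dot (vec x) (vec y))) *: J y) =
    \row_j T j (spherical_map ((t, u), k)).
  rewrite -vintegral_transform; congr vintegral; apply/funext => y.
  by rewrite dot_spherical_map.
set A := \row_j _; rewrite double_cross.
have -> : dot (cvec x) (cvec x) = 1.
  rewrite -(rmorph1 (real_complex R)) -(dot_sphere_point t u) /dot rmorph_sum/=.
  by apply: eq_bigr => j _; rewrite [cvec x 0 j]mxE rmorphM.
have -> : dot (cvec x) A = 0.
  have kC : k%:C != 0 :> R[i] by rewrite eq_complex /= eqxx andbT gt_eqF.
  apply: (mulfI kC); rewrite mulr0.
  rewrite -[RHS](divergence_free_transform cJ divJ (spherical_map ((t, u), k))).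
  rewrite /dot mulr_sumr; apply: eq_bigr => j _.
  rewrite mulrA [cvec x 0 j]mxE [A 0 j]mxE -rmorphM/=; congr (_%:C * _).
  rewrite !mxE /x /sphere_point /spherical_map /=.
  by case: j => [[|[|[|//]]]] jp /=.
rewrite scale0r subr0 scale1r; congr (_ *: _).
by rewrite /c1; ring.
Qed.

(** The factors -i and i multiply to 1 and the square roots of [eps] cancel, leaving 1/(8 pi^3), the
    normalisation of Fourier inversion in dimension three. *)
Lemma far_field_constant :
  (- 'i * (Num.sqrt eps)%:C / (2 * pi ^+ 2)%:C) * c1 =
  (((2 * pi) ^+ 3)^-1)%:C :> R[i].
Proof.
have s0 : Num.sqrt eps != 0 by rewrite gt_eqF// sqrtr_gt0.
have p0 : (pi : R) != 0 by rewrite gt_eqF// pi_gt0.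
rewrite /c1; move: (Num.sqrt eps) (pi : R) s0 p0 => s p s0 p0.
have -> : (((2 * p) ^+ 3)^-1)%:C = (s / (2 * p ^+ 2) / (4 * p * s))%:C :> R[i].
  by congr (_%:C); field; rewrite s0 p0.
have ii : - 'i * 'i = 1 :> R[i] by rewrite mulNr -expr2 sqr_i opprK.
have E (a b c : R) : (a / b / c)%:C = a%:C / b%:C / c%:C :> R[i].
  by rewrite !rmorphM/= !fmorphV.
rewrite E; set a := s%:C; set b := (_)%:C; set c := (_)%:C.
by rewrite -[RHS]mul1r -ii; ring.
Qed.

Lemma conjc_fourier_kernel3 (s z : R3 R) :
  conjc (fourier_kernel3 (s, z)) = expi (dot (vec s) (vec z)).
Proof. by rewrite /fourier_kernel3 -expiN opprK. Qed.

(** One factor k comes from the far field and one from [I_E]; together they are the k^2 of the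
    spherical volume element. Truncating wave numbers at [K] is therefore truncating frequencies to
    the ball of radius [K]. *)
Lemma I_E_partial_inverse (K : R) (z : R3 R) j : 0 < K ->
  I_E eps J K z 0 j =
  partial_inverse (@leb3s R) (@leb3s R) (@fourier_kernel3 R) ((2 * pi) ^+ 3)
    (f j) (cball K) z.
Proof.
move=> K0; rewrite /I_E /partial_inverse [LHS]mxE [X in _ * X = _]mxE.
have mT : cmeas (T j) by exact: (@cmeas_transform _ _ _ _ R (@leb3s R) _ (@cmeas_fourier_kernel3 R) _ (cJ j)).
pose B := 2 * fine (\int[@leb3s R]_x (l1n (f j x))%:E).
have TB s : l1n (T j s) <= B.
  exact: (@l1n_transform_le _ _ _ _ R (@leb3s R) _ (@cmeas_fourier_kernel3 R)
    (@l1n_fourier_kernel3 R) _ (cJ j)).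
pose G s := expi (dot (vec s) (vec z)) * T j s.
have mG : cmeas G.
  apply: cmeasM => //; apply: cmeas_expi; under eq_fun do rewrite dotC.
  exact: measurable_dot.
have GB s : l1n (G s) <= 2 * B.
  by apply: (le_trans (l1nM _ _)); apply: ler_pM; rewrite ?l1n_ge0 ?l1n_expi.
have mcG : cmeas (fun s => c1 * G s) by apply: cmeasM => //; exact: cmeas_cst.
have cGB s : l1n (c1 * G s) <= l1n c1 * (2 * B).
  by apply: (le_trans (l1nM _ _)); apply: ler_wpM2l; rewrite ?l1n_ge0.
have := cintegral_cball K0 mcG cGB => E.
transitivity ((- 'i * (Num.sqrt eps)%:C / (2 * pi ^+ 2)%:C) *
    cintegral (leb3 R) setT (fun s => (\1_(cball K) s)%:C * (c1 * G s))).
  congr (_ * _); rewrite E; apply: eq_cintegral => a _.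
  rewrite [LHS]mxE; congr (_ * _); rewrite mxE; apply: eq_cintegral => k.
  rewrite inE/= in_itv/= => /andP[k0 _].
  rewrite E_far_sphere// !mxE /G dot_spherical_map /=.
  by rewrite rmorphXn/= -surjective_pairing; ring.
have iB : cintegrable (leb3 R) (fun s => (\1_(cball K) s)%:C * G s).
  under eq_fun do rewrite mulrC.
  exact: (cintegrableM_bounded mG GB (cintegrable_cball K)).
transitivity ((- 'i * (Num.sqrt eps)%:C / (2 * pi ^+ 2)%:C) *
    (c1 * cintegral (leb3 R) setT (fun s => (\1_(cball K) s)%:C * G s))).
  congr (_ * _); rewrite -cintegralZ//; apply: eq_cintegral => s _.
  by rewrite mulrCA.
rewrite mulrA far_field_constant; congr (_ * _); apply: eq_cintegral => s _.
by rewrite conjc_fourier_kernel3 /G /trunc_transform mulrCA.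
Qed.

End far_field.

Theorem theorem3p1 (R : realType) (eps : R) (J : R3 R -> 'rV[R[i]]_3) :
  0 < eps -> in_L2 J -> compact (ess_support J) -> divergence_free J ->
  L2_cvg_pinfty (I_E eps J) J.
Proof.
move=> eps0 J2 sJ divJ.
have cJ j := in_L2_cintegrable j J2 sJ.
have iJ j := in_L2_integrable_sqn j J2.
have mk := @cmeas_fourier_kernel3 R; have kle := @l1n_fourier_kernel3 R.
have pl := @plancherel_fourier3 R; have pla := @plancherel_fourier3_adj R.
have c0 : 0 < (2 * pi) ^+ 3 :> R by rewrite exprn_gt0// mulr_gt0// pi_gt0.
pose P r j := partial_inverse (@leb3s R) (@leb3s R) (@fourier_kernel3 R)
  ((2 * pi) ^+ 3) (fun y => J y 0 j) (cball r).
have IE r z j : 0 < r -> I_E eps J r z 0 j = P r j z.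
  exact: I_E_partial_inverse.
have mB r := @measurable_cball R r; have fB r := @leb3_cball R r.
have mP r j : cmeas (P r j) by exact: (@cmeas_partial_inverse _ _ _ _ R (@leb3s R) (@leb3s R) _ _ mk _ (cJ j) _ (mB r)).
have iP r j : (leb3 R).-integrable setT (fun x => (sqn (P r j x))%:E).
  exact: (@integrable_sqn_partial_inverse _ _ _ _ R (@leb3s R) (@leb3s R)
    _ _ mk kle pl pla _ (cJ j) (iJ j) _ (mB r) (fB r)).
(* By |a - b|^2 <= 2 |a|^2 + 2 |b|^2. *)
have iPJ r j : (leb3 R).-integrable setT (fun x => (sqn (P r j x - J x 0 j))%:E).
  have i1 := integrableD measurableT (integrableZl measurableT 2 (iP r j))
    (integrableZl measurableT 2 (iJ j)).
  apply: (le_integrable measurableT _ _ i1) => [|x _].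
    apply/measurable_EFinP/measurable_sqn.
    under eq_fun do rewrite -mulN1r.
    apply: cmeasD => //; apply: cmeasM; first exact: cmeas_cst.
    exact: in_L2_cmeas.
  rewrite /= lee_fin !ger0_norm ?sqn_ge0//; last first.
    by rewrite addr_ge0// mulr_ge0// sqn_ge0.
  move: (P r j x) (J x 0 j) => a b; rewrite /sqn !cReD !cImD !cReN !cImN.
  have := sqr_ge0 (complex.Re a + complex.Re b).
  by have := sqr_ge0 (complex.Im a + complex.Im b); lra.
have sum_int (g : 'I_3 -> R3 R -> R) : (forall j, (leb3 R).-integrable setT (fun x => (g j x)%:E)) ->
    (\int[leb3 R]_x (\sum_j g j x)%:E)%E = (\sum_j \int[leb3 R]_x g j x)%:E.
  move=> ig; under eq_integral do rewrite -sumEFin.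
  rewrite integral_sum//.
  by rewrite -sumEFin; apply: eq_bigr => j _; rewrite -EFin_Rintegral//; exact: ig.
split.
  move=> r r0; split.
    by move=> j; have [mr mi] := mP r j; split; under eq_fun do rewrite IE//.
  rewrite L2normE; under eq_integral do under eq_bigr do rewrite IE//.
  by rewrite (sum_int (fun j x => sqn (P r j x)))//= ltry.
(* The error is the root of the sum of the three componentwise squared errors, each of which tends
   to 0 by [partial_inverse_cvg]. *)
have L2E r : 0 < r -> L2norm (fun x => I_E eps J r x - J x) =
    (Num.sqrt (\sum_j \int[leb3 R]_x sqn (P r j x - J x 0 j)))%:E.
  move=> r0; rewrite L2normE -[RHS]/(sqrte _%:E) -sum_int//; congr sqrte.
  apply: eq_integral => x _; congr _%:E; apply: eq_bigr => j _.
  by rewrite mxE [X in _ + X]mxE IE.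
have cv j : \int[leb3 R]_x sqn (P r j x - J x 0 j) @[r --> +oo] --> (0 : R).
  apply/cvgrPdist_le => e e0.
  have [r1 h] := @partial_inverse_cvg _ _ _ _ R (@leb3s R) (@leb3s R) _ _ mk kle c0 pl pla
    _ (cJ j) (iJ j) _ mB fB (@le_cball R) (@bigcup_cball R) e e0.
  near=> r; rewrite sub0r normrN ger0_norm; last first.
    by apply: Rintegral_ge0 => x _; exact: sqn_ge0.
  by apply: h; near: r; apply: nbhs_pinfty_ge; rewrite num_real.
have cvS : Num.sqrt (\sum_j \int[leb3 R]_x sqn (P r j x - J x 0 j)) @[r --> +oo] --> (0 : R).
  have cS : \sum_j \int[leb3 R]_x sqn (P r j x - J x 0 j) @[r --> +oo] --> (0 + 0 + 0 : R).
    under eq_fun do rewrite sum3.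
    exact: (cvgD (cvgD (cv 0) (cv 1)) (cv 2)).
  have := cvg_comp _ _ cS (@sqrt_continuous R _).
  by rewrite !addr0 sqrtr0.
apply: cvg_EFin.
  near=> r; rewrite L2E//.
apply: cvg_trans cvS; apply: near_eq_cvg; near=> r.
by rewrite /= L2E.
Unshelve. all: by end_near. Qed.
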